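(* Let $\lambda\in\mathbb{R}$ and fix $t>0$. For each integer $n\ge1$ let $(\gamma_i^{(\sqrt n)})_{i\ge0}$ be i.i.d. with law $GIG(\lambda,\sqrt n,\sqrt n)$, let $\delta_n=\frac1n$, and for $m\ge0$ let $b_m^{(\delta_n)}$ be the random matrix $$b_m^{(\delta_n)}=\begin{pmatrix}X_m&0\\ Z_m^{(\delta_n)}&X_m^{-1}\end{pmatrix},\quad X_m=\prod_{i=0}^{m-1}\gamma_i^{(\sqrt n)},\quad Z_m^{(\delta_n)}=\delta_n\sum_{k=0}^{m-1}\Big(\prod_{i=0}^{k-1}\big(\gamma_i^{(\sqrt n)}\big)^{-1}\Big)\Big(\prod_{j=k+1}^{m-1}\gamma_j^{(\sqrt n)}\Big).$$ Then, when $n\to+\infty$, $$b_{\lfloor nt\rfloor}^{(\delta_n)}\ \overset{\text{law}}{\longrightarrow}\ \begin{pmatrix}e^{B_t^{(\lambda)}}&0\\ e^{B_t^{(\lambda)}}\int_0^te^{-2B_s^{(\lambda)}}ds&e^{-B_t^{(\lambda)}}\end{pmatrix},$$ where $B_t^{(\lambda)}=B_t+\lambda t$ and $(B_t)_{t\ge0}$ is a standard one-dimensional Brownian motion.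
   Context: Empty products equal $1$ and empty sums equal $0$. For $a>0$ and $\lambda\in\mathbb{R}$, $GIG(\lambda,a,a)$ (Generalized Inverse Gaussian) is the probability law on $(0,+\infty)$ with density $x\mapsto \frac{1}{2K_\lambda(a^2)}x^{\lambda-1}e^{-\frac{a^2}{2}(x+\frac1x)}$, where $K_\lambda(z)=\frac12\int_0^{+\infty}x^{\lambda-1}e^{-\frac z2(x+\frac1x)}dx$ for $z>0$ is the Macdonald function. Equivalently $b_m^{(\delta_n)}=g_0g_1\cdots g_{m-1}$ with $g_i=\begin{pmatrix}\gamma_i^{(\sqrt n)}&0\\ \delta_n&(\gamma_i^{(\sqrt n)})^{-1}\end{pmatrix}$. *)

(* Defs.v *)
From HB Require Import structures.
From mathcomp Require Import all_boot all_order all_algebra.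
From mathcomp Require Import all_classical all_reals all_analysis.

Set Implicit Arguments.
Unset Strict Implicit.
Unset Printing Implicit Defensive.

Import Order.TTheory GRing.Theory Num.Theory.
Import numFieldNormedType.Exports.

Local Open Scope classical_set_scope.
Local Open Scope ring_scope.

Definition macdonald (R : realType) (lambda z : R) : R :=
  2^-1 * \int[lebesgue_measure]_(x in `]0, +oo[)
           (x `^ (lambda - 1) * expR (- (z / 2 * (x + x^-1)))).

(* Density of GIG(lambda, a, a), extended by 0 to the whole line. *)
Definition gig_pdf (R : realType) (lambda a x : R) : R :=
  if 0 < x then
    (2 * macdonald lambda (a ^+ 2))^-1
      * (x `^ (lambda - 1) * expR (- (a ^+ 2 / 2 * (x + x^-1))))
  else 0.

Definition has_gig_law (R : realType) (d : measure_display)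
    (T : measurableType d) (P : probability T R) (lambda a : R)
    (X : {RV P >-> R}) : Prop :=
  forall A : set R, measurable A ->
    distribution P X A
      = (\int[lebesgue_measure]_(x in A) (gig_pdf lambda a x)%:E)%E.

(* The product rule is required for every finite subfamily J. *)
Definition mutually_independent (R : realType) (d d' : measure_display)
    (T : measurableType d) (T' : measurableType d') (P : probability T R)
    (I : choiceType) (X : I -> T -> T') : Prop :=
  forall (J : seq I) (A : I -> set T'), uniq J ->
    (forall i, measurable (A i)) ->
    P (\big[setI/setT]_(i <- J) (X i @^-1` A i))
      = (\prod_(i <- J) P (X i @^-1` A i))%E.

(* Only the values B s with 0 <= s are constrained.  The second parameter of
   normal_prob is the standard deviation. *)
Record standard_brownian_motion (R : realType) (d : measure_display)
    (T : measurableType d) (P : probability T R) (B : R -> {RV P >-> R})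
    : Prop := {
  brownian_start : {ae P, forall w, B 0 w = 0};
  brownian_continuous :
    forall w, {within `[0, +oo[, continuous (fun s : R => B s w)};
  brownian_increment : forall s u : R, 0 <= s -> s < u ->
    forall A : set R, measurable A ->
      P [set w | A (B u w - B s w)] = normal_prob 0 (Num.sqrt (u - s)) A;
  brownian_independent : forall u : nat -> R,
    0 <= u 0%N -> nondecreasing_seq u ->
    mutually_independent P (fun (i : nat) w => B (u i.+1) w - B (u i) w)
}.

Definition random_element (d : measure_display) (T : measurableType d)
    (E : topologicalType) (X : T -> E) : Prop :=
  forall U : set E, open U -> measurable (X @^-1` U).

(* Each X n may live on its own probability space. *)
Definition cvg_in_law (R : realType) (d : nat -> measure_display)
    (T : forall n, measurableType (d n)) (P : forall n, probability (T n) R)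
    (d' : measure_display) (T' : measurableType d') (Q : probability T' R)
    (E : topologicalType) (X : forall n, T n -> E) (Y : T' -> E) : Prop :=
  [/\ forall n, random_element (X n),
      random_element Y
    & forall f : E -> R, continuous f ->
        (exists M : R, forall x, `|f x| <= M) ->
        ('E_(P n)[fun w => f (X n w)] @[n --> \oo]
           --> 'E_Q[fun w => f (Y w)])%E].

Definition lower_mx (R : realType) (x z y : R) : 'M[R]_2 :=
  \matrix_(i < 2, j < 2)
    if i == 0 then (if j == 0 then x else 0) else (if j == 0 then z else y).

Definition walk_X (R : realType) (g : nat -> R) (m : nat) : R :=
  \prod_(0 <= i < m) g i.

Definition walk_Z (R : realType) (delta : R) (g : nat -> R) (m : nat) : R :=
  delta * \sum_(0 <= k < m)
    ((\prod_(0 <= i < k) (g i)^-1) * (\prod_(k.+1 <= j < m) g j)).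

Definition walk_b (R : realType) (delta : R) (g : nat -> R) (m : nat)
    : 'M[R]_2 :=
  lower_mx (walk_X g m) (walk_Z delta g m) (walk_X g m)^-1.

Definition drifted (R : realType) (lambda : R) (b : R -> R) (s : R) : R :=
  b s + lambda * s.

Definition limit_mx (R : realType) (b : R -> R) (t : R) : 'M[R]_2 :=
  lower_mx (expR (b t))
    (expR (b t) * \int[lebesgue_measure]_(s in `[0, t]) expR (- (2 * b s)))
    (expR (- b t)).

(* Main.v *)
(** The observable of the walk is the pair p = 1/(1+X), v = 1/(1+Z) in (0,1]^2,
    which determines the matrix. Freezing all factors but one, x, turns both into
    functions x |-> 1/(1 + a x + b + c/x) with a, b, c >= 0. With y = sinh (ln x),
    these have a second-order expansion in y with error O(|y|^3) uniformly in
    a, b, c and x, and so has any polynomial in (p, v). Lindeberg's method then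
    replaces the factors one at a time by the lognormal increments
    exp (B_(i+1)/n - B_i/n + lambda/n): each replacement costs o(1/n), because
    for both laws the first, second and fourth moments of y, multiplied by n, tend to
    lambda, 1 and 0; in the GIG case this follows by integrating by parts.
    The lognormal walk converges along each Brownian path, its lower left entry being
    a Riemann sum. Bernstein polynomials extend the convergence of expectations from
    nonnegative polynomials in (p, v) to bounded continuous functions of the matrix;
    these are singular on the edges p = 0, p = 1 and v = 0 of the square, which the
    limit law does not charge. *)
Require Import Defs.
From HB Require Import structures.
From mathcomp Require Import all_boot all_order all_algebra.
From mathcomp Require Import all_classical all_reals all_analysis.
From mathcomp Require Import measurable_realfun ring lra.

Set Implicit Arguments.
Unset Strict Implicit.
Unset Printing Implicit Defensive.

Import Order.TTheory GRing.Theory Num.Theory.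
Import numFieldNormedType.Exports.

Local Open Scope classical_set_scope.
Local Open Scope ring_scope.

(** * Second-order expansions in sinh *)

(** The variable [y = sinh (ln x)] suits both ends of the comparison. Powers of [y] are Laurent
    polynomials in [x], whose GIG expectations are combinations of Macdonald functions of shifted
    index; their three-term recurrence then yields the moments without any asymptotics of
    [K_lambda]. Since the observables are bounded, the cubic error term also covers large
    increments, and no truncation occurs. The Brownian factors live on one space for all [n], so a
    pathwise limit takes the place of a functional limit theorem. Test functions are kept
    nonnegative for two reasons: Tonelli can resample one factor at a time, and a polynomial cutoff
    with small expectation under the limit law has small expectation under the walk for large [n],
    which stands in for tightness. The GIG estimates need [n] large with respect to [lambda], hence
    the eventual form of the moment hypotheses. *)

(* [sinh (ln x)], for [0 < x]. *)
Definition sinhv {R : realFieldType} (x : R) : R := (x - x^-1) / 2.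

(** One constant bounds the function, the coefficients and the cubic remainder, so that uniformity
    in parameters is a statement about [C] alone. The bound on [F] controls the range of large
    [sinhv x]. The coefficient [f0] is bounded implicitly: the remainder vanishes at [x = 1], so
    [f0 = F 1]. *)
Definition jet {R : realFieldType} (C : R) (F : R -> R) : Prop :=
  (forall x, 0 < x -> `|F x| <= C) /\
  exists f0 f1 f2 : R, [/\ `|f1| <= C, `|f2| <= C
    & forall x, 0 < x ->
      `|F x - (f0 + f1 * sinhv x + f2 * sinhv x ^+ 2)| <= C * `|sinhv x| ^+ 3].

Section jets.
Variable R : realFieldType.
Implicit Types (F G : R -> R) (C D x : R).

Lemma sinhv1 : sinhv 1 = 0 :> R.
Proof. by rewrite /sinhv invr1 subrr mul0r. Qed.

Lemma jet_ge0 C F : jet C F -> 0 <= C.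
Proof. by move=> [/(_ 1 ltr01) h _]; exact: le_trans (normr_ge0 _) h. Qed.

Lemma jet_le C D F : C <= D -> jet C F -> jet D F.
Proof.
move=> CD [FC [f0 [f1 [f2 [h1 h2 h]]]]]; split.
  by move=> x x0; exact: le_trans (FC x x0) CD.
exists f0, f1, f2; split; [exact: le_trans h1 CD|exact: le_trans h2 CD|].
move=> x x0; apply: le_trans (h x x0) _.
by rewrite ler_wpM2r// exprn_ge0.
Qed.

Lemma jet_cst (c : R) : jet `|c| (fun=> c).
Proof.
split=> // ; exists c, 0, 0; split; rewrite ?normr0 ?normr_ge0// => x x0.
by rewrite !mul0r !addr0 subrr normr0 mulr_ge0// exprn_ge0.
Qed.

Lemma jetD C D F G : jet C F -> jet D G -> jet (C + D) (fun x => F x + G x).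
Proof.
move=> [FC [f0 [f1 [f2 [hf1 hf2 hf]]]]] [GC [g0 [g1 [g2 [hg1 hg2 hg]]]]].
split.
  by move=> x x0; rewrite (le_trans (ler_normD _ _))// lerD ?FC ?GC.
exists (f0 + g0), (f1 + g1), (f2 + g2); split.
- by rewrite (le_trans (ler_normD _ _))// lerD.
- by rewrite (le_trans (ler_normD _ _))// lerD.
move=> x x0; set y := sinhv x.
have -> : F x + G x - (f0 + g0 + (f1 + g1) * y + (f2 + g2) * y ^+ 2) =
  (F x - (f0 + f1 * y + f2 * y ^+ 2)) + (G x - (g0 + g1 * y + g2 * y ^+ 2)).
  by ring.
by rewrite (le_trans (ler_normD _ _))// mulrDl lerD ?hf ?hg.
Qed.

(** Multiply the expansions and drop the degrees 3 and 4. With [t] the modulus of [sinhv x], the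
    error terms for [t <= 1] cost 1, 3, 2 and 1 times [C * D * t ^+ 3]; for [t > 1] boundedness
    gives [2 + 2 * t + 3 * t ^+ 2], again at most [7 * t ^+ 3]. *)
Lemma jetM C D F G : jet C F -> jet D G -> jet (7 * (C * D)) (fun x => F x * G x).
Proof.
move=> jF jG; have C0 := jet_ge0 jF; have D0 := jet_ge0 jG.
move: jF jG => [FC [f0 [f1 [f2 [hf1 hf2 hf]]]]] [GC [g0 [g1 [g2 [hg1 hg2 hg]]]]].
have CD0 : 0 <= C * D by rewrite mulr_ge0.
have CD7 : C * D <= 7 * (C * D) by rewrite ler_peMl// ler1n.
have nM a b : `|a| <= C -> `|b| <= D -> `|a * b| <= C * D.
  by move=> ha hb; rewrite normrM ler_pM.
have hf0 : `|f0| <= C.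
  have := hf 1 ltr01; rewrite sinhv1 expr2 !mulr0 normr0 !addr0 expr0n mulr0 normr_le0.
  by rewrite subr_eq0 => /eqP <-; exact: FC.
have hg0 : `|g0| <= D.
  have := hg 1 ltr01; rewrite sinhv1 expr2 !mulr0 normr0 !addr0 expr0n mulr0 normr_le0.
  by rewrite subr_eq0 => /eqP <-; exact: GC.
split.
  by move=> x x0; rewrite (le_trans _ CD7)// nM ?FC ?GC.
have h0 : `|f0 * g0| <= C * D by exact: nM.
have h1 : `|f0 * g1 + f1 * g0| <= 2 * (C * D).
  by rewrite (le_trans (ler_normD _ _))// (_ : 2 * _ = C * D + C * D) ?lerD ?nM//; ring.
have h2 : `|f0 * g2 + f1 * g1 + f2 * g0| <= 3 * (C * D).
  rewrite (le_trans (ler_normD _ _))// (_ : 3 * _ = C * D + C * D + C * D); last by ring.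
  by rewrite lerD ?nM// (le_trans (ler_normD _ _))// lerD ?nM.
exists (f0 * g0), (f0 * g1 + f1 * g0), (f0 * g2 + f1 * g1 + f2 * g0); split.
- by rewrite (le_trans h1)// ler_wpM2r// ler_nat.
- by rewrite (le_trans h2)// ler_wpM2r// ler_nat.
move=> x x0; set y := sinhv x; set t := `|y|.
have t0 : 0 <= t by exact: normr_ge0.
have nt : `|y ^+ 2| = t ^+ 2 by rewrite normrX.
have [t1|t1] := leP t 1; last first.
  have FG : `|F x * G x| <= C * D by rewrite nM ?FC ?GC.
  apply: le_trans (_ : C * D + (C * D + 2 * (C * D) * t + 3 * (C * D) * t ^+ 2) <= _).
    rewrite (le_trans (ler_normB _ _))// lerD//.
    rewrite (le_trans (ler_normD _ _))// lerD//; last by rewrite normrM nt ler_wpM2r// exprn_ge0.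
    by rewrite (le_trans (ler_normD _ _))// lerD// normrM ler_wpM2r.
  have t3 : 1 <= t ^+ 3 by rewrite exprn_ege1// ltW.
  have t13 : t <= t ^+ 3.
    by rewrite exprS ler_peMr// exprn_ege1// ltW.
  have t23 : t ^+ 2 <= t ^+ 3 by rewrite (exprS _ 2) ler_peMl ?exprn_ge0// ltW.
  have -> : C * D + (C * D + 2 * (C * D) * t + 3 * (C * D) * t ^+ 2) =
     (2 + 2 * t + 3 * t ^+ 2) * (C * D) by ring.
  rewrite (mulrAC 7) ler_wpM2r//; lra.
set pf := f0 + f1 * y + f2 * y ^+ 2; set pg := g0 + g1 * y + g2 * y ^+ 2.
have -> : F x * G x - (f0 * g0 + (f0 * g1 + f1 * g0) * y +
     (f0 * g2 + f1 * g1 + f2 * g0) * y ^+ 2) =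
   (F x - pf) * G x + (pf * (G x - pg) +
    ((f1 * g2 + f2 * g1) * y ^+ 3 + f2 * g2 * y ^+ 4)).
  by rewrite /pf /pg; ring.
have t2 : t ^+ 2 <= 1 by rewrite exprn_ile1.
have hpf : `|pf| <= 3 * C.
  rewrite (_ : 3 * C = C + C * 1 + C * 1); last by ring.
  rewrite (le_trans (ler_normD _ _))// lerD//; last by rewrite normrM nt ler_pM// exprn_ge0.
  by rewrite (le_trans (ler_normD _ _))// lerD// normrM ler_pM.
have -> : 7 * (C * D) * t ^+ 3 = C * t ^+ 3 * D + (3 * C * (D * t ^+ 3) +
   (2 * (C * D) * t ^+ 3 + C * D * t ^+ 3)) by ring.
rewrite (le_trans (ler_normD _ _))// lerD//.
  by rewrite normrM ler_pM// ?hf ?GC.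
rewrite (le_trans (ler_normD _ _))// lerD//.
  by rewrite normrM ler_pM// hg.
rewrite (le_trans (ler_normD _ _))// lerD//.
  rewrite normrM normrX ler_wpM2r ?exprn_ge0//.
  rewrite (le_trans (ler_normD _ _))// (_ : 2 * _ = C * D + C * D); last by ring.
  by rewrite lerD// nM.
rewrite normrM normrX ler_pM ?nM// ?exprn_ge0//.
by rewrite (exprS _ 3) ler_piMl// exprn_ge0.
Qed.

Definition homog (a b c x : R) : R := (1 + a * x + b + c / x)^-1.

Lemma homog_gt0 a b c x : 0 <= a -> 0 <= b -> 0 <= c -> 0 < x ->
  0 < 1 + a * x + b + c / x.
Proof.
move=> a0 b0 c0 x0.
by rewrite !ltr_wpDr ?ltr01 ?mulr_ge0 ?invr_ge0 ?(ltW x0).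
Qed.

Lemma homog_ge0 a b c x : 0 <= a -> 0 <= b -> 0 <= c -> 0 < x ->
  0 <= homog a b c x <= 1.
Proof.
move=> a0 b0 c0 x0.
rewrite /homog invr_ge0 ltW ?homog_gt0//= invf_le1 ?homog_gt0//.
by rewrite -!addrA lerDl !addr_ge0 ?mulr_ge0 ?invr_ge0 ?(ltW x0).
Qed.

(** Here [w] is [cosh (ln x) - 1]: the linear equations write [x] and [x^-1] as cosh plus or minus
    sinh, and the last one is [cosh ^ 2 - sinh ^ 2 = 1]. *)
Lemma sinhv_cosh x : 0 < x -> exists w, [/\ 0 <= w, x = 1 + sinhv x + w,
  x^-1 = 1 - sinhv x + w & sinhv x ^+ 2 = w ^+ 2 + 2 * w].
Proof.
move=> x0; exists ((x + x^-1) / 2 - 1); split.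
- have -> : (x + x^-1) / 2 - 1 = (x - 1) ^+ 2 / x / 2 by field; lra.
  by rewrite !divr_ge0 ?sqr_ge0// ltW.
- by rewrite /sinhv; field; lra.
- by rewrite /sinhv; field; lra.
- by rewrite /sinhv; field; lra.
Qed.

(** With [D] the denominator at [x = 1], the denominator at [x] is [D * (1 + s)] where
    [s = k * y + th * w] and [|k| <= th <= 1] whatever [a], [b], [c]: uniformity comes from there.
    Since [w] is [y ^+ 2 / 2] up to order four, the geometric expansion in [s] becomes one in
    [y]. *)
Lemma jet_homog a b c : 0 <= a -> 0 <= b -> 0 <= c -> jet 30 (homog a b c).
Proof.
move=> a0 b0 c0; split.
  move=> x x0; have /andP[h0 h1] := homog_ge0 a0 b0 c0 x0.
  by rewrite ger0_norm// (le_trans h1)// ler1n.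
set D := 1 + a + b + c; have D1 : 1 <= D by rewrite /D; lra.
have D0 : 0 < D by lra.
have iD1 : D^-1 <= 1 by rewrite invf_le1.
have iD0 : 0 <= D^-1 by rewrite invr_ge0 ltW.
pose k := (a - c) / D; pose th := (a + c) / D.
have th0 : 0 <= th by rewrite divr_ge0// ?addr_ge0// ltW.
have th1 : th <= 1 by rewrite ler_pdivrMr// mul1r /D; lra.
have k1 : `|k| <= th.
  rewrite ler_norml; apply/andP; split.
    by rewrite -mulNr ler_pM2r ?invr_gt0//; lra.
  by rewrite ler_pM2r ?invr_gt0//; lra.
have k2 : k ^+ 2 <= 1.
  by rewrite -real_normK ?num_real// exprn_ile1// (le_trans k1).
have f1b : `|- k / D| <= 1.
  rewrite normrM normrN ger0_norm// -[leRHS]mul1r.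
  by rewrite ler_pM// (le_trans k1).
have f2b : `|(k ^+ 2 - th / 2) / D| <= 1.
  rewrite normrM (ger0_norm iD0) -[leRHS]mul1r ler_pM//.
  by rewrite ler_norml; have := sqr_ge0 k; lra.
exists D^-1, (- k / D), ((k ^+ 2 - th / 2) / D); split.
- by rewrite (le_trans f1b)// ler1n.
- by rewrite (le_trans f2b)// ler1n.
move=> x x0; set y := sinhv x.
have [w [w0 xE xVE yw]] := sinhv_cosh x0.
rewrite -/y in xE xVE yw; set t := `|y|.
have t0 : 0 <= t by exact: normr_ge0.
have tE : t ^+ 2 = w ^+ 2 + 2 * w by rewrite -yw /t real_normK ?num_real.
have [t1|t1] := leP t 1; last first.
  have t3 : 1 <= t ^+ 3 by rewrite exprn_ege1// ltW.
  have t13 : t <= t ^+ 3 by rewrite exprS ler_peMr// exprn_ege1// ltW.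
  have t23 : t ^+ 2 <= t ^+ 3 by rewrite (exprS _ 2) ler_peMl ?exprn_ge0// ltW.
  have /andP[h0 h1] := homog_ge0 a0 b0 c0 x0.
  apply: (@le_trans _ _ (1 + (1 + 1 * t + 1 * t ^+ 2))); last by lra.
  rewrite (le_trans (ler_normB _ _))// lerD//; first by rewrite ger0_norm.
  rewrite (le_trans (ler_normD _ _))// lerD//; last first.
    by rewrite normrM normrX ler_pM// exprn_ge0.
  rewrite (le_trans (ler_normD _ _))// lerD//; first by rewrite ger0_norm.
  by rewrite normrM ler_pM.
pose s := k * y + th * w.
have DsE : 1 + a * x + b + c / x = D * (1 + s).
  have -> : a * x = a * (1 + y + w) by rewrite -xE.
  have -> : c / x = c * (1 - y + w) by rewrite -xVE.
  rewrite /s /k /th.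
  have -> : D * (1 + ((a - c) / D * y + (a + c) / D * w)) =
     D + (a - c) * y + (a + c) * w by field; lra.
  by rewrite /D; ring.
(* For [|y| <= 1] both [x] and [x^-1] are at least [sqrt 2 - 1 > 3^-1]. Hence [1 + s >= 3^-1], and
   the geometric remainder [s ^+ 3 / (1 + s)] is at most [(2 * t) ^+ 3 * 3]. *)
have [x3 xV3] : 3^-1 <= x /\ 3^-1 <= x^-1.
  have : `|y| <= 1 by []. rewrite ler_norml => /andP[y1 y2].
  have xx : x * x^-1 = 1 by rewrite divff// gt_eqF.
  have : 0 < x^-1 by rewrite invr_gt0.
  by move: y1 y2; rewrite /y /sinhv; split; nra.
have s1 : 3^-1 <= 1 + s.
  have -> : 1 + s = (1 + a * x + b + c / x) / D by rewrite DsE; field; lra.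
  rewrite ler_pdivlMr// /D.
  have : 0 <= a * (x - 3^-1) by rewrite mulr_ge0// subr_ge0.
  have : 0 <= c * (x^-1 - 3^-1) by rewrite mulr_ge0// subr_ge0.
  lra.
have wt2 : w <= t ^+ 2 / 2 by have := sqr_ge0 w; lra.
have t2t : t ^+ 2 <= t by rewrite expr2 ler_piMl.
have wt : w <= t by lra.
have st : `|s| <= 2 * t.
  rewrite /s; apply: le_trans (ler_normD _ _) _.
  rewrite (normrM k) (normrM th) (ger0_norm th0) (ger0_norm w0).
  rewrite -/t (_ : 2 * t = 1 * t + 1 * t); last by ring.
  by rewrite lerD// ler_pM// (le_trans k1).
(* The terms linear in [w] cancel: as [y ^+ 2 = w ^+ 2 + 2 * w], the part [- th / 2] of the second
   coefficient accounts for the [- th * w] coming from [- s]. What is left has order three in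
   [y]. *)
have -> : homog a b c x - (D^-1 + - k / D * y + (k ^+ 2 - th / 2) / D * y ^+ 2) =
  D^-1 * (- (s ^+ 3 / (1 + s)) + (th * w ^+ 2 / 2 + 2 * (k * th) * (y * w) +
    th ^+ 2 * w ^+ 2)).
  rewrite /homog DsE yw.
  have y2 : (k * y) ^+ 2 = k ^+ 2 * (w ^+ 2 + 2 * w) by rewrite exprMn yw.
  have -> : (D * (1 + s))^-1 = D^-1 * (1 - s + s ^+ 2 - s ^+ 3 / (1 + s)).
    by field; rewrite !gt_eqF//; lra.
  have -> : s ^+ 2 = (k * y) ^+ 2 + 2 * (k * y) * (th * w) + (th * w) ^+ 2.
    by rewrite /s; ring.
  by rewrite y2 /s; field; rewrite !gt_eqF//; rewrite -/s; lra.
have w2 : w ^+ 2 <= t ^+ 3 / 2.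
  rewrite expr2 (_ : t ^+ 3 / 2 = t * (t ^+ 2 / 2)); last by ring.
  by rewrite ler_pM.
have t3 : 0 <= t ^+ 3 by rewrite exprn_ge0.
rewrite normrM ger0_norm//.
apply: (@le_trans _ _ (1 * (24 * t ^+ 3 + 2 * t ^+ 3))); last by lra.
apply: ler_pM => //.
rewrite (le_trans (ler_normD _ _))// lerD//.
  rewrite normrN normrM normrX.
  rewrite (_ : 24 * t ^+ 3 = (2 * t) ^+ 3 * 3); last by ring.
  apply: ler_pM; rewrite ?exprn_ge0//.
    by rewrite lerXn2r// nnegrE// mulr_ge0.
  have s0 : 0 < 1 + s by lra.
  by rewrite normfV gtr0_norm// -[leRHS]invrK lef_pV2// posrE// invr_gt0.
rewrite (_ : 2 * t ^+ 3 = 1 * (t ^+ 3 / 2) / 2 + 2 * (1 * 1) * (t * (t ^+ 2 / 2)) +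
  1 * (t ^+ 3 / 2) + t ^+ 3 / 4); last by field.
apply: (@le_trans _ _ (1 * (t ^+ 3 / 2) / 2 + 2 * (1 * 1) * (t * (t ^+ 2 / 2)) +
  1 * (t ^+ 3 / 2))); last by lra.
rewrite (le_trans (ler_normD _ _))// lerD//; last first.
  have th2 : 0 <= th ^+ 2 by rewrite exprn_ge0.
  have ww : 0 <= w ^+ 2 by rewrite exprn_ge0.
  rewrite ger0_norm; last exact: mulr_ge0.
  by apply: ler_pM => //; rewrite exprn_ile1.
rewrite (le_trans (ler_normD _ _))// lerD//.
  have thw : 0 <= th * w ^+ 2 by rewrite mulr_ge0// exprn_ge0.
  rewrite ger0_norm; last by rewrite divr_ge0.
  rewrite ler_wpM2r ?invr_ge0 ?ler0n//.
  by apply: ler_pM => //; exact: exprn_ge0.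
rewrite (normrM (2 * (k * th))) (normrM 2) (normrM k) (normrM y).
rewrite (ger0_norm th0) (ger0_norm w0) (ger0_norm (ler0n _ 2)).
have kth : `|k| * th <= 1 * 1 by apply: ler_pM => //; exact: le_trans k1 th1.
have kth0 : 0 <= `|k| * th by rewrite mulr_ge0.
apply: ler_pM; [by rewrite mulr_ge0|by rewrite mulr_ge0| |by rewrite ler_wpM2l].
by rewrite ler_wpM2l.
Qed.
End jets.

(** * Bernstein polynomials in two variables *)

(** A closure predicate on functions instead of a type of polynomials: jets, measurability and
    limits each follow by one induction. *)
Inductive poly2 {R : realFieldType} : (R -> R -> R) -> Prop :=
| poly2_cst c : poly2 (fun _ _ => c)
| poly2_fst : poly2 (fun p _ => p)
| poly2_snd : poly2 (fun _ v => v)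
| poly2_add f g : poly2 f -> poly2 g -> poly2 (fun p v => f p v + g p v)
| poly2_mul f g : poly2 f -> poly2 g -> poly2 (fun p v => f p v * g p v).

(* [bernstein N h p] is the expectation of [h] under the binomial law with
   parameters [N] and [p]. *)
Fixpoint bernstein {R : realFieldType} (N : nat) (h : nat -> R) (p : R) : R :=
  if N is N'.+1 then
    p * bernstein N' (fun k => h k.+1) p + (1 - p) * bernstein N' h p
  else h 0%N.

Section bernstein.
Variable R : realFieldType.
Implicit Types (h : nat -> R) (p v : R).

Lemma bernstein_add N h1 h2 p :
  bernstein N (fun k => h1 k + h2 k) p = bernstein N h1 p + bernstein N h2 p.
Proof. by elim: N h1 h2 => //= N IH h1 h2; rewrite !IH; ring. Qed.

Lemma bernstein_scale N c h p :
  bernstein N (fun k => c * h k) p = c * bernstein N h p.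
Proof. by elim: N h => //= N IH h; rewrite !IH; ring. Qed.

Lemma bernstein_cst N c p : bernstein N (fun=> c) p = c.
Proof. by elim: N => //= N ->; ring. Qed.

Lemma bernstein_subc N h c p :
  bernstein N (fun k => h k - c) p = bernstein N h p - c.
Proof. by rewrite bernstein_add bernstein_cst. Qed.

Lemma bernstein_le N h1 h2 p : 0 <= p <= 1 ->
  (forall k, (k <= N)%N -> h1 k <= h2 k) ->
  bernstein N h1 p <= bernstein N h2 p.
Proof.
move=> /andP[p0 p1]; elim: N h1 h2 => [|N IH] h1 h2 h12 /=; first exact: h12.
apply: lerD; (apply: ler_wpM2l; first by rewrite ?subr_ge0); apply: IH => k kN; apply: h12 => //.
exact: leqW.
Qed.

(** The centre [x] is arbitrary because conditioning on one trial moves it to [x - 1] in the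
    induction; at [x = N%:R * p] the formula is the binomial variance. *)
Lemma bernstein_variance N x p :
  bernstein N (fun k => (k%:R - x) ^+ 2) p = N%:R * p * (1 - p) + (N%:R * p - x) ^+ 2.
Proof.
elim: N x => [|N IH] x /=; first by ring.
have -> : (fun k : nat => (k.+1%:R - x) ^+ 2) = (fun k : nat => (k%:R - (x - 1)) ^+ 2).
  by apply/funext => k; rewrite -natr1; ring.
by rewrite !IH -natr1; ring.
Qed.

(** The coefficients [F k] may depend on both variables so that a Bernstein sum in [v] can serve as
    a coefficient of the one in [p]. *)
Lemma poly2_bernstein N (F : nat -> R -> R -> R) (e : R -> R -> R) :
  poly2 e -> (forall k, poly2 (F k)) ->
  poly2 (fun p v => bernstein N (fun k => F k p v) (e p v)).
Proof.
move=> pe; elim: N F => [|N IH] F pF /=; first exact: pF.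
apply: poly2_add; first by apply: poly2_mul => //; exact: IH.
apply: poly2_mul; last exact: IH.
apply: poly2_add; first exact: poly2_cst.
have -> : (fun p v => - e p v) = (fun p v => -1 * e p v).
  by apply/funext => p; apply/funext => v; rewrite mulN1r.
by apply: poly2_mul => //; exact: poly2_cst.
Qed.

Definition bernstein2 N (g : R -> R -> R) p v :=
  bernstein N (fun k => bernstein N (fun l => g (k%:R / N%:R) (l%:R / N%:R)) v) p.

Lemma poly2_bernstein2 N g : poly2 (bernstein2 N g).
Proof.
apply: (@poly2_bernstein N (fun k _ v =>
  bernstein N (fun l => g (k%:R / N%:R) (l%:R / N%:R)) v)); first exact: poly2_fst.
move=> k; apply: (@poly2_bernstein N (fun l _ _ => g (k%:R / N%:R) (l%:R / N%:R))).
  exact: poly2_snd.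
by move=> l; exact: poly2_cst.
Qed.

Lemma bernstein_norm N h p : 0 <= p <= 1 ->
  `|bernstein N h p| <= bernstein N (fun k => `|h k|) p.
Proof.
move=> p01; rewrite ler_norml; apply/andP; split.
  rewrite -mulN1r -bernstein_scale; apply: bernstein_le => // k _.
  by rewrite mulN1r lerNl ler_normr lexx orbT.
by apply: bernstein_le => // k _; exact: ler_norm.
Qed.

(** Chebyshev's inequality. Within distance [d] in both coordinates [g] varies by at most [e];
    otherwise by at most [2 * M], which [K] times a squared deviation dominates. Each of the two
    variances is at most [N%:R], so each coordinate contributes [2 * M / d ^+ 2 / N%:R]. *)
Lemma bernstein2_approx N g p v (M e d : R) : (0 < N)%N ->
  0 <= p <= 1 -> 0 <= v <= 1 -> 0 < d ->
  (forall a b a' b' : R, 0 <= a <= 1 -> 0 <= b <= 1 -> 0 <= a' <= 1 -> 0 <= b' <= 1 ->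
     `|a - a'| < d -> `|b - b'| < d -> `|g a b - g a' b'| <= e) ->
  (forall a b : R, 0 <= a <= 1 -> 0 <= b <= 1 -> `|g a b| <= M) ->
  `|bernstein2 N g p v - g p v| <= e + 4 * M / d ^+ 2 / N%:R.
Proof.
move=> N0 p01 v01 d0 ge gM.
have N0' : 0 < N%:R :> R by rewrite ltr0n.
have M0 : 0 <= M by apply: le_trans (gM p v p01 v01).
have e0 : 0 <= e.
  by apply: le_trans (ge p v p v p01 v01 p01 v01 _ _); rewrite ?normr_ge0// subrr normr0.
pose K := 2 * M / d ^+ 2 / N%:R ^+ 2.
have K0 : 0 <= K by rewrite !divr_ge0 ?mulr_ge0 ?exprn_ge0// ltW.
have -> : bernstein2 N g p v - g p v = bernstein N (fun k => bernstein N
    (fun l => g (k%:R / N%:R) (l%:R / N%:R) - g p v) v) p.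
  rewrite /bernstein2 -bernstein_subc; congr bernstein.
  by apply/funext => k; rewrite bernstein_subc.
have frac k : (k <= N)%N -> 0 <= (k%:R / N%:R : R) <= 1.
  by move=> kN; rewrite divr_ge0//= ler_pdivrMr// mul1r ler_nat.
have key k l : (k <= N)%N -> (l <= N)%N ->
    `|g (k%:R / N%:R) (l%:R / N%:R) - g p v| <=
    e + K * (k%:R - N%:R * p) ^+ 2 + K * (l%:R - N%:R * v) ^+ 2.
  move=> kN lN.
  have sqK (j : nat) (q : R) : d <= `|j%:R / N%:R - q| -> 2 * M <= K * (j%:R - N%:R * q) ^+ 2.
    move=> dj; have -> : K * (j%:R - N%:R * q) ^+ 2 = 2 * M * ((j%:R / N%:R - q) ^+ 2 / d ^+ 2).
      by rewrite /K; field; rewrite !gt_eqF.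
    rewrite ler_peMr ?mulr_ge0// ler_pdivlMr ?exprn_gt0// mul1r.
    by rewrite -[leRHS]real_normK ?num_real// lerXn2r// nnegrE ltW.
  have Kk : 0 <= K * (k%:R - N%:R * p) ^+ 2 by rewrite mulr_ge0// sqr_ge0.
  have Kl : 0 <= K * (l%:R - N%:R * v) ^+ 2 by rewrite mulr_ge0// sqr_ge0.
  have gg : `|g (k%:R / N%:R) (l%:R / N%:R) - g p v| <= 2 * M.
    apply: le_trans (ler_normB _ _) _; rewrite (_ : 2 * M = M + M); last by ring.
    by apply: lerD; apply: gM => //; exact: frac.
  have [h1|/sqK] := ltP `|k%:R / N%:R - p| d; last by lra.
  have [h2|/sqK] := ltP `|l%:R / N%:R - v| d; last by lra.
  apply: (@le_trans _ _ e); last by lra.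
  by apply: ge => //; exact: frac.
apply: le_trans (bernstein_norm _ _ p01) _.
apply: (@le_trans _ _ (bernstein N (fun k => e + K * (k%:R - N%:R * p) ^+ 2 +
   K * (N%:R * v * (1 - v))) p)).
  apply: bernstein_le => // k kN; apply: le_trans (bernstein_norm _ _ v01) _.
  apply: (@le_trans _ _ (bernstein N (fun l => e + K * (k%:R - N%:R * p) ^+ 2 +
    K * (l%:R - N%:R * v) ^+ 2) v)).
    by apply: bernstein_le => // l lN; exact: key.
  by rewrite bernstein_add bernstein_cst bernstein_scale bernstein_variance subrr expr0n addr0.
rewrite !bernstein_add !bernstein_cst bernstein_scale bernstein_variance subrr expr0n addr0.
have var (q : R) : 0 <= q <= 1 -> K * (N%:R * q * (1 - q)) <= 2 * M / d ^+ 2 / N%:R.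
  move=> /andP[q0 q1].
  have -> : K * (N%:R * q * (1 - q)) = 2 * M / d ^+ 2 / N%:R * (q * (1 - q)).
    by rewrite /K; field; rewrite !gt_eqF.
  rewrite ler_piMr//; first by rewrite !divr_ge0 ?mulr_ge0 ?exprn_ge0// ltW.
  by rewrite mulr_ile1// ?subr_ge0//; lra.
have := var p p01; have := var v v01.
have -> : 4 * M / d ^+ 2 / N%:R = 2 * M / d ^+ 2 / N%:R + 2 * M / d ^+ 2 / N%:R.
  by field; rewrite !gt_eqF.
lra.
Qed.

Lemma bernstein2_ge0 N g p v : 0 <= p <= 1 -> 0 <= v <= 1 ->
  (forall a b : R, 0 <= a <= 1 -> 0 <= b <= 1 -> 0 <= g a b) -> 0 <= bernstein2 N g p v.
Proof.
move=> p01 v01 g0.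
have frac k : (k <= N)%N -> 0 <= (k%:R / N%:R : R) <= 1.
  move=> kN; rewrite divr_ge0//=; have [->|N0] := posnP N; first by rewrite invr0 mulr0.
  by rewrite ler_pdivrMr ?ltr0n// mul1r ler_nat.
rewrite -[leLHS](bernstein_cst N 0 p); apply: bernstein_le => // k kN.
rewrite -[leLHS](bernstein_cst N 0 v); apply: bernstein_le => // l lN.
by apply: g0; exact: frac.
Qed.

End bernstein.

(** [C] is chosen before [F] and [G]: a single constant serves for all frozen values of the other
    factors. *)
Lemma poly2_jet (R : realFieldType) (f : R -> R -> R) (K : R) : poly2 f -> exists C,
  forall F G, jet K F -> jet K G -> jet C (fun x => f (F x) (G x)).
Proof.
elim=> [c|||g h _ [C HC] _ [D HD]|g h _ [C HC] _ [D HD]].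
- by exists `|c| => F G _ _; exact: jet_cst.
- by exists K.
- by exists K.
- by exists (C + D) => F G jF jG; apply: jetD; [exact: HC|exact: HD].
- by exists (7 * (C * D)) => F G jF jG; apply: jetM; [exact: HC|exact: HD].
Qed.

(** * Recursions and independence for the walk *)

Section walk_recursion.
Variable R : realType.
Implicit Types (g : nat -> R) (delta : R).

Lemma walk_X0 g : walk_X g 0 = 1.
Proof. by rewrite /walk_X big_geq. Qed.

Lemma walk_XS g m : walk_X g m.+1 = walk_X g m * g m.
Proof. by rewrite /walk_X big_nat_recr. Qed.

Lemma walk_Z0 delta g : walk_Z delta g 0 = 0.
Proof. by rewrite /walk_Z big_geq// mulr0. Qed.

Lemma walk_ZS delta g m :
  walk_Z delta g m.+1 = walk_Z delta g m * g m + delta / walk_X g m.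
Proof.
rewrite /walk_Z /walk_X big_nat_recr//= mulrDr; congr (_ + _).
  rewrite -mulrA; congr (_ * _); rewrite big_distrl/=.
  apply: eq_big_nat => k /andP[_ km].
  by rewrite -mulrA; congr (_ * _); rewrite big_nat_recr.
by rewrite [X in _ * (_ * X)]big_geq// mulr1 prodfV.
Qed.

Lemma walk_X_add g k r :
  walk_X g (k + r) = walk_X g k * walk_X (fun i => g (k + i)%N) r.
Proof.
elim: r => [|r IH]; first by rewrite addn0 walk_X0 mulr1.
by rewrite addnS !walk_XS IH mulrA.
Qed.

(** Lower left entry of a matrix product: the first [k] factors times the walk of the shifted
    factors. [walk_X_add] is the upper left entry. *)
Lemma walk_Z_add delta g k r :
  walk_Z delta g (k + r) = walk_Z delta g k * walk_X (fun i => g (k + i)%N) r +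
    (walk_X g k)^-1 * walk_Z delta (fun i => g (k + i)%N) r.
Proof.
elim: r => [|r IH]; first by rewrite addn0 walk_X0 walk_Z0 mulr1 mulr0 addr0.
by rewrite addnS !walk_ZS walk_XS IH walk_X_add invfM; ring.
Qed.

Lemma eq_walk_X g g' m : (forall i, (i < m)%N -> g i = g' i) ->
  walk_X g m = walk_X g' m.
Proof. by move=> gg'; apply: eq_big_nat => i /andP[_]; exact: gg'. Qed.

Lemma eq_walk_Z delta g g' m : (forall i, (i < m)%N -> g i = g' i) ->
  walk_Z delta g m = walk_Z delta g' m.
Proof.
elim: m => [|m IH] gg'; first by rewrite !walk_Z0.
rewrite !walk_ZS gg'// IH; last by move=> i im; apply: gg'; exact: ltnW.
by rewrite (@eq_walk_X g g')// => i im; apply: gg'; exact: ltnW.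
Qed.

Lemma walk_X_gt0 g m : (forall i, 0 < g i) -> 0 < walk_X g m.
Proof. by move=> g0; apply: prodr_gt0. Qed.

Lemma walk_Z_ge0 delta g m : 0 <= delta -> (forall i, 0 < g i) ->
  0 <= walk_Z delta g m.
Proof.
move=> d0 g0; elim: m => [|m IH]; first by rewrite walk_Z0.
rewrite walk_ZS addr_ge0//; first by rewrite mulr_ge0// ltW.
by rewrite divr_ge0// ltW// walk_X_gt0.
Qed.

End walk_recursion.

Section walk_measurable.
Context (R : realType) (d : measure_display) (T : measurableType d).

Lemma measurable_funVr (f : T -> R) : measurable_fun setT f ->
  measurable_fun setT (fun w => (f w)^-1).
Proof.
(* The square makes the base nonnegative, as [powR_inv1] requires; at a zero of [f] both sides are 0
   because the inverse of 0 is 0. *)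
move=> mf; have -> : (fun w => (f w)^-1) = (fun w => f w * (f w ^+ 2) `^ (-1)).
  apply/funext => w; rewrite powR_inv1 ?sqr_ge0// expr2 invfM.
  by have [->|f0] := eqVneq (f w) 0; rewrite ?mul0r ?invr0// mulrA divff// mul1r.
apply: measurable_funM => //.
apply: (measurableT_comp (measurable_powR (-1))); exact: measurable_funX.
Qed.

Lemma measurable_walk_X (g : nat -> T -> R) m :
  (forall i, (i < m)%N -> measurable_fun setT (g i)) ->
  measurable_fun setT (fun w => walk_X (fun i => g i w) m).
Proof.
elim: m => [|m IH] mg.
  by under eq_fun do rewrite walk_X0; exact: measurable_cst.
under eq_fun do rewrite walk_XS.
by apply: measurable_funM; [apply: IH => i im; apply: mg; exact: ltnW|exact: mg].
Qed.

Lemma measurable_walk_Z delta (g : nat -> T -> R) m :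
  (forall i, (i < m)%N -> measurable_fun setT (g i)) ->
  measurable_fun setT (fun w => walk_Z delta (fun i => g i w) m).
Proof.
elim: m => [|m IH] mg.
  by under eq_fun do rewrite walk_Z0; exact: measurable_cst.
under eq_fun do rewrite walk_ZS.
have mg' i : (i < m)%N -> measurable_fun setT (g i) by move=> im; exact/mg/ltnW.
apply: measurable_funD; first by apply: measurable_funM; [exact: IH|exact: mg].
by apply: measurable_funM => //; apply: measurable_funVr; exact: measurable_walk_X.
Qed.

Lemma measurable_poly2 (f : R -> R -> R) (F G : T -> R) : poly2 f ->
  measurable_fun setT F -> measurable_fun setT G ->
  measurable_fun setT (fun w => f (F w) (G w)).
Proof.
move=> pf mF mG; elim: pf => // [g h _ mg _ mh|g h _ mg _ mh].
- exact: measurable_funD.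
- exact: measurable_funM.
Qed.

End walk_measurable.

Section independence.
Context (R : realType) (d : measure_display) (T : measurableType d).
Variable P : probability T R.
Local Open Scope ereal_scope.

(** Independence on rectangles identifies the joint law with the product of the marginals; Tonelli
    then replaces [W] by an independent copy. *)
Lemma ge0_integral_indep (d1 d2 : measure_display) (T1 : measurableType d1)
    (T2 : measurableType d2) (V : T -> T1) (W : T -> T2) (f : T1 * T2 -> \bar R) :
  measurable_fun setT V -> measurable_fun setT W ->
  (forall A B, measurable A -> measurable B ->
     P (V @^-1` A `&` W @^-1` B) = P (V @^-1` A) * P (W @^-1` B)) ->
  measurable_fun setT f -> (forall x, 0 <= f x) ->
  \int[P]_w f (V w, W w) = \int[P]_w \int[P]_w' f (V w, W w').
Proof.
move=> mV mW VW mf f0.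
pose V' : {RV P >-> T1} := HB.pack V (isMeasurableFun.Build _ _ _ _ V mV).
pose W' : {RV P >-> T2} := HB.pack W (isMeasurableFun.Build _ _ _ _ W mW).
have mVW : measurable_fun setT (fun w => (V w, W w)) by exact: measurable_fun_pair.
pose VW' : {RV P >-> (T1 * T2)%type} :=
  HB.pack (fun w => (V w, W w)) (isMeasurableFun.Build _ _ _ _ _ mVW).
transitivity (\int[distribution P VW']_z f z).
  by rewrite ge0_integral_distribution.
transitivity (\int[distribution P V' \x distribution P W']_z f z).
  apply: eq_measure_integral => A mA _; apply/esym.
  by apply: product_measure_unique => // B1 B2 mB1 mB2; rewrite -VW.
rewrite (fubini_tonelli1 f mf f0) ge0_integral_distribution//; last 2 first.
- exact: measurable_fun_fubini_tonelli_F.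
- by move=> x; apply: integral_ge0.
apply: eq_integral => w _ /=; rewrite /fubini_F ge0_integral_distribution//.
exact: measurableT_comp.
Qed.

(** Cylinders in the variables of index below [N] other than [k] are stable under intersection, and
    on them the finite measures [mrestr P mXB] and [mscale p P] agree; uniqueness of measures
    extends this to the generated sigma-algebra. [G] is exposed so that any functional measurable
    for it, such as a partial walk, is seen to be independent of [X k]. *)
Lemma mutually_independent_split (X : nat -> T -> R) (N k : nat) :
  (forall i, measurable_fun setT (X i)) -> mutually_independent P X ->
  exists G : set (set T),
  [/\ forall i, (i < N)%N -> i != k ->
        measurable_fun setT (X i : g_sigma_algebraType G -> R),
      <<s G >> `<=` measurable
    & forall E B, <<s G >> E -> measurable B ->
        P (E `&` X k @^-1` B) = P E * P (X k @^-1` B)].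
Proof.
move=> mX iX; pose J := [seq i <- iota 0 N | i != k].
pose cyl (A : nat -> set R) := \big[setI/setT]_(i <- J) (X i @^-1` A i).
have mcyl A : (forall i, measurable (A i)) -> measurable (cyl A).
  move=> mA; apply: bigsetI_measurable => i _.
  by rewrite -[X in measurable X]setTI; exact: mX.
pose G := [set cyl A | A in [set A | forall i, measurable (A i)]].
have GT : G setT.
  exists (fun=> setT); first by [].
  by rewrite /cyl big1.
have sGm : <<s G >> `<=` measurable.
  apply: smallest_sub; first exact: sigma_algebra_measurable.
  by move=> _ [A mA <-]; exact: mcyl.
have uJ : uniq J by rewrite filter_uniq// iota_uniq.
have kJ : k \notin J by rewrite mem_filter eqxx.
exists G; split => //.
- move=> i iN ik _ B mB; rewrite setTI; apply: sub_sigma_algebra.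
  exists (fun j => if j == i then B else setT); first by move=> j /=; case: ifP.
  rewrite /cyl (bigD1_seq i)//= ?eqxx; last by rewrite mem_filter ik mem_iota.
  by rewrite big1 ?setIT// => j /negbTE ->.
- move=> E B sE mB; have mXB : measurable (X k @^-1` B).
    by rewrite -[X in measurable X]setTI; exact: mX.
  pose p : {nonneg R} := NngNum (fine_ge0 (measure_ge0 P (X k @^-1` B))).
  have pE : p%:num%:E = P (X k @^-1` B) by rewrite /= fineK// fin_num_measure.
  rewrite [RHS]muleC -pE.
  pose m1 : {measure set T -> \bar R} := mrestr P mXB.
  pose m2 : {measure set T -> \bar R} := mscale p P.
  suff : m1 E = m2 E by rewrite /m1 /m2 /= /mrestr /mscale.
  apply: (g_sigma_algebra_measure_unique G _ (fun=> setT)) => //.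
  + by move=> A GA; apply: sGm; exact: sub_sigma_algebra.
  + by rewrite bigcup_const.
  + move=> _ _ [A mA <-] [A' mA' <-]; exists (fun i => A i `&` A' i).
      by move=> i; exact: measurableI.
    by rewrite /cyl -big_split.
  + move=> _ [A mA <-]; rewrite /m1 /m2 /= /mrestr /mscale pE /cyl.
    (* As [k] is not in [J], prescribing [B] at index [k] leaves the cylinder unchanged; the product
       rule can then be applied to both [J] and [k :: J] with the same sets. *)
    have eqA : \big[setI/setT]_(i <- J) (X i @^-1` A i) =
        \big[setI/setT]_(i <- J) (X i @^-1` (if i == k then B else A i)).
      apply: eq_big_seq => i iJ; case: eqP => // ik.
      by move: kJ; rewrite -ik iJ.
    have mA2 i : measurable (if i == k then B else A i) by case: ifP.
    have := iX (k :: J) (fun i => if i == k then B else A i).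
    rewrite /= kJ uJ => /(_ isT mA2); rewrite !big_cons !eqxx.
    rewrite -(iX J (fun i => if i == k then B else A i) uJ mA2) -eqA => <-.
    by rewrite setIC.
  + move=> _; rewrite /m1 /= /mrestr setTI ltey_eq fin_num_measure//.
Qed.

End independence.

Lemma integral2_leD (R : realType) (d d' : measure_display)
    (T : measurableType d) (T' : measurableType d')
    (P : probability T R) (Q : probability T' R) (h1 h2 : T * T' -> \bar R) (e : R) :
  measurable_fun setT h1 -> measurable_fun setT h2 ->
  (forall z, 0 <= h1 z)%E -> (forall z, 0 <= h2 z)%E -> 0 <= e ->
  (forall w v, h1 (w, v) <= h2 (w, v) + e%:E)%E ->
  (\int[P]_w \int[Q]_v h1 (w, v) <= \int[P]_w \int[Q]_v h2 (w, v) + e%:E)%E.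
Proof.
move=> mh1 mh2 h10 h20 e0 h.
have cst d0 (T0 : measurableType d0) (P0 : probability T0 R) : (\int[P0]_w e%:E = e%:E)%E.
  by rewrite integral_cst//= [X in (_ * X)%E]probability_setT mule1.
have m1 := measurable_fun_fubini_tonelli_F (m2 := Q) h1 mh1 h10.
have m2 := measurable_fun_fubini_tonelli_F (m2 := Q) h2 mh2 h20.
rewrite -[X in (_ + X)%E](cst _ _ P) -ge0_integralD//; last first.
  by move=> w _; apply: integral_ge0.
apply: ge0_le_integral => //.
- by move=> w _; apply: integral_ge0.
- by apply: emeasurable_funD => //; exact: m2.
move=> w _; rewrite -[X in (_ + X)%E](cst _ _ Q) -ge0_integralD//; last first.
  exact: (measurableT_comp mh2 (pair1_measurable w)).
apply: ge0_le_integral => //.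
- exact: (measurableT_comp mh1 (pair1_measurable w)).
- by apply: emeasurable_funD => //; exact: (measurableT_comp mh2 (pair1_measurable w)).
Qed.

Section swap.
Context (R : realType) (d d' : measure_display).
Context (T : measurableType d) (T' : measurableType d').
Variables (P : probability T R) (Q : probability T' R).
Context (d1 d2 : measure_display).
Context (T1 : measurableType d1) (T2 : measurableType d2).
Variables (V : T -> T1) (W : T -> R) (V' : T' -> T2) (W' : T' -> R).
Hypotheses (mV : measurable_fun setT V) (mW : measurable_fun setT W).
Hypotheses (mV' : measurable_fun setT V') (mW' : measurable_fun setT W').
Local Open Scope ereal_scope.
Hypothesis VW : forall A B, measurable A -> measurable B ->
  P (V @^-1` A `&` W @^-1` B) = P (V @^-1` A) * P (W @^-1` B).
Hypothesis VW' : forall A B, measurable A -> measurable B ->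
  Q (V' @^-1` A `&` W' @^-1` B) = Q (V' @^-1` A) * Q (W' @^-1` B).
Variable f : T1 * R * T2 -> \bar R.
Hypotheses (mf : measurable_fun setT f) (f0 : forall z, 0 <= f z).

Lemma measurable_fun_resample :
  measurable_fun setT (fun z : T * T' => \int[P]_w' f (V z.1, W w', V' z.2)).
Proof.
apply: (measurable_fun_fubini_tonelli_F
  (fun z : T * T' * T => f (V z.1.1, W z.2, V' z.1.2))) => //.
apply: measurableT_comp => //; apply: measurable_fun_pair.
  by apply: measurable_fun_pair; apply: measurableT_comp => //; apply: measurableT_comp.
by apply: measurableT_comp => //; apply: measurableT_comp.
Qed.

Lemma measurable_fun_resample' :
  measurable_fun setT (fun z : T * T' => \int[Q]_v' f (V z.1, W' v', V' z.2)).
Proof.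
apply: (measurable_fun_fubini_tonelli_F
  (fun z : T * T' * T' => f (V z.1.1, W' z.2, V' z.1.2))) => //.
apply: measurableT_comp => //; apply: measurable_fun_pair.
  by apply: measurable_fun_pair; apply: measurableT_comp => //; apply: measurableT_comp.
by apply: measurableT_comp => //; apply: measurableT_comp.
Qed.

(** [V] stands for the factors before the exchanged one, [V'] for those after it, which live on the
    other space. Tonelli first brings the integral over [T] inside, so that [V' v] is frozen when
    the independence of [V] and [W] is used. *)
Lemma resample : \int[P]_w \int[Q]_v f (V w, W w, V' v) =
  \int[P]_w \int[Q]_v \int[P]_w' f (V w, W w', V' v).
Proof.
rewrite (fubini_tonelli (fun z : T * T' => f (V z.1, W z.1, V' z.2)))//; last first.
  apply: measurableT_comp => //; apply: measurable_fun_pair.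
    by apply: measurable_fun_pair; apply: measurableT_comp.
  by apply: measurableT_comp.
rewrite (fubini_tonelli (fun z : T * T' => \int[P]_w' f (V z.1, W w', V' z.2)))//.
- apply: eq_integral => v _ /=.
  rewrite (ge0_integral_indep (f := fun z : T1 * R => f (z.1, z.2, V' v)) mV mW VW)//.
  apply: measurableT_comp => //; apply: measurable_fun_pair => //.
  exact: measurable_fun_pair.
- exact: measurable_fun_resample.
- by move=> z; apply: integral_ge0.
Qed.

Lemma resample' : \int[P]_w \int[Q]_v f (V w, W' v, V' v) =
  \int[P]_w \int[Q]_v \int[Q]_v' f (V w, W' v', V' v).
Proof.
apply: eq_integral => w _.
rewrite (ge0_integral_indep (f := fun z : T2 * R => f (V w, z.2, z.1)) mV' mW' VW')//.
apply: measurableT_comp => //; apply: measurable_fun_pair => //.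
exact: measurable_fun_pair.
Qed.

Lemma integral_swap_le (e : R) : (0 <= e)%R ->
  (forall w v, \int[P]_w' f (V w, W w', V' v) <=
               \int[Q]_v' f (V w, W' v', V' v) + e%:E) ->
  \int[P]_w \int[Q]_v f (V w, W w, V' v) <=
  \int[P]_w \int[Q]_v f (V w, W' v, V' v) + e%:E.
Proof.
move=> e0 h; rewrite resample resample'.
apply: (@integral2_leD _ _ _ _ _ P Q (fun z => \int[P]_w' f (V z.1, W w', V' z.2))
  (fun z => \int[Q]_v' f (V z.1, W' v', V' z.2))) => //.
- exact: measurable_fun_resample.
- exact: measurable_fun_resample'.
- by move=> z; apply: integral_ge0.
- by move=> z; apply: integral_ge0.
Qed.

Lemma integral_swap_ge (e : R) : (0 <= e)%R ->
  (forall w v, \int[Q]_v' f (V w, W' v', V' v) <=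
               \int[P]_w' f (V w, W w', V' v) + e%:E) ->
  \int[P]_w \int[Q]_v f (V w, W' v, V' v) <=
  \int[P]_w \int[Q]_v f (V w, W w, V' v) + e%:E.
Proof.
move=> e0 h; rewrite resample resample'.
apply: (@integral2_leD _ _ _ _ _ P Q (fun z => \int[Q]_v' f (V z.1, W' v', V' z.2))
  (fun z => \int[P]_w' f (V z.1, W w', V' z.2))) => //.
- exact: measurable_fun_resample'.
- exact: measurable_fun_resample.
- by move=> z; apply: integral_ge0.
- by move=> z; apply: integral_ge0.
Qed.

End swap.

Definition sinh_moments {R : realType} {d : measure_display}
    {T : measurableType d} (P : probability T R) (W : T -> R) (s : nat -> R) :=
  [/\ measurable_fun setT W, (forall w, 0 < W w)
    & forall k, k \in [:: 1; 2; 4]%N ->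
      P.-integrable setT (fun w => (sinhv (W w) ^+ k)%:E) /\
      \int[P]_w (sinhv (W w) ^+ k) = s k].

(* By AM-GM, [2 * `|y| ^+ 3 <= r * y ^+ 2 + y ^+ 4 / r]; [r] stays free since no moment of
   odd order of [`|y|] is available. *)
Definition taylor_gap {R : realType} (r : R) (s u : nat -> R) : R :=
  `|s 1%N - u 1%N| + `|s 2%N - u 2%N| + r * (s 2%N + u 2%N) + (s 4%N + u 4%N) / r.

Section jet_expectation.
Context (R : realType).

Lemma bounded_integrable (d : measure_display) (T : measurableType d)
    (P : probability T R) (F : T -> R) (M : R) :
  measurable_fun setT F -> (forall w, `|F w| <= M) ->
  P.-integrable setT (EFin \o F).
Proof.
move=> mF FM; apply: (@le_integrable _ _ _ P setT measurableT _ (EFin \o cst M)).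
- exact/measurable_EFinP.
- by move=> w _ /=; rewrite lee_fin (le_trans (FM w))// ler_norm.
- exact: finite_measure_integrable_cst.
Qed.

Section one.
Context (d : measure_display) (T : measurableType d) (P : probability T R).
Variables (W : T -> R) (s : nat -> R).
Hypothesis sW : sinh_moments P W s.

Lemma sinh_moment_ge0 k : k \in [:: 2; 4]%N -> 0 <= s k.
Proof.
move: sW => [_ _ m] k24.
have [|_ <-] := m k; first by rewrite inE k24 orbT.
apply: Rintegral_ge0 => w _; move: k24; rewrite !inE => /orP[]/eqP -> //.
- exact: sqr_ge0.
- by rewrite (exprM _ 2 2) sqr_ge0.
Qed.

Lemma jet_expectation (F : R -> R) (C f0 f1 f2 r : R) : 0 < r -> 0 <= C ->
  measurable_fun setT (fun w => F (W w)) -> (forall x, 0 < x -> `|F x| <= C) ->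
  (forall x, 0 < x ->
      `|F x - (f0 + f1 * sinhv x + f2 * sinhv x ^+ 2)| <= C * `|sinhv x| ^+ 3) ->
  `|\int[P]_w F (W w) - (f0 + f1 * s 1%N + f2 * s 2%N)| <=
    C * (r * s 2%N + s 4%N / r).
Proof.
move=> r0 C0 mF FC jF; move: sW => [mW W0 m].
have [i1 e1] := m 1%N isT; have [i2 e2] := m 2%N isT; have [i4 e4] := m 4%N isT.
have iF : P.-integrable setT (EFin \o (fun w => F (W w))).
  by apply: (@bounded_integrable _ _ P _ C) => // w; exact: FC.
have i0 : P.-integrable setT (EFin \o cst f0) by exact: finite_measure_integrable_cst.
have iZ (c : R) k : P.-integrable setT (fun w => (sinhv (W w) ^+ k)%:E) ->
    P.-integrable setT (EFin \o (fun w => c * sinhv (W w) ^+ k)).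
  by move=> ik; exact: (integrableZl measurableT c ik).
have iD (h1 h2 : T -> R) : P.-integrable setT (EFin \o h1) ->
    P.-integrable setT (EFin \o h2) -> P.-integrable setT (EFin \o (fun w => h1 w + h2 w)).
  by move=> ih1 ih2; exact: (integrableD measurableT ih1 ih2).
have iB (h1 h2 : T -> R) : P.-integrable setT (EFin \o h1) ->
    P.-integrable setT (EFin \o h2) -> P.-integrable setT (EFin \o (fun w => h1 w - h2 w)).
  by move=> ih1 ih2; exact: (integrableB measurableT ih1 ih2).
pose q w := f0 + f1 * sinhv (W w) ^+ 1 + f2 * sinhv (W w) ^+ 2.
have iq : P.-integrable setT (EFin \o q) by apply: (iD); [apply: (iD)|]; auto.
have Eq : \int[P]_w q w = f0 + f1 * s 1%N + f2 * s 2%N.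
  rewrite /q (RintegralD (f1 := fun w => f0 + f1 * sinhv (W w) ^+ 1))//; [|by apply: (iD); auto|by auto].
  rewrite RintegralD//; last by auto.
  rewrite !RintegralZl// e1 e2 Rintegral_cst//.
  by rewrite [X in fine X]probability_setT mulr1.
rewrite -Eq -RintegralB//.
apply: le_trans (le_normr_Rintegral measurableT (iB _ _ iF iq)) _.
pose b w := C * r * sinhv (W w) ^+ 2 + C / r * sinhv (W w) ^+ 4.
have ib : P.-integrable setT (EFin \o b) by apply: (iD); auto.
have -> : C * (r * s 2%N + s 4%N / r) = \int[P]_w b w.
  rewrite RintegralD//; [|by auto|by auto].
  by rewrite !RintegralZl// e2 e4; ring.
apply: le_Rintegral => //.
  exact: (integrable_norm (iB _ _ iF iq)).
move=> w _; rewrite /q expr1; apply: le_trans (jF _ (W0 w)) _.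
rewrite /b; set y := sinhv (W w).
have -> : C * r * y ^+ 2 + C / r * y ^+ 4 = C * (r * y ^+ 2 + y ^+ 4 / r).
  by field; rewrite gt_eqF.
apply: ler_wpM2l => //.
have -> : y ^+ 2 = `|y| ^+ 2 by rewrite real_normK ?num_real.
have -> : y ^+ 4 = `|y| ^+ 4 by rewrite !(exprM _ 2 2) real_normK ?num_real.
(* Expanding this product gives the AM-GM bound on the cubic term; its factor 2 is given away. *)
have : 0 <= (r - `|y|) ^+ 2 * (`|y| ^+ 2 / r).
  by rewrite mulr_ge0 ?sqr_ge0// divr_ge0 ?sqr_ge0// ltW.
have -> : (r - `|y|) ^+ 2 * (`|y| ^+ 2 / r) = r * `|y| ^+ 2 + `|y| ^+ 4 / r - 2 * `|y| ^+ 3.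
  by field; rewrite gt_eqF.
have : 0 <= `|y| ^+ 3 by rewrite exprn_ge0.
lra.
Qed.

End one.

(** The jet coefficients depend on [F] only, hence are common to both laws, and [f0] cancels because
    both laws have mass one. *)
Lemma jet_expectation_diff (d d' : measure_display) (T : measurableType d)
    (T' : measurableType d') (P : probability T R) (Q : probability T' R)
    (W : T -> R) (W' : T' -> R) (s u : nat -> R) (F : R -> R) (C r : R) :
  sinh_moments P W s -> sinh_moments Q W' u -> 0 < r -> jet C F ->
  measurable_fun setT (fun w => F (W w)) -> measurable_fun setT (fun w => F (W' w)) ->
  `|\int[P]_w F (W w) - \int[Q]_w F (W' w)| <= C * taylor_gap r s u.
Proof.
move=> sW sW' r0 jF mF mF'; have C0 := jet_ge0 jF.
case: jF => FC [f0 [f1 [f2 [h1 h2 h]]]].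
have := jet_expectation sW r0 C0 mF FC h.
have := jet_expectation sW' r0 C0 mF' FC h.
set a := \int[P]_w _; set b := \int[Q]_w _ => hb ha.
have -> : a - b = (a - (f0 + f1 * s 1%N + f2 * s 2%N)) +
   ((f1 * (s 1%N - u 1%N) + f2 * (s 2%N - u 2%N)) - (b - (f0 + f1 * u 1%N + f2 * u 2%N))).
  by ring.
have -> : C * taylor_gap r s u = C * (r * s 2%N + s 4%N / r) +
   ((C * `|s 1%N - u 1%N| + C * `|s 2%N - u 2%N|) + C * (r * u 2%N + u 4%N / r)).
  by rewrite /taylor_gap; field; rewrite gt_eqF.
apply: le_trans (ler_normD _ _) _; apply: lerD => //.
apply: le_trans (ler_normB _ _) _; apply: lerD => //.
apply: le_trans (ler_normD _ _) _; apply: lerD => //.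
- by rewrite normrM ler_wpM2r.
- by rewrite normrM ler_wpM2r.
Qed.

End jet_expectation.

(** * Lindeberg replacement along the walk *)

Definition walk_obs {R : realType} (phi : R -> R -> R) (delta : R)
    (g : nat -> R) (m : nat) : R :=
  phi (1 + walk_X g m)^-1 (1 + walk_Z delta g m)^-1.

Lemma inv1D_itv (R : realFieldType) (x : R) : 0 <= x -> 0 < (1 + x)^-1 <= 1.
Proof.
by move=> x0; rewrite invr_gt0 invf_le1 ?ltr_pwDl//= lerDl.
Qed.

Section lindeberg.
Context (R : realType) (d d' : measure_display).
Context (T : measurableType d) (T' : measurableType d').
Variables (P : probability T R) (Q : probability T' R).
Variables (gam : nat -> T -> R) (zet : nat -> T' -> R) (s u : nat -> R).
Hypotheses (igam : mutually_independent P gam) (izet : mutually_independent Q zet).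
Hypotheses (sgam : forall i, sinh_moments P (gam i) s).
Hypotheses (szet : forall i, sinh_moments Q (zet i) u).
Variables (phi : R -> R -> R) (C delta r : R).
Hypotheses (delta0 : 0 <= delta) (r0 : 0 < r) (pphi : poly2 phi).
Hypothesis phi0 : forall p v, 0 < p <= 1 -> 0 < v <= 1 -> 0 <= phi p v.
Hypothesis jphi : forall F G, jet 30 F -> jet 30 G -> jet C (fun x => phi (F x) (G x)).

Let mgam i : measurable_fun setT (gam i). Proof. by case: (sgam i). Qed.
Let mzet i : measurable_fun setT (zet i). Proof. by case: (szet i). Qed.
Let gam0 i w : 0 < gam i w. Proof. by case: (sgam i). Qed.
Let zet0 i w : 0 < zet i w. Proof. by case: (szet i). Qed.

(* The observable as a function of one factor [x]: [a], [c] are the entries [X], [Z] of the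
   product of the factors before [x], and [p], [q] those of the factors after it. *)
Let core (a c x p q : R) : R :=
  phi (1 + a * x * p)^-1 (1 + ((c * x + delta / a) * p + (a * x)^-1 * q))^-1.

Let coreE (g : nat -> R) k n : walk_obs phi delta g (k.+1 + n) =
  core (walk_X g k) (walk_Z delta g k) (g k) (walk_X (fun i => g (k.+1 + i)%N) n)
    (walk_Z delta (fun i => g (k.+1 + i)%N) n).
Proof. by rewrite /walk_obs walk_X_add walk_Z_add walk_XS walk_ZS. Qed.

Let jet_core (a c p q : R) : 0 < a -> 0 <= c -> 0 < p -> 0 <= q ->
  jet C (fun x => phi (homog (a * p) 0 0 x) (homog (c * p) (delta * p / a) (q / a) x)).
Proof.
move=> a0 c0 p0 q0; apply: jphi.
  by apply: jet_homog => //; rewrite mulr_ge0// ltW.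
apply: jet_homog; first by rewrite mulr_ge0// ltW.
  by rewrite divr_ge0// ?mulr_ge0// ltW.
by rewrite divr_ge0// ltW.
Qed.

Let core_homog (a c p q x : R) : 0 < a -> 0 < x -> core a c x p q =
  phi (homog (a * p) 0 0 x) (homog (c * p) (delta * p / a) (q / a) x).
Proof.
move=> a0 x0; rewrite /core /homog; congr (phi _^-1 _^-1).
  by rewrite mul0r !addr0 mulrAC.
by field; rewrite !gt_eqF.
Qed.

Let core_ge0 (a c p q x : R) : 0 < a -> 0 <= c -> 0 < p -> 0 <= q -> 0 < x ->
  0 <= core a c x p q.
Proof.
move=> a0 c0 p0 q0 x0; apply: phi0; apply: inv1D_itv.
  by rewrite !mulr_ge0// ltW.
rewrite addr_ge0// mulr_ge0//; [|exact: ltW|by rewrite invr_ge0 mulr_ge0// ltW].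
by rewrite addr_ge0//; [rewrite mulr_ge0// ltW|rewrite divr_ge0// ltW].
Qed.

(** The absolute value makes [f] nonnegative on its whole domain, as Tonelli requires; on the values
    that walks can take it changes nothing, by [fE]. *)
Let f (z : (R * R) * R * (R * R)) : \bar R :=
  `|core z.1.1.1 z.1.1.2 z.1.2 z.2.1 z.2.2|%:E.

Let mf : measurable_fun setT f.
Proof.
have m11 : measurable_fun setT (fun z : (R * R) * R * (R * R) => z.1.1.1).
  by do 2 apply: measurableT_comp => //.
have m12 : measurable_fun setT (fun z : (R * R) * R * (R * R) => z.1.1.2).
  by do 2 apply: measurableT_comp => //.
have mx : measurable_fun setT (fun z : (R * R) * R * (R * R) => z.1.2).
  by apply: measurableT_comp.
have m21 : measurable_fun setT (fun z : (R * R) * R * (R * R) => z.2.1).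
  by apply: measurableT_comp.
have m22 : measurable_fun setT (fun z : (R * R) * R * (R * R) => z.2.2).
  by apply: measurableT_comp.
apply/measurable_EFinP; apply: measurableT_comp => //; apply: measurable_poly2 => //.
  apply: measurable_funVr; apply: measurable_funD => //.
  by do 2 apply: measurable_funM => //.
apply: measurable_funVr; apply: measurable_funD => //; apply: measurable_funD.
  apply: measurable_funM => //; apply: measurable_funD; first exact: measurable_funM.
  by apply: measurable_funM => //; exact: measurable_funVr.
by apply: measurable_funM => //; apply: measurable_funVr; exact: measurable_funM.
Qed.

Let f0 z : (0 <= f z)%E. Proof. by rewrite /f lee_fin. Qed.

Let fE (a c p q x : R) : 0 < a -> 0 <= c -> 0 < p -> 0 <= q -> 0 < x ->
  f (a, c, x, (p, q)) = (core a c x p q)%:E.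
Proof. by move=> *; rewrite /f /= ger0_norm// core_ge0. Qed.

Let measurable_core (d0 : measure_display) (T0 : measurableType d0) (W : T0 -> R) a c p q :
  measurable_fun setT W -> (forall w, 0 < W w) ->
  0 < a -> 0 <= c -> 0 < p -> 0 <= q ->
  measurable_fun setT (fun w => core a c (W w) p q).
Proof.
move=> mW W0 a0 c0 p0 q0.
have -> : (fun w => core a c (W w) p q) = (fun w => fine (f (a, c, W w, (p, q)))).
  by apply/funext => w; rewrite fE.
apply: measurableT_comp => //; apply: measurableT_comp => //.
by apply: measurable_fun_pair => //; apply: measurable_fun_pair.
Qed.

Let integral_core (d0 : measure_display) (T0 : measurableType d0)
    (P0 : probability T0 R) (W : T0 -> R) a c p q :
  measurable_fun setT W -> (forall w, 0 < W w) ->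
  0 < a -> 0 <= c -> 0 < p -> 0 <= q ->
  (\int[P0]_w f (a, c, W w, (p, q)) = (\int[P0]_w core a c (W w) p q)%:E)%E.
Proof.
move=> mW W0 a0 c0 p0 q0; rewrite /Rintegral fineK.
  by apply: eq_integral => w _; rewrite fE.
apply: integrable_fin_num => //; apply: (@bounded_integrable _ _ _ P0 _ C).
  exact: measurable_core.
by move=> w; rewrite core_homog//; case: (jet_core a0 c0 p0 q0) => + _; exact.
Qed.

Let gap := C * taylor_gap r s u.

Let gap_ge0 : 0 <= gap.
Proof.
have C0 : 0 <= C.
  by apply: (@jet_ge0 _ C); apply: (@jet_core 1 0 1 0); rewrite ?ltr01.
have s2 := @sinh_moment_ge0 _ _ _ _ _ _ (sgam 0) 2%N isT.
have s4 := @sinh_moment_ge0 _ _ _ _ _ _ (sgam 0) 4%N isT.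
have u2 := @sinh_moment_ge0 _ _ _ _ _ _ (szet 0) 2%N isT.
have u4 := @sinh_moment_ge0 _ _ _ _ _ _ (szet 0) 4%N isT.
rewrite mulr_ge0// /taylor_gap !addr_ge0// ?divr_ge0 ?mulr_ge0 ?addr_ge0//; exact: ltW.
Qed.

Let swap_core k a c p q : 0 < a -> 0 <= c -> 0 < p -> 0 <= q ->
  `|\int[P]_w core a c (gam k w) p q - \int[Q]_v core a c (zet k v) p q| <= gap.
Proof.
move=> a0 c0 p0 q0.
have mgc := measurable_core (mgam k) (gam0 k) a0 c0 p0 q0.
have mzc := measurable_core (mzet k) (zet0 k) a0 c0 p0 q0.
have gE : (fun w => core a c (gam k w) p q) = (fun w => phi (homog (a * p) 0 0 (gam k w))
    (homog (c * p) (delta * p / a) (q / a) (gam k w))).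
  by apply/funext => w; rewrite core_homog.
have zE : (fun w => core a c (zet k w) p q) = (fun w => phi (homog (a * p) 0 0 (zet k w))
    (homog (c * p) (delta * p / a) (q / a) (zet k w))).
  by apply/funext => w; rewrite core_homog.
rewrite gE in mgc *; rewrite zE in mzc *.
exact: (jet_expectation_diff (sgam k) (szet k) r0 (jet_core a0 c0 p0 q0)).
Qed.

Let hyb k (w : T) (v : T') i := if (i < k)%N then gam i w else zet i v.

(** The integral is iterated over the two spaces, so that no joint space for [gam] and [zet] has to
    be built. [H m 0] belongs to the walk of [zet], [H m m] to the walk of [gam]. *)
Let H m k := (\int[P]_w \int[Q]_v (walk_obs phi delta (hyb k w v) m)%:E)%E.

Let H_step m k : (k < m)%N -> (H m k <= H m k.+1 + gap%:E)%E /\ (H m k.+1 <= H m k + gap%:E)%E.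
Proof.
move=> km; have [n mE] : exists n, m = (k.+1 + n)%N by exists (m - k.+1)%N; rewrite subnKC.
pose V w := (walk_X (fun i => gam i w) k, walk_Z delta (fun i => gam i w) k).
pose V' v := (walk_X (fun i => zet (k.+1 + i)%N v) n,
   walk_Z delta (fun i => zet (k.+1 + i)%N v) n).
have Vpos w : 0 < (V w).1 /\ 0 <= (V w).2.
  by split; [exact: walk_X_gt0|exact: walk_Z_ge0].
have V'pos w : 0 < (V' w).1 /\ 0 <= (V' w).2.
  by split; [exact: walk_X_gt0|exact: walk_Z_ge0].
have mV : measurable_fun setT V.
  by apply: measurable_fun_pair; [exact: measurable_walk_X|exact: measurable_walk_Z].
have mV' : measurable_fun setT V'.
  by apply: measurable_fun_pair; [exact: measurable_walk_X|exact: measurable_walk_Z].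
(* The cases [j = 0] and [j = 1] treat two neighbouring hybrids at once: they differ only in the
   factor of index [k], taken from [zet] or from [gam]. *)
have obsE w v j : (j < 2)%N -> walk_obs phi delta (hyb (k + j) w v) m =
    core (V w).1 (V w).2 (if j == 0%N then zet k v else gam k w) (V' v).1 (V' v).2.
  move=> j2; rewrite mE coreE /V /V' /=.
  have pre i : (i < k)%N -> hyb (k + j) w v i = gam i w.
    by move=> ik; rewrite /hyb (leq_trans ik (leq_addr _ _)).
  have post i : hyb (k + j) w v (k.+1 + i)%N = zet (k.+1 + i)%N v.
    by rewrite /hyb ifF//; apply/negbTE; rewrite -leqNgt addSnnS leq_add2l; case: (j) j2 => [|[]].
  rewrite (eq_walk_X pre) (eq_walk_Z delta pre).
  rewrite (funext post).
  have -> : hyb (k + j) w v k = if j == 0%N then zet k v else gam k w.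
    by rewrite /hyb; case: (j) j2 => [|[]]//= _; rewrite ?addn0 ?addn1 ?ltnn ?ltnSn.
  by [].
have H0 : H m k = (\int[P]_w \int[Q]_v f (V w, zet k v, V' v))%E.
  apply: eq_integral => w _; apply: eq_integral => v _.
  have := obsE w v 0%N isT; rewrite addn0 /= => ->.
  have [a0 c0] := Vpos w; have [p0 q0] := V'pos v.
  by rewrite -fE// /V /V'.
have H1 : H m k.+1 = (\int[P]_w \int[Q]_v f (V w, gam k w, V' v))%E.
  apply: eq_integral => w _; apply: eq_integral => v _.
  have := obsE w v 1%N isT; rewrite addn1 /= => ->.
  have [a0 c0] := Vpos w; have [p0 q0] := V'pos v.
  by rewrite -fE// /V /V'.
have iV A B : measurable A -> measurable B ->
    P (V @^-1` A `&` gam k @^-1` B) = (P (V @^-1` A) * P (gam k @^-1` B))%E.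
  move=> mA mB; have [G [mG sG iG]] := mutually_independent_split k k mgam igam.
  apply: iG => //.
  have mVG : measurable_fun setT (V : g_sigma_algebraType G -> R * R).
    apply: measurable_fun_pair.
      by apply: measurable_walk_X => i ik; apply: mG => //; rewrite ltn_eqF.
    by apply: measurable_walk_Z => i ik; apply: mG => //; rewrite ltn_eqF.
  by have := mVG measurableT _ mA; rewrite setTI.
have iV' A B : measurable A -> measurable B ->
    Q (V' @^-1` A `&` zet k @^-1` B) = (Q (V' @^-1` A) * Q (zet k @^-1` B))%E.
  move=> mA mB; have [G [mG sG iG]] := mutually_independent_split m k mzet izet.
  apply: iG => //.
  have mVG : measurable_fun setT (V' : g_sigma_algebraType G -> R * R).
    have mi i : (i < n)%N -> measurable_fun setT (zet (k.+1 + i)%N : g_sigma_algebraType G -> R).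
      move=> iin; apply: mG; first by rewrite mE ltn_add2l.
      by rewrite gtn_eqF// addSn ltnS leq_addr.
    by apply: measurable_fun_pair; [apply: measurable_walk_X|apply: measurable_walk_Z].
  by have := mVG measurableT _ mA; rewrite setTI.
have cmp w v := swap_core k (Vpos w).1 (Vpos w).2 (V'pos v).1 (V'pos v).2.
have iP w v := integral_core P (mgam k) (gam0 k) (Vpos w).1 (Vpos w).2 (V'pos v).1 (V'pos v).2.
have iQ w v := integral_core Q (mzet k) (zet0 k) (Vpos w).1 (Vpos w).2 (V'pos v).1 (V'pos v).2.
split; rewrite H0 H1.
  apply: (integral_swap_ge mV (mgam k) mV' (mzet k) iV iV' mf f0 gap_ge0) => w v.
  move: (iP w v) (iQ w v) (cmp w v); rewrite -!surjective_pairing => -> ->.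
  by rewrite -EFinD lee_fin distrC => /(le_trans (ler_norm _)) h; lra.
apply: (integral_swap_le mV (mgam k) mV' (mzet k) iV iV' mf f0 gap_ge0) => w v.
move: (iP w v) (iQ w v) (cmp w v); rewrite -!surjective_pairing => -> ->.
by rewrite -EFinD lee_fin => /(le_trans (ler_norm _)) h; lra.
Qed.

Let H_le m k : (k <= m)%N -> (H m 0 <= H m k + (k%:R * gap)%:E)%E /\
  (H m k <= H m 0 + (k%:R * gap)%:E)%E.
Proof.
elim: k => [|k IH] km; first by rewrite mul0r adde0.
have [h1 h2] := IH (ltnW km); have [h3 h4] := H_step km.
have gE : (((k.+1)%:R * gap)%:E = gap%:E + (k%:R * gap)%:E)%E.
  by rewrite -EFinD -natr1; congr (_%:E); ring.
split; rewrite gE addeA.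
  exact: le_trans h1 (leeD h3 (lexx _)).
apply: le_trans h4 _; rewrite addeAC; apply: leeD => //.
Qed.

Lemma measurable_walk_obs (d0 : measure_display) (T0 : measurableType d0)
    (g : nat -> T0 -> R) m : (forall i, measurable_fun setT (g i)) ->
  measurable_fun setT (fun w => walk_obs phi delta (fun i => g i w) m).
Proof.
move=> mg; apply: measurable_poly2 => //; apply: measurable_funVr.
  by apply: measurable_funD => //; exact: measurable_walk_X.
by apply: measurable_funD => //; exact: measurable_walk_Z.
Qed.

Lemma lindeberg_walk m :
  `|\int[P]_w walk_obs phi delta (fun i => gam i w) m -
    \int[Q]_v walk_obs phi delta (fun i => zet i v) m| <= m%:R * gap.
Proof.
have [h1 h2] := H_le (leqnn m).
(* Applied to constant functions, [jphi] shows that [C] also bounds the observable: both arguments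
   lie in []0, 1]], so these constants are jets with constant 30. *)
have obs_bound (g : nat -> R) : (forall i, 0 < g i) -> `|walk_obs phi delta g m| <= C.
  move=> g0; have gx : 0 <= walk_X g m by rewrite ltW// walk_X_gt0.
  have gz : 0 <= walk_Z delta g m by exact: walk_Z_ge0.
  have jc (x : R) : 0 <= x -> jet 30 (fun=> (1 + x)^-1).
    move=> x0; have /andP[i0 i1] := inv1D_itv x0; apply: jet_le (jet_cst _).
    by rewrite gtr0_norm// (le_trans i1)// ler1n.
  by have [/(_ 1 ltr01)] := jphi (jc _ gx) (jc _ gz).
have H0 : H m 0 = (\int[Q]_v walk_obs phi delta (fun i => zet i v) m)%:E.
  rewrite /H /hyb /= integral_cst// [X in (_ * X)%E]probability_setT mule1.
  rewrite fineK//; apply: integrable_fin_num => //.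
  by apply: (@bounded_integrable _ _ _ Q _ C); [exact: measurable_walk_obs|auto].
have Hm : H m m = (\int[P]_w walk_obs phi delta (fun i => gam i w) m)%:E.
  rewrite /Rintegral fineK; last first.
    apply: integrable_fin_num => //.
    by apply: (@bounded_integrable _ _ _ P _ C); [exact: measurable_walk_obs|auto].
  apply: eq_integral => w _.
  under eq_integral => v _.
    rewrite (_ : walk_obs _ _ _ _ = walk_obs phi delta (fun i => gam i w) m); last first.
      by rewrite /walk_obs (@eq_walk_X _ _ (fun i => gam i w))
        ?(@eq_walk_Z _ _ _ (fun i => gam i w))// => i im; rewrite /hyb im.
    over.
  by rewrite integral_cst// [X in (_ * X)%E]probability_setT mule1.
move: h1 h2; rewrite H0 Hm -!EFinD !lee_fin => h1 h2.
by rewrite ler_distl; apply/andP; split; lra.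
Qed.

End lindeberg.

(** * Laws given by a density *)

Section density.
Context (R : realType) (d : measure_display) (T : measurableType d).
Variables (mu nu : {measure set T -> \bar R}) (p : T -> R).
Hypotheses (mp : measurable_fun setT p) (p0 : forall x, 0 <= p x).
Local Open Scope ereal_scope.
Hypothesis nuE : forall A, measurable A -> nu A = \int[mu]_(x in A) (p x)%:E.

Let mpE : measurable_fun setT (EFin \o p). Proof. exact/measurable_EFinP. Qed.

Import HBNNSimple.

Let nnsfun_density (h : {nnsfun T >-> R}) :
  \int[nu]_x (h x)%:E = \int[mu]_x ((h x)%:E * (p x)%:E).
Proof.
rewrite integralT_nnsfun sintegralE.
transitivity (\int[mu]_x (\sum_(r \in range h)
    (r * \1_(h @^-1` [set r]) x)%:E * (p x)%:E)); last first.
  apply: eq_integral => x _; rewrite -ge0_mule_fsuml.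
    by rewrite fsumEFin// -fimfunE.
  by move=> r; exact: nnfun_muleindic_ge0.
rewrite ge0_integral_fsum//; last 2 first.
- move=> r; apply: emeasurable_funM => //; apply/measurable_EFinP.
  exact: measurable_funM.
- by move=> r x _; rewrite mule_ge0 ?lee_fin//; exact: nnfun_muleindic_ge0.
apply: eq_fsbigr => r rh; have r0 : (0 <= r)%R.
  by move: rh => /set_mem[x _ <-].
rewrite nuE//; under [RHS]eq_integral do rewrite EFinM -muleA.
rewrite ge0_integralZl//.
- congr (_ * _); rewrite integral_mkcond; apply: eq_integral => x _.
  by rewrite muleC epatch_indic.
- apply: emeasurable_funM => //; exact/measurable_EFinP.
- by move=> x _; rewrite mule_ge0 ?lee_fin.
Qed.

Lemma ge0_integral_density (f : T -> \bar R) :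
  measurable_fun setT f -> (forall x, 0 <= f x) ->
  \int[nu]_x f x = \int[mu]_x (f x * (p x)%:E).
Proof.
move=> mf f0; pose h := nnsfun_approx measurableT mf.
have hf x : EFin \o h ^~ x @ \oo --> f x by exact: cvg_nnsfun_approx.
have ndh x : nondecreasing_seq (EFin \o h ^~ x).
  by move=> a b ab; rewrite lee_fin; exact/lefP/nd_nnsfun_approx.
transitivity (limn (fun n => \int[nu]_x (h n x)%:E)).
  rewrite -monotone_convergence//; last 3 first.
  - by move=> n; exact/measurable_EFinP.
  - by move=> n x _; rewrite lee_fin.
  - by move=> x _; exact: ndh.
  by apply: eq_integral => x _; apply/esym/cvg_lim => //; exact: hf.
under eq_fun do rewrite nnsfun_density.
rewrite -monotone_convergence//.
- apply: eq_integral => x _; apply/cvg_lim => //.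
  by apply: cvgeZr => //; exact: hf.
- by move=> n; apply: emeasurable_funM => //; exact/measurable_EFinP.
- by move=> n x _; rewrite mule_ge0 ?lee_fin.
- move=> x _ a b ab; apply: lee_wpmul2r; rewrite ?lee_fin//.
  exact/lefP/nd_nnsfun_approx.
Qed.

Lemma integral_density (f : T -> R) : measurable_fun setT f ->
  mu.-integrable setT (fun x => (f x * p x)%:E) ->
  nu.-integrable setT (EFin \o f) /\
  \int[nu]_x (f x)%:E = \int[mu]_x (f x * p x)%:E.
Proof.
move=> mf ifp; have mfE : measurable_fun setT (EFin \o f) by exact/measurable_EFinP.
split.
  apply/integrableP; split => //.
  rewrite ge0_integral_density//; last exact: measurableT_comp.
  move/integrableP : ifp => [_]; congr (_ < _); apply: eq_integral => x _.
  by rewrite /= normrM (ger0_norm (p0 x)) EFinM.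
rewrite integralE [RHS]integralE.
rewrite !ge0_integral_density//; [|exact: measurable_funeneg|exact: measurable_funepos].
congr (_ - _); apply: eq_integral => x _.
  by rewrite !funeposE/= -EFin_max -EFin_max -EFinM maxr_pMl ?mul0r.
by rewrite !funenegE/= -!EFin_max -EFinM maxr_pMl ?mul0r// mulNr.
Qed.

End density.

(** * Moments of generalized inverse Gaussian laws *)

Section gig_kernel.
Variable R : realType.
Notation leb := (@lebesgue_measure R).
Implicit Types (c m x : R).

(** Unnormalised density of [GIG(lambda, a, a)] for [c = a ^+ 2 / 2] and [m = lambda]. The
    parameters are kept apart because multiplying by [x] or [x^-1] shifts [m] and leaves [c]
    alone. *)
Definition gig_kernel c m x : R := x `^ (m - 1) * expR (- (c * (x + x^-1))).

(* [gig_mass c m = 2 * macdonald m (2 * c)]. *)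
Definition gig_mass c m : R := \int[leb]_(x in `]0, +oo[) gig_kernel c m x.

Lemma gig_kernelE c m x : 0 < x ->
  gig_kernel c m x = expR ((m - 1) * ln x - c * (x + x^-1)).
Proof. by move=> x0; rewrite /gig_kernel /powR gt_eqF// expRD. Qed.

Lemma gig_kernel_ge0 c m x : 0 <= gig_kernel c m x.
Proof. by rewrite mulr_ge0 ?powR_ge0 ?expR_ge0. Qed.

Lemma gig_kernel_succ c m x : 0 < x -> gig_kernel c (m + 1) x = x * gig_kernel c m x.
Proof.
move=> x0; rewrite /gig_kernel mulrA; congr (_ * _).
rewrite (_ : m + 1 - 1 = 1 + (m - 1)); last by ring.
rewrite (@powRD _ x 1); first by rewrite powRr1 ?ltW.
by rewrite (gt_eqF x0) implybT.
Qed.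

Lemma gig_kernel_pred c m x : 0 < x -> gig_kernel c (m - 1) x = x^-1 * gig_kernel c m x.
Proof.
move=> x0; rewrite -[in RHS](subrK 1 m) gig_kernel_succ// mulrA mulVf ?mul1r//.
by rewrite gt_eqF.
Qed.

Lemma measurable_gig_kernel c m : measurable_fun setT (gig_kernel c m).
Proof.
apply: measurable_funM; first exact: measurable_powR.
apply: measurableT_comp => //; apply: measurableT_comp => //.
by apply: measurable_funM => //; apply: measurable_funD => //; exact: measurable_funVr.
Qed.

(* For [x > 0] both [ln x] and [- ln x] are at most [x + x^-1], so a large [c]
   absorbs the power of [x]. *)
Lemma gig_kernel_le c m x : 0 < x -> `|m - 1| + 1 <= c -> gig_kernel c m x <= expR (- x).
Proof.
move=> x0 mc; rewrite gig_kernelE// ler_expR.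
have xV0 : 0 < x^-1 by rewrite invr_gt0.
have lx : `|ln x| <= x + x^-1.
  rewrite ler_norml; apply/andP; split.
    by have := ln_sublinear xV0; rewrite lnV ?posrE//; lra.
  by have := ln_sublinear x0; lra.
have : (m - 1) * ln x <= `|m - 1| * (x + x^-1).
  by apply: le_trans (ler_norm _) _; rewrite normrM ler_wpM2l.
have : (`|m - 1| + 1) * (x + x^-1) <= c * (x + x^-1).
  by rewrite ler_wpM2r// addr_ge0// ltW.
lra.
Qed.

Lemma integrable_expRN : leb.-integrable `]0, +oo[ (fun x => (expR (- x))%:E).
Proof.
have ie : leb.-integrable setT (EFin \o exponential_pdf 1).
  apply/integrableP; split.
    by apply/measurable_EFinP; exact: measurable_exponential_pdf.
  under eq_integral do rewrite /= ger0_norm ?exponential_pdf_ge0//.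
  by rewrite integral_exponential_pdf// ltry.
have : leb.-integrable `]0, +oo[ (EFin \o exponential_pdf 1).
  exact: (integrableS _ _ (@subsetT _ _) ie).
apply: eq_integrable => // x; rewrite inE/= in_itv/= andbT => x0.
by rewrite /= exponential_pdfE ?ltW// mul1r mulN1r.
Qed.

Lemma integrable_gig_kernel c m : `|m - 1| + 1 <= c ->
  leb.-integrable `]0, +oo[ (EFin \o gig_kernel c m).
Proof.
move=> mc; apply: le_integrable integrable_expRN => //.
  by apply/measurable_EFinP; apply: measurable_funTS; exact: measurable_gig_kernel.
move=> x /=; rewrite in_itv/= andbT => x0; rewrite lee_fin.
by rewrite ger0_norm ?gig_kernel_ge0// ger0_norm ?expR_ge0// gig_kernel_le.
Qed.

(** The differentiated function is the kernel of index [m + 1] on the positive half-line. Its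
    derivative is again a combination of kernels, and this is the source of a recurrence between
    masses. *)
Lemma is_derive_gig_kernel c m x : 0 < x ->
  is_derive x 1 (fun y => expR (m * ln y - c * (y + y^-1)))
    (m * gig_kernel c m x - c * gig_kernel c (m + 1) x + c * gig_kernel c (m - 1) x).
Proof.
move=> x0.
have xn0 : x != 0 by rewrite gt_eqF.
have -> : m * gig_kernel c m x - c * gig_kernel c (m + 1) x + c * gig_kernel c (m - 1) x =
   expR (m * ln x - c * (x + x^-1)) * (m * x^-1 - c * (1 - x^-2)).
  have -> : expR (m * ln x - c * (x + x^-1)) = gig_kernel c (m + 1) x.
    by rewrite gig_kernelE// addrK.
  by rewrite gig_kernel_succ// gig_kernel_pred//; field.
have dl : is_derive x 1 (@ln R) x^-1 by exact: is_derive1_ln.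
have dV : is_derive x 1 (fun y : R => y^-1) (- x^-2).
  apply: (@is_derive_eq _ _ _ _ _ _ _ _ (is_deriveV (f := id) xn0 (is_derive_id x 1))).
  by rewrite /GRing.scale /= mulr1.
have din : is_derive x 1 (fun y : R => m * ln y - c * (y + y^-1)) (m * x^-1 - c * (1 - x^-2)).
  exact: (is_deriveB (is_deriveZ m dl) (is_deriveZ c (is_deriveD (is_derive_id x 1) dV))).
exact: (is_derive1_comp (f := expR)).
Qed.

Lemma continuous_gig_kernel c m x : 0 < x -> {for x, continuous (gig_kernel c m)}.
Proof.
move=> x0; have [dF _] := is_derive_gig_kernel c (m - 1) x0.
have /derivable1_diffP/differentiable_continuous := dF.
rewrite /prop_for /continuous_at -gig_kernelE//; apply: cvg_trans.
apply: near_eq_cvg; near=> y; rewrite gig_kernelE//.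
by near: y; exact: lt_nbhsr.
Unshelve. all: by end_near. Qed.

(** The fundamental theorem on [[a n, b n]], whose boundary values tend to 0. The margin
    [|m| + 3 <= c] puts the kernels of index [m], [m + 1], [m - 1] and [- m + 1] all below
    [expR (- x)]. *)
Lemma integral_derive_gig_kernel c m : `|m| + 3 <= c ->
  \int[leb]_(x in `]0, +oo[)
    (m * gig_kernel c m x - c * gig_kernel c (m + 1) x + c * gig_kernel c (m - 1) x) = 0.
Proof.
move=> mc.
pose f x := m * gig_kernel c m x - c * gig_kernel c (m + 1) x + c * gig_kernel c (m - 1) x.
pose F x := expR (m * ln x - c * (x + x^-1)).
have h1 : `|m - 1| + 1 <= c by have := ler_normB m 1; rewrite normr1; lra.
have h2 : `|m + 1 - 1| + 1 <= c by rewrite addrK; lra.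
have h3 : `|m - 1 - 1| + 1 <= c.
  rewrite (_ : m - 1 - 1 = m - 2); last by ring.
  by have := ler_normB m 2; rewrite (ger0_norm (ler0n _ 2)); lra.
have If : leb.-integrable `]0, +oo[ (EFin \o f).
  have iZ k mm : `|mm - 1| + 1 <= c ->
      leb.-integrable `]0, +oo[ (EFin \o (fun x => k * gig_kernel c mm x)).
    by move=> hk; exact: (integrableZl _ k (integrable_gig_kernel hk)).
  exact: (integrableD _ (integrableB _ (iZ m m h1) (iZ c (m + 1) h2)) (iZ c (m - 1) h3)).
have FE x : 0 < x -> F x = gig_kernel c (m + 1) x by move=> x0; rewrite gig_kernelE// addrK.
(* The inversion of [x] turns [m] into [- m], so that the boundary value at [a n = (b n)^-1] is
   treated as one at infinity. *)
have FV x : 0 < x -> F x^-1 = gig_kernel c (- m + 1) x.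
  move=> x0; rewrite gig_kernelE// addrK /F lnV ?posrE// invrK.
  by congr expR; ring.
pose b n : R := n.+2%:R; pose a n : R := (b n)^-1.
have b0 n : 0 < b n by rewrite ltr0n.
have a0 n : 0 < a n by rewrite invr_gt0.
have b1 n : 1 < b n by rewrite ltr1n.
have ab n : a n < b n by rewrite (lt_trans _ (b1 n))// invf_lt1.
have ftc n : (\int[leb]_(x in `[a n, b n]) (f x)%:E = (F (b n))%:E - (F (a n))%:E)%E.
  have pos x : a n <= x -> 0 < x by exact: lt_le_trans.
  apply: continuous_FTC2 => //.
  - apply: continuous_in_subspaceT => x; rewrite inE/= in_itv/= => /andP[/pos x0 _].
    by apply: cvgD; [apply: cvgB|]; apply: cvgM; (try exact: cvg_cst); exact: continuous_gig_kernel.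
  - split.
    + move=> x; rewrite in_itv/= => /andP[/ltW/pos x0 _].
      by case: (is_derive_gig_kernel c m x0).
    + apply: cvg_at_right_filter.
      have [dF _] := is_derive_gig_kernel c m (a0 n).
      exact/differentiable_continuous/derivable1_diffP.
    + apply: cvg_at_left_filter.
      have [dF _] := is_derive_gig_kernel c m (b0 n).
      exact/differentiable_continuous/derivable1_diffP.
  - move=> x; rewrite in_itv/= => /andP[/ltW/pos x0 _].
    by rewrite derive1E; case: (is_derive_gig_kernel c m x0).
have lim0 : (fun n => ((F (b n))%:E - (F (a n))%:E)%E) @ \oo --> 0%E.
  have e0 mm : `|mm - 1| + 1 <= c -> (fun n => gig_kernel c mm (b n)) @ \oo --> (0 : R).
    move=> hm; apply: (@squeeze_cvgr _ _ _ _ (fun=> 0) (fun n : nat => expR (- n%:R))).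
    - near=> n; rewrite gig_kernel_ge0/= (le_trans (gig_kernel_le (b0 n) hm))//.
      by rewrite ler_expR lerN2 ler_nat leqW// leqnSn.
    - exact: cvg_cst.
    - exact: cvgn_expR.
  apply: cvg_EFin; first by near=> n.
  rewrite -[0]subr0; apply: cvgB.
    by under eq_fun do rewrite FE//; exact: e0.
  under eq_fun do rewrite FV//.
  by apply: e0; rewrite addrK normrN; lra.
have limI : (fun n => (\int[leb]_(x in `]0%R, +oo[) ((EFin \o f) \_ `[a n, b n]) x)%E) @ \oo -->
   (\int[leb]_(x in `]0%R, +oo[) (f x)%:E)%E.
  have mf : measurable_fun setT f.
    apply: measurable_funD; last by apply: measurable_funM => //; exact: measurable_gig_kernel.
    by apply: measurable_funB; apply: measurable_funM => //; exact: measurable_gig_kernel.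
  apply: (@dominated_cvg _ _ _ leb `]0, +oo[%classic _
    (fun n => (EFin \o f) \_ `[a n, b n]) (fun x => (f x)%:E) (fun x => `|(f x)%:E|%E)) => //.
  - move=> n; apply: measurable_funTS; apply/(measurable_restrictT _ _).1 => //.
    by apply: measurable_funTS; exact/measurable_EFinP.
  - move=> x /=; rewrite in_itv/= andbT => x0.
    apply: cvg_near_cst; near=> n; rewrite patchE mem_set//=.
    have xn : Num.max x x^-1 <= b n.
      apply: (@le_trans _ _ n%:R); last by rewrite ler_nat leqW// leqnSn.
      by near: n; exact: nbhs_infty_ger.
    move: xn; rewrite ge_max => /andP[xb xVb]; rewrite in_itv/= xb andbT.
    by rewrite /a -[leRHS]invrK lef_pV2// posrE// invr_gt0.
  - exact: integrable_abse.
  - move=> n x _; rewrite patchE; case: ifP => // _.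
    by rewrite abse0 abse_ge0.
rewrite /Rintegral -/f.
have -> : (\int[leb]_(x in `]0%R, +oo[) (f x)%:E)%E = 0%E; last by [].
apply: (cvg_unique _ limI) => //; apply: cvg_trans lim0; apply: near_eq_cvg.
apply: nearW => n /=.
rewrite -ftc -integral_mkcondr; congr integral; apply/seteqP; split => x //=; last by move=> [].
by rewrite !in_itv/= andbT => /andP[ax xb]; split; [exact: lt_le_trans ax|rewrite ax].
Unshelve. all: by end_near. Qed.

(** At [z = 2 * c] this is the three-term recurrence of the Macdonald functions,
    [2 m K_m(z) = z (K_{m+1}(z) - K_{m-1}(z))]. *)
Lemma gig_mass_rec c m : `|m| + 3 <= c ->
  m * gig_mass c m = c * (gig_mass c (m + 1) - gig_mass c (m - 1)).
Proof.
move=> mc.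
have h1 : `|m - 1| + 1 <= c by have := ler_normB m 1; rewrite normr1; lra.
have h2 : `|m + 1 - 1| + 1 <= c by rewrite addrK; lra.
have h3 : `|m - 1 - 1| + 1 <= c.
  rewrite (_ : m - 1 - 1 = m - 2); last by ring.
  by have := ler_normB m 2; rewrite (ger0_norm (ler0n _ 2)); lra.
have iZ k mm : `|mm - 1| + 1 <= c ->
    leb.-integrable `]0, +oo[ (EFin \o (fun x => k * gig_kernel c mm x)).
  by move=> hk; exact: (integrableZl _ k (integrable_gig_kernel hk)).
have := integral_derive_gig_kernel mc.
rewrite RintegralD//; [|exact: (integrableB _ (iZ m m h1) (iZ c (m + 1) h2))|exact: iZ].
rewrite RintegralB//; [|exact: iZ|exact: iZ].
rewrite !RintegralZl//; try exact: integrable_gig_kernel.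
rewrite -/(gig_mass c m) -/(gig_mass c (m + 1)) -/(gig_mass c (m - 1)); lra.
Qed.

End gig_kernel.

(* GIG variables are positive only almost surely; this makes them positive everywhere. *)
Definition pos_part1 {R : realType} (x : R) : R := if 0 < x then x else 1.

Section law_density.
Context (R : realType) (d : measure_display) (T : measurableType d).
Variables (P : probability T R) (X : T -> R) (p : R -> R).
Notation leb := (@lebesgue_measure R).
Hypotheses (mX : measurable_fun setT X) (mp : measurable_fun setT p).
Hypothesis p0 : forall x, 0 <= p x.
Hypothesis X_law : forall A, measurable A ->
  P (X @^-1` A) = (\int[leb]_(x in A) (p x)%:E)%E.

Lemma expectation_density (f : R -> R) : measurable_fun setT f ->
  leb.-integrable setT (fun x => (f x * p x)%:E) ->
  P.-integrable setT (EFin \o (fun w => f (X w))) /\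
  \int[P]_w f (X w) = \int[leb]_x (f x * p x).
Proof.
move=> mf ifp.
(* [leb] is a measure on [measurableTypeR R], whose display is not that of [R]. *)
have mX' : measurable_fun setT (X : T -> measurableTypeR R) by exact: mX.
pose X' : {RV P >-> measurableTypeR R} := HB.pack (X : T -> measurableTypeR R)
  (isMeasurableFun.Build _ _ _ _ (X : T -> measurableTypeR R) mX').
have mf' : measurable_fun setT (f : measurableTypeR R -> R) by exact: mf.
have [i e] := integral_density (mu := leb) (nu := distribution P X') mp p0 X_law mf' ifp.
have mfE : measurable_fun setT (EFin \o f : measurableTypeR R -> \bar R).
  exact/measurable_EFinP.
have ifX : P.-integrable setT (EFin \o (fun w => f (X w))).
  apply/integrableP; split; first exact: (measurableT_comp mfE mX').
  have /integrableP[_] := i; rewrite ge0_integral_distribution//.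
  exact: measurableT_comp.
split => //.
by rewrite /Rintegral -(integral_distribution (f := EFin \o f) (X := X'))// e.
Qed.

End law_density.

Section gig_law.
Variable R : realType.
Notation leb := (@lebesgue_measure R).

Lemma pos_part1_gt0 (x : R) : 0 < pos_part1 x.
Proof. by rewrite /pos_part1; case: ifP. Qed.

Lemma measurable_pos_part1 : measurable_fun setT (@pos_part1 R).
Proof.
apply: measurable_fun_ifT => //; exact: measurable_fun_ltr.
Qed.

Lemma gig_mass_ge0 (c m : R) : 0 <= gig_mass c m.
Proof. by apply: Rintegral_ge0 => x _; exact: gig_kernel_ge0. Qed.

Lemma gig_pdfE (lambda a x : R) : gig_pdf lambda a x =
  if 0 < x then (gig_mass (a ^+ 2 / 2) lambda)^-1 * gig_kernel (a ^+ 2 / 2) lambda x else 0.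
Proof.
rewrite /gig_pdf; congr (if _ then _^-1 * _ else _).
by rewrite /macdonald mulrA divff// mul1r.
Qed.

Lemma gig_pdf_ge0 (lambda a x : R) : 0 <= gig_pdf lambda a x.
Proof.
rewrite gig_pdfE; case: ifP => // _.
by rewrite mulr_ge0 ?invr_ge0 ?gig_mass_ge0 ?gig_kernel_ge0.
Qed.

Lemma measurable_gig_pdf (lambda a : R) : measurable_fun setT (gig_pdf lambda a).
Proof.
rewrite (_ : gig_pdf lambda a = fun x => if 0 < x then
  (gig_mass (a ^+ 2 / 2) lambda)^-1 * gig_kernel (a ^+ 2 / 2) lambda x else 0); last first.
  by apply/funext => x; exact: gig_pdfE.
apply: measurable_fun_ifT => //; first exact: measurable_fun_ltr.
by apply: measurable_funM => //; exact: measurable_gig_kernel.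
Qed.

Section expectation.
Context (d : measure_display) (T : measurableType d) (P : probability T R).
Variables (lambda a : R) (X : {RV P >-> R}).
Hypothesis X_law : has_gig_law lambda a X.
Let c := a ^+ 2 / 2.

(** The density is carried by the positive half-line, where [pos_part1] is the identity; the value 1
    that it takes elsewhere receives no mass. *)
Lemma gig_expectation (f : R -> R) : measurable_fun setT f ->
  leb.-integrable `]0, +oo[ (EFin \o (fun x => f x * gig_kernel c lambda x)) ->
  P.-integrable setT (EFin \o (fun w => f (pos_part1 (X w)))) /\
  \int[P]_w f (pos_part1 (X w)) =
    (gig_mass c lambda)^-1 * \int[leb]_(x in `]0, +oo[) (f x * gig_kernel c lambda x).
Proof.
move=> mf iff; set M := gig_mass c lambda.
pose g x := f (pos_part1 x).
have mg : measurable_fun setT g by apply: measurableT_comp => //; exact: measurable_pos_part1.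
pose h x := M^-1 * (f x * gig_kernel c lambda x).
have gE : (fun x => (g x * gig_pdf lambda a x)%:E) = (EFin \o h) \_ `]0, +oo[.
  apply/funext => x; rewrite patchE gig_pdfE /g /pos_part1.
  case: ltP => x0; last by rewrite memNset ?mulr0//= in_itv/= andbT ltNge x0.
  by rewrite mem_set/= ?in_itv/= ?x0// /h mulrCA.
have ih : leb.-integrable `]0, +oo[ (EFin \o h) by exact: (integrableZl _ M^-1 iff).
have igp : leb.-integrable setT (fun x => (g x * gig_pdf lambda a x)%:E).
  by rewrite gE -integrable_mkcond.
have [ig eg] := expectation_density (measurable_funPT X) (measurable_gig_pdf lambda a)
  (@gig_pdf_ge0 lambda a) X_law mg igp.
split => //; rewrite eg /Rintegral gE.
rewrite -[M^-1 * _](RintegralZl _ _ iff)//; congr fine.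
by rewrite [RHS]integral_mkcond.
Qed.

End expectation.
End gig_law.

Section sinh_cosh.
Variable R : realFieldType.
Implicit Types x : R.

Lemma cosh_ge1 x : 0 < x -> 1 <= (x + x^-1) / 2.
Proof. by move=> /sinhv_cosh[w [w0 xE xVE _]]; rewrite {1}xE xVE; lra. Qed.

(** With [w = cosh - 1] this is [w <= (w ^+ 2 + 2 * w) / 2]. The right side is spelled as the
    combination of [1] and [sinhv x ^+ 2] that is integrated later. *)
Lemma cosh_le x : 0 < x -> (x + x^-1) / 2 <= 1 * 1 + 2^-1 * sinhv x ^+ 2.
Proof.
move=> /sinhv_cosh[w [w0 xE xVE yw]]; rewrite {1}xE xVE yw.
by have := sqr_ge0 w; lra.
Qed.

(** The left side is what integration by parts against [sinh ^ 3] leaves: [lambda] times [sinh ^ 3],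
    plus the derivative of [sinh ^ 3]. Splitting the odd power by [2 |y|^3 <= y^2 + y^4] and
    bounding cosh by [cosh_le] leaves only the powers 2 and 4, so that the moment estimates close
    up. *)
Lemma sinh_cubic_le lambda x : 0 < x ->
  lambda * sinhv x ^+ 3 + 3 * (sinhv x ^+ 2 * ((x + x^-1) / 2)) <=
  (`|lambda| / 2 + 3) * sinhv x ^+ 2 + (`|lambda| / 2 + 3 / 2) * sinhv x ^+ 4.
Proof.
move=> x0; have := cosh_le x0; move: ((x + x^-1) / 2) => ch; set y := sinhv x => hw.
have y2 : 0 <= y ^+ 2 := sqr_ge0 y.
have h3 : 3 * (y ^+ 2 * ch) <= 3 * (y ^+ 2 * (1 * 1 + 2^-1 * y ^+ 2)).
  by rewrite ler_wpM2l// ler_wpM2l.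
have hy : lambda * y ^+ 3 <= `|lambda| * ((y ^+ 2 + y ^+ 4) / 2).
  apply: le_trans (ler_norm _) _; rewrite normrM ler_wpM2l// ler_norml.
  have := mulr_ge0 y2 (sqr_ge0 (y - 1)); have := mulr_ge0 y2 (sqr_ge0 (y + 1)).
  by move=> *; apply/andP; split; lra.
lra.
Qed.

Variables (c lambda j0 j1 j2 j3 j4 k1 k2 k3 k4 : R).
Hypothesis j0_gt0 : 0 < j0.

Let cancel_j0 (u v : R) : j0 * u = j0 * v -> u = v.
Proof. by apply: mulfI; rewrite gt_eqF. Qed.

(** Here and in the next two lemmas [j1], [k1] and the like stand for the masses of index
    [lambda + 1], [lambda - 1] and so on, [s1] and [s2] for normalised moments of sinh, and [ch] for
    that of cosh. The hypotheses in [c] are instances of [gig_mass_rec]. *)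
Lemma first_moment_rec s1 : lambda * j0 = c * (j1 - k1) ->
  j0 * s1 = (j1 - k1) / 2 -> 2 * c * s1 = lambda.
Proof.
move=> r e; apply: cancel_j0; rewrite [RHS]mulrC r.
have -> : j0 * (2 * c * s1) = 2 * c * (j0 * s1) by ring.
by rewrite e; field.
Qed.

Lemma second_moment_rec s1 s2 ch : (lambda + 1) * j1 = c * (j2 - j0) ->
  (lambda - 1) * k1 = c * (j0 - k2) ->
  j0 * s1 = (j1 - k1) / 2 -> j0 * s2 = (j2 - 2 * j0 + k2) / 4 ->
  (j1 + k1) / 2 = j0 * ch -> 2 * c * s2 = lambda * s1 + ch.
Proof.
move=> r q e1 e2 e3; apply: cancel_j0; rewrite mulrDr -e3.
have -> : j0 * (2 * c * s2) = 2 * c * (j0 * s2) by ring.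
have -> : j0 * (lambda * s1) = lambda * (j0 * s1) by ring.
rewrite e1 e2.
have -> : 2 * c * ((j2 - 2 * j0 + k2) / 4) = (c * (j2 - j0) - c * (j0 - k2)) / 2 by field.
by rewrite -r -q; field.
Qed.

Lemma fourth_moment_rec :
  (lambda + 1) * j1 = c * (j2 - j0) -> (lambda + 3) * j3 = c * (j4 - j2) ->
  (lambda - 1) * k1 = c * (j0 - k2) -> (lambda - 3) * k3 = c * (k2 - k4) ->
  2 * c * ((j4 - 4 * j2 + 6 * j0 - 4 * k2 + k4) / 16) =
  ((lambda + 3) * j3 - 3 * (lambda + 1) * j1 + 3 * (lambda - 1) * k1 - (lambda - 3) * k3) / 8.
Proof.
move=> r1 r3 q1 q3.
by rewrite -(mulrA 3) -(mulrA 3 _ k1) r1 r3 q1 q3; field.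
Qed.

End sinh_cosh.

Section gig_moments.
Variable R : realType.
Notation leb := (@lebesgue_measure R).
Implicit Types (c lambda x : R).

Lemma gig_kernel_addn c m k x : 0 < x ->
  gig_kernel c (m + k%:R) x = x ^+ k * gig_kernel c m x.
Proof.
move=> x0; elim: k => [|k IH]; first by rewrite addr0 mul1r.
by rewrite -natr1 addrA gig_kernel_succ// IH exprS mulrA.
Qed.

Lemma gig_kernel_subn c m k x : 0 < x ->
  gig_kernel c (m - k%:R) x = x^-1 ^+ k * gig_kernel c m x.
Proof.
move=> x0; elim: k => [|k IH]; first by rewrite subr0 mul1r.
by rewrite -natr1 opprD addrA gig_kernel_pred// IH exprS mulrA.
Qed.

(** A Laurent polynomial in [x] times the kernel is a combination of kernels of shifted index; [s]
    lists the pairs of a coefficient and an index. *)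
Lemma gig_laurent c lambda (s : seq (R * R)) (f : R -> R) :
  all (fun p => `|p.2 - 1| + 1 <= c) s ->
  (forall x, 0 < x -> f x * gig_kernel c lambda x = \sum_(p <- s) p.1 * gig_kernel c p.2 x) ->
  leb.-integrable `]0, +oo[ (EFin \o (fun x => f x * gig_kernel c lambda x)) /\
  \int[leb]_(x in `]0, +oo[) (f x * gig_kernel c lambda x) = \sum_(p <- s) p.1 * gig_mass c p.2.
Proof.
move=> hs fE.
have [iS eS] : leb.-integrable `]0, +oo[ (EFin \o (fun x => \sum_(p <- s) p.1 * gig_kernel c p.2 x)) /\
    \int[leb]_(x in `]0, +oo[) (\sum_(p <- s) p.1 * gig_kernel c p.2 x) =
      \sum_(p <- s) p.1 * gig_mass c p.2.
  elim: s hs {fE} => [_|p s IH /= /andP[hp /IH[iS eS]]].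
    have -> : (fun x => \sum_(p <- [::] : seq (R * R)) p.1 * gig_kernel c p.2 x) = fun=> 0.
      by apply/funext => x; rewrite big_nil.
    rewrite big_nil; split; first exact: integrable0.
    by rewrite Rintegral_cst// mul0r.
  have ip : leb.-integrable `]0, +oo[ (EFin \o (fun x => p.1 * gig_kernel c p.2 x)).
    exact: (integrableZl _ p.1 (integrable_gig_kernel hp)).
  have -> : (fun x => \sum_(q <- p :: s) q.1 * gig_kernel c q.2 x) =
      fun x => p.1 * gig_kernel c p.2 x + \sum_(q <- s) q.1 * gig_kernel c q.2 x.
    by apply/funext => x; rewrite big_cons.
  rewrite big_cons; split; first exact: (integrableD _ ip iS).
  by rewrite RintegralD// eS RintegralZl//; exact: integrable_gig_kernel.
split.
  apply: eq_integrable iS => // x; rewrite inE/= in_itv/= andbT => x0.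
  by rewrite /= fE.
rewrite -eS; apply: eq_Rintegral => x; rewrite inE/= in_itv/= andbT => x0.
exact: fE.
Qed.

Definition gig_sinh c lambda (k : nat) : R :=
  (gig_mass c lambda)^-1 * \int[leb]_(x in `]0, +oo[) (sinhv x ^+ k * gig_kernel c lambda x).

Section large.
Variables (c lambda : R).
(** Indices between [lambda - 4] and [lambda + 4] are integrated and the recurrence is used up to
    distance 3 from [lambda]; either way the requirement on [c] is at most [|lambda| + 6]. *)
Hypothesis c_large : `|lambda| + 8 <= c.

Let hk (k : R) : `|k| <= 4 -> `|lambda + k - 1| + 1 <= c.
Proof.
move=> k4; have := ler_normD (lambda + k) (- 1); have := ler_normD lambda k.
by move: c_large; rewrite normrN1; lra.
Qed.
Let n4 (k : nat) : (k <= 4)%N -> `|k%:R| <= 4 :> R.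
Proof. by move=> k4; rewrite ger0_norm// ler_nat. Qed.
Let hp (k : nat) : (k <= 4)%N -> `|lambda + k%:R - 1| + 1 <= c.
Proof. by move=> k4; apply: hk; exact: n4. Qed.
Let hn (k : nat) : (k <= 4)%N -> `|lambda - k%:R - 1| + 1 <= c.
Proof. by move=> k4; apply: hk; rewrite normrN; exact: n4. Qed.

Let j (k : nat) := gig_mass c (lambda + k%:R).
Let jN (k : nat) := gig_mass c (lambda - k%:R).

Let kE (k : nat) x : 0 < x -> gig_kernel c (lambda + k%:R) x = x ^+ k * gig_kernel c lambda x.
Proof. exact: gig_kernel_addn. Qed.
Let kNE (k : nat) x : 0 < x -> gig_kernel c (lambda - k%:R) x = x^-1 ^+ k * gig_kernel c lambda x.
Proof. exact: gig_kernel_subn. Qed.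

Let I (f : R -> R) := \int[leb]_(x in `]0, +oo[) (f x * gig_kernel c lambda x).
Let int (f : R -> R) :=
  leb.-integrable `]0, +oo[ (EFin \o (fun x => f x * gig_kernel c lambda x)).

Let L1 : int (fun x => sinhv x ^+ 1) /\ I (fun x => sinhv x ^+ 1) = (j 1 - jN 1) / 2.
Proof.
have [|x x0|i e] := @gig_laurent c lambda
  [:: (2^-1, lambda + 1%:R); (- 2^-1, lambda - 1%:R)] (fun x => sinhv x ^+ 1).
- by rewrite /= !hp ?hn.
- by rewrite !big_cons big_nil /= kE// kNE// /sinhv; field; lra.
by split => //; rewrite /I e !big_cons big_nil /= -/(j 1) -/(jN 1); field.
Qed.

Let L2 : int (fun x => sinhv x ^+ 2) /\
  I (fun x => sinhv x ^+ 2) = (j 2 - 2 * j 0 + jN 2) / 4.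
Proof.
have [|x x0|i e] := @gig_laurent c lambda
  [:: (4^-1, lambda + 2%:R); (- 2^-1, lambda + 0%:R); (4^-1, lambda - 2%:R)]
  (fun x => sinhv x ^+ 2).
- by rewrite /= !hp ?hn.
- by rewrite !big_cons big_nil /= !kE// kNE// /sinhv; field; lra.
by split => //; rewrite /I e !big_cons big_nil /= -/(j 2) -/(j 0) -/(jN 2); field.
Qed.

Let L4 : int (fun x => sinhv x ^+ 4) /\
  I (fun x => sinhv x ^+ 4) = (j 4 - 4 * j 2 + 6 * j 0 - 4 * jN 2 + jN 4) / 16.
Proof.
have [|x x0|i e] := @gig_laurent c lambda
  [:: (16^-1, lambda + 4%:R); (- 4^-1, lambda + 2%:R); (6/16, lambda + 0%:R);
      (- 4^-1, lambda - 2%:R); (16^-1, lambda - 4%:R)]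
  (fun x => sinhv x ^+ 4).
- by rewrite /= !hp ?hn.
- by rewrite !big_cons big_nil /= !kE// !kNE// /sinhv; field; lra.
split => //; rewrite /I e !big_cons big_nil /=.
by rewrite -/(j 2) -/(j 0) -/(j 4) -/(jN 4) -/(jN 2); field.
Qed.

Let Lch : int (fun x => (x + x^-1) / 2) /\ I (fun x => (x + x^-1) / 2) = (j 1 + jN 1) / 2.
Proof.
have [|x x0|i e] := @gig_laurent c lambda
  [:: (2^-1, lambda + 1%:R); (2^-1, lambda - 1%:R)] (fun x => (x + x^-1) / 2).
- by rewrite /= !hp ?hn.
- by rewrite !big_cons big_nil /= kE// kNE//; field; lra.
by split => //; rewrite /I e !big_cons big_nil /= -/(j 1) -/(jN 1); field.
Qed.

Let L0 : int (fun=> 1) /\ I (fun=> 1) = j 0.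
Proof.
have [|x x0|i e] := @gig_laurent c lambda [:: (1, lambda + 0%:R)] (fun=> 1).
- by rewrite /= !hp ?hn.
- by rewrite !big_cons big_nil /= kE// expr0; ring.
by split => //; rewrite /I e !big_cons big_nil /= -/(j 0); ring.
Qed.

(** The integrand is the one whose expectation equals [2 * c] times that of [sinh ^ 4]: its mass
    expression is the right side of [fourth_moment_rec]. *)
Let Lmix : int (fun x => lambda * sinhv x ^+ 3 + 3 * (sinhv x ^+ 2 * ((x + x^-1) / 2))) /\
  I (fun x => lambda * sinhv x ^+ 3 + 3 * (sinhv x ^+ 2 * ((x + x^-1) / 2))) =
    ((lambda + 3) * j 3 - 3 * (lambda + 1) * j 1 + 3 * (lambda - 1) * jN 1 - (lambda - 3) * jN 3) / 8.
Proof.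
have [|x x0|i e] := @gig_laurent c lambda
  [:: ((lambda + 3) / 8, lambda + 3%:R); (- (3 * (lambda + 1) / 8), lambda + 1%:R);
      (3 * (lambda - 1) / 8, lambda - 1%:R); (- ((lambda - 3) / 8), lambda - 3%:R)]
  (fun x => lambda * sinhv x ^+ 3 + 3 * (sinhv x ^+ 2 * ((x + x^-1) / 2))).
- by rewrite /= !hp ?hn.
- by rewrite !big_cons big_nil /= !kE// !kNE// /sinhv; field; lra.
split => //; rewrite /I e !big_cons big_nil /=.
by rewrite -/(j 3) -/(j 1) -/(jN 1) -/(jN 3); field.
Qed.

Let le_I f g : int f -> int g -> (forall x, 0 < x -> f x <= g x) -> I f <= I g.
Proof.
move=> If Ig fg; apply: le_Rintegral => // x /=; rewrite in_itv/= andbT => x0.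
by rewrite ler_wpM2r ?gig_kernel_ge0// fg.
Qed.

Let comb f g (a b : R) : int f -> int g ->
  int (fun x => a * f x + b * g x) /\ I (fun x => a * f x + b * g x) = a * I f + b * I g.
Proof.
move=> If Ig.
have ia : leb.-integrable `]0, +oo[ (EFin \o (fun x => a * (f x * gig_kernel c lambda x))).
  exact: (integrableZl _ a If).
have ib : leb.-integrable `]0, +oo[ (EFin \o (fun x => b * (g x * gig_kernel c lambda x))).
  exact: (integrableZl _ b Ig).
have E : (fun x => (a * f x + b * g x) * gig_kernel c lambda x) =
   (fun x => a * (f x * gig_kernel c lambda x) + b * (g x * gig_kernel c lambda x)).
  by apply/funext => x; ring.
rewrite /int /I E; split; first exact: (integrableD _ ia ib).
by rewrite RintegralD// !RintegralZl.
Qed.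

Let rec (m : R) : `|m| <= `|lambda| + 3 -> m * gig_mass c m = c * (gig_mass c (m + 1) - gig_mass c (m - 1)).
Proof. by move=> hm; apply: gig_mass_rec; move: c_large; lra. Qed.

Let recp (k : nat) : (k <= 2)%N ->
  (lambda + k.+1%:R) * j k.+1 = c * (j k.+2 - j k).
Proof.
move=> k2; have := @rec (lambda + k.+1%:R).
have -> : lambda + k.+1%:R + 1 = lambda + k.+2%:R by rewrite -addrA natr1.
have -> : lambda + k.+1%:R - 1 = lambda + k%:R by rewrite -natr1 addrA addrK.
apply; rewrite (le_trans (ler_normD _ _))// lerD2l ger0_norm// ler_nat; exact: k2.
Qed.

Let recn (k : nat) : (k <= 2)%N ->
  (lambda - k.+1%:R) * jN k.+1 = c * (jN k - jN k.+2).
Proof.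
move=> k2; have := @rec (lambda - k.+1%:R).
have -> : lambda - k.+1%:R - 1 = lambda - k.+2%:R by rewrite -(natr1 k.+1); ring.
have -> : lambda - k.+1%:R + 1 = lambda - k%:R by rewrite -natr1; ring.
by apply; rewrite (le_trans (ler_normB _ _))// lerD2l ger0_norm// ler_nat; exact: k2.
Qed.

Let rec0 : lambda * j 0 = c * (j 1 - jN 1).
Proof. by have := @rec lambda; rewrite /j /jN addr0; apply; lra. Qed.

Let jN0 : jN 0 = j 0. Proof. by rewrite /j /jN subr0 addr0. Qed.

Lemma gig_sinh_integrable k : k \in [:: 1; 2; 4]%N ->
  leb.-integrable `]0, +oo[ (EFin \o (fun x => sinhv x ^+ k * gig_kernel c lambda x)).
Proof.
by rewrite !inE => /or3P[] /eqP ->; [case: L1|case: L2|case: L4].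
Qed.

Lemma integrable_gig_kernel_large :
  leb.-integrable `]0, +oo[ (EFin \o (fun x => 1 * gig_kernel c lambda x)).
Proof. by case: L0. Qed.

(* Integrating by parts against [1], [sinh] and [sinh^3] in the variable
   [u = ln x], where the density is proportional to
   [expR (lambda * u - 2 * c * cosh u)]. *)
Lemma gig_sinh_estimates : 0 < gig_mass c lambda ->
  [/\ 2 * c * gig_sinh c lambda 1 = lambda,
      `|2 * c * gig_sinh c lambda 2 - 1 - lambda * gig_sinh c lambda 1|
        <= gig_sinh c lambda 2 / 2,
      2 * c * gig_sinh c lambda 4 <= (`|lambda| / 2 + 3) * gig_sinh c lambda 2 +
        (`|lambda| / 2 + 3 / 2) * gig_sinh c lambda 4,
      0 <= gig_sinh c lambda 2 & 0 <= gig_sinh c lambda 4].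
Proof.
have jE : gig_mass c lambda = j 0 by rewrite /j addr0.
rewrite jE => M0.
have sE k : I (fun x => sinhv x ^+ k) = j 0 * gig_sinh c lambda k.
  by rewrite /gig_sinh jE mulVKf// gt_eqF.
have c0 : 0 < c by move: c_large; have := normr_ge0 lambda; lra.
have [i1 e1] := L1; have [i2 e2] := L2; have [i4 e4] := L4.
have [ich ech] := Lch; have [imix emix] := Lmix; have [i0 e0] := L0.
rewrite sE in e1; rewrite sE in e2; rewrite sE in e4.
set s1 := gig_sinh c lambda 1 in e1 *; set s2 := gig_sinh c lambda 2 in e2 *.
set s4 := gig_sinh c lambda 4 in e4 *.
have r1 := recp (isT : (0 <= 2)%N); have r2 := recp (isT : (1 <= 2)%N).
have r3 := recp (isT : (2 <= 2)%N).
have q1 := recn (isT : (0 <= 2)%N); have q2 := recn (isT : (1 <= 2)%N).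
have q3 := recn (isT : (2 <= 2)%N).
rewrite jN0 in q1.
have s2_ge0 : 0 <= s2.
  rewrite -(pmulr_rge0 _ M0) -sE; apply: Rintegral_ge0 => x _.
  by rewrite mulr_ge0 ?gig_kernel_ge0 ?sqr_ge0.
have s4_ge0 : 0 <= s4.
  rewrite -(pmulr_rge0 _ M0) -sE; apply: Rintegral_ge0 => x _.
  by rewrite mulr_ge0 ?gig_kernel_ge0// (exprM _ 2 2) sqr_ge0.
pose ch := (j 1 + jN 1) / 2 / j 0.
have chE : (j 1 + jN 1) / 2 = j 0 * ch by rewrite /ch; field; rewrite gt_eqF.
have ch1 : 1 <= ch.
  rewrite -(ler_pM2l M0) -chE -ech mulr1 -e0; apply: le_I => //.
  exact: cosh_ge1.
have ch2 : ch <= 1 + s2 / 2.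
  have [ic ec] := comb 1 2^-1 i0 i2.
  rewrite -(ler_pM2l M0) -chE -ech.
  have -> : j 0 * (1 + s2 / 2) = 1 * j 0 + 2^-1 * (j 0 * s2) by field.
  rewrite -{1}e0 -sE -ec; apply: le_I => //; exact: cosh_le.
have E2 := second_moment_rec M0 r1 q1 e1 e2 chE.
have E4 := fourth_moment_rec r1 r3 q1 q3.
split => //.
- by have := first_moment_rec M0 rec0 e1.
- have -> : 2 * c * s2 - 1 - lambda * s1 = ch - 1 by rewrite E2; ring.
  by rewrite ger0_norm ?subr_ge0// lerBlDl.
- have [ic ec] := comb (`|lambda| / 2 + 3) (`|lambda| / 2 + 3 / 2) i2 i4.
  rewrite -(ler_pM2l M0).
  have -> : j 0 * ((`|lambda| / 2 + 3) * s2 + (`|lambda| / 2 + 3 / 2) * s4) =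
    (`|lambda| / 2 + 3) * (j 0 * s2) + (`|lambda| / 2 + 3 / 2) * (j 0 * s4) by ring.
  have -> : j 0 * (2 * c * s4) = 2 * c * (j 0 * s4) by ring.
  rewrite [leLHS](etrans (congr1 _ e4) (etrans E4 (esym emix))) -(sE 2%N) -(sE 4%N) -ec.
  by apply: le_I => // x x0; exact: sinh_cubic_le.
Qed.

End large.
End gig_moments.

(** * Diffusive scaling of the moments *)

Definition diffusive_moments {R : realType} (lambda : R) (s : nat -> nat -> R) : Prop :=
  [/\ (fun n => n%:R * s n 1%N) @ \oo --> lambda,
      (fun n => n%:R * s n 2%N) @ \oo --> (1 : R)
    & (fun n => n%:R * s n 4%N) @ \oo --> (0 : R)].

Section diffusive.
Variable R : realType.

Lemma cvg_invn (K : R) : (fun n : nat => K / n%:R) @ \oo --> (0 : R).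
Proof.
rewrite -(mulr0 K); apply: cvgM; first exact: cvg_cst.
by apply/gtr0_cvgV0; [near=> n; rewrite ltr0n; near: n; exact: nbhs_infty_gt|exact: cvgr_idn].
Unshelve. all: by end_near. Qed.

Lemma cvg_dist_invn (f : nat -> R) (l K : R) :
  (\forall n \near \oo, `|f n - l| <= K / n%:R) -> f @ \oo --> l.
Proof.
move=> h; apply/cvgrPdist_le => e e0; near=> n.
rewrite distrC; apply: (@le_trans _ _ (K / n%:R)); first by near: n.
near: n; have /cvgrPdist_le/(_ _ e0) := cvg_invn K.
by apply: filterS => n; rewrite sub0r normrN; apply: le_trans; exact: ler_norm.
Unshelve. all: by end_near. Qed.

(** First and second moments agree in the limit and the fourth ones vanish. What survives is [r]
    times the sum of the two second moments, and [r] can be taken small. *)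
Lemma cvg_taylor_gap lambda (s u : nat -> nat -> R) r : 0 < r ->
  diffusive_moments lambda s -> diffusive_moments lambda u ->
  (fun n => n%:R * taylor_gap r (s n) (u n)) @ \oo --> r * 2.
Proof.
move=> r0 [s1 s2 s4] [u1 u2 u4].
have E n : n%:R * taylor_gap r (s n) (u n) =
    `|n%:R * s n 1%N - n%:R * u n 1%N| + `|n%:R * s n 2%N - n%:R * u n 2%N| +
    r * (n%:R * s n 2%N + n%:R * u n 2%N) + (n%:R * s n 4%N + n%:R * u n 4%N) * r^-1.
  rewrite -!mulrBr !normrM (ger0_norm (ler0n _ n)) /taylor_gap; ring.
under eq_fun do rewrite E.
have -> : r * 2 = `|lambda - lambda| + `|1 - 1 : R| + r * (1 + 1) + (0 + 0) * r^-1.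
  by rewrite !subrr normr0 addr0 mul0r addr0 add0r.
apply: cvgD; last by apply: cvgM; [exact: cvgD|exact: cvg_cst].
apply: cvgD; last by apply: cvgM; [exact: cvg_cst|exact: cvgD].
by apply: cvgD; apply: cvg_norm; exact: cvgB.
Qed.

(** Positivity of the mass is a hypothesis here; it is derived in [gig_mass_gt0] from the existence
    of variables with this law. *)
Lemma gig_diffusive (lambda : R) :
  (forall n : nat, 2 * `|lambda| + 16 <= n%:R -> 0 < gig_mass (n%:R / 2) lambda) ->
  diffusive_moments lambda (fun n => gig_sinh (n%:R / 2) lambda).
Proof.
move=> M0.
pose K1 := `|lambda| / 2 + 3; pose K2 := `|lambda| / 2 + 3 / 2.
have K10 : 0 <= K1 by rewrite addr_ge0// divr_ge0.
have l20 : 0 <= lambda ^+ 2 := sqr_ge0 lambda.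
have est (n : nat) : 2 * `|lambda| + 16 <= n%:R ->
   [/\ n%:R * gig_sinh (n%:R / 2) lambda 1 = lambda,
     `|n%:R * gig_sinh (n%:R / 2) lambda 2 - 1| <= (lambda ^+ 2 + (1 + lambda ^+ 2)) / n%:R
   & `|n%:R * gig_sinh (n%:R / 2) lambda 4 - 0| <= 4 * K1 * (1 + lambda ^+ 2) / n%:R].
  move=> hn; have l0 := normr_ge0 lambda.
  have n1 : 1 <= n%:R :> R by lra.
  have n0 : 0 < n%:R :> R by lra.
  have large : `|lambda| + 8 <= n%:R / 2 by lra.
  have [] := gig_sinh_estimates large (M0 n hn).
  have -> : 2 * (n%:R / 2) = n%:R :> R by field.
  set s1 := gig_sinh _ _ 1; set s2 := gig_sinh _ _ 2; set s4 := gig_sinh _ _ 4.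
  move=> e1 e2 e4 s20 s40.
  have s1E : lambda * s1 = lambda ^+ 2 / n%:R by rewrite expr2 -mulrA -{3}e1 mulrAC divff ?mul1r// gt_eqF.
  have inv1 : lambda ^+ 2 / n%:R <= lambda ^+ 2.
    by rewrite ler_pdivrMr// ler_peMr.
  move: e2; rewrite s1E ler_norml => /andP[e2 e2'].
  (* The estimate is self-referential, [n * s2 <= 1 + lambda ^+ 2 + s2 / 2]; since [s2 <= n * s2],
     half of the left side absorbs the last term. *)
  have s2n : s2 <= 2 * (1 + lambda ^+ 2) / n%:R.
    rewrite ler_pdivlMr//.
    have : s2 * 1 <= s2 * n%:R by rewrite ler_wpM2l.
    lra.
  have -> : (lambda ^+ 2 + (1 + lambda ^+ 2)) / n%:R =
     lambda ^+ 2 / n%:R + 2 * (1 + lambda ^+ 2) / n%:R / 2 by field; rewrite gt_eqF.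
  split; first exact: e1.
    have : 0 <= lambda ^+ 2 / n%:R by rewrite divr_ge0.
    by move=> ?; rewrite ler_norml; apply/andP; split; lra.
  rewrite subr0 ger0_norm; last exact: mulr_ge0.
  (* The same absorption for the fourth moment: [K2 <= n / 2], so half of [n * s4] swallows
     [K2 * s4]. *)
  have : K2 * s4 <= n%:R / 2 * s4 by rewrite ler_wpM2r// /K2; lra.
  have : K1 * s2 <= K1 * (2 * (1 + lambda ^+ 2) / n%:R) by rewrite ler_wpM2l.
  rewrite -/K1 -/K2 in e4.
  have -> : 4 * K1 * (1 + lambda ^+ 2) / n%:R = 2 * (K1 * (2 * (1 + lambda ^+ 2) / n%:R)).
    by field; rewrite gt_eqF.
  lra.
split.
- apply: cvg_near_cst; near=> n; have [] := est n; last by move=> ->.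
  by near: n; exact: nbhs_infty_ger.
- apply: (@cvg_dist_invn _ _ (lambda ^+ 2 + (1 + lambda ^+ 2))).
  near=> n; have [] := est n; last by [].
  by near: n; exact: nbhs_infty_ger.
- apply: (@cvg_dist_invn _ _ (4 * K1 * (1 + lambda ^+ 2))).
  near=> n; have [] := est n; last by [].
  by near: n; exact: nbhs_infty_ger.
Unshelve. all: by end_near. Qed.

Lemma cvg_expR_invn (a : R) : (fun n => n%:R * (expR (a / n%:R) - 1)) @ \oo --> a.
Proof.
apply: (@cvg_dist_invn _ _ (2 * a ^+ 2)); near=> n.
have n1 : 1 + 2 * `|a| <= n%:R by near: n; exact: nbhs_infty_ger.
have n0 : 0 < n%:R :> R by apply: lt_le_trans n1; rewrite ltr_pwDl// mulr_ge0.
set x := a / n%:R.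
have ax : a = n%:R * x by rewrite /x; field; rewrite gt_eqF.
have x2 : `|x| <= 2^-1.
  rewrite /x normrM normfV (gtr0_norm n0) ler_pdivrMr//.
  by move: n1; clear; lra.
have -> : n%:R * (expR x - 1) - a = n%:R * (expR x - 1 - x) by rewrite ax; ring.
have -> : 2 * a ^+ 2 / n%:R = n%:R * (2 * x ^+ 2) by rewrite /x; field; rewrite gt_eqF.
rewrite normrM gtr0_norm// ler_wpM2l// ?(ltW n0)//.
have h1 := expR_ge1Dx x; have := expR_ge1Dx (- x).
rewrite expRN -/x => h2.
have e0 := expR_gt0 x.
have h3 : (1 - x) * expR x <= 1.
  by rewrite -[leRHS](mulVf (lt0r_neq0 e0)) ler_wpM2r// ltW.
have : `|x| <= 2^-1 by []; rewrite ler_norml => /andP[xa xb].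
rewrite ger0_norm; last by lra.
(* [h3] amounts to [(1 - x) * (expR x - 1 - x) <= x ^+ 2]; together with [1 - x >= 2^-1] it gives
   the constant 2. *)
have h4 : 0 <= (2^-1 - x) * (expR x - 1 - x) by rewrite mulr_ge0//; lra.
have := sqr_ge0 x; lra.
Unshelve. all: by end_near. Qed.

(* [lognormal b v k] is the mean of [expR (k * h)] for [h] normal of mean [b]
   and variance [v]. *)
Definition lognormal (b v k : R) : R := expR (k * b + k ^+ 2 * v / 2).

(** Binomial expansion of [sinh ^ k]; the last branch is the case [k = 4], the only other degree
    that [sinh_moments] consults. *)
Definition lognormal_sinh (b v : R) (k : nat) : R :=
  let e := lognormal b v in
  if k == 1%N then (e 1 - e (-1)) / 2
  else if k == 2%N then (e 2 - 2 + e (-2)) / 4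
  else (e 4 - 4 * e 2 + 6 - 4 * e (-2) + e (-4)) / 16.

(** The coefficients in each moment sum to zero, so 1 may be subtracted from every exponential;
    [n * (expR (a k / n) - 1)] tends to [a k], and the limits are the same combinations of the
    [a k]. *)
Lemma lognormal_diffusive (lambda : R) :
  diffusive_moments lambda (fun n => lognormal_sinh (lambda / n%:R) n%:R^-1).
Proof.
pose a (k : R) := k * lambda + k ^+ 2 / 2.
pose L (k : R) (n : nat) := n%:R * (expR (a k / n%:R) - 1).
have LE k : L k @ \oo --> a k by exact: cvg_expR_invn.
have eE k (n : nat) : lognormal (lambda / n%:R) n%:R^-1 k = expR (a k / n%:R).
  by rewrite /lognormal /a; congr expR; ring.
have cZ (u : nat -> R) l c : u @ \oo --> l -> (fun n => c * u n) @ \oo --> c * l.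
  by move=> ul; apply: cvgM => //; exact: cvg_cst.
split.
- have aE : 2^-1 * (a 1 - a (-1)) = lambda by rewrite /a; field.
  rewrite -[X in _ --> X]aE.
  apply: cvg_trans (cZ _ _ 2^-1 (cvgB (LE 1) (LE (-1)))).
  apply: near_eq_cvg; apply: nearW => n.
  by rewrite !fctE /lognormal_sinh /= !eE /L; field.
- have aE : 4^-1 * (a 2 + a (-2)) = 1 by rewrite /a; field.
  rewrite -[X in _ --> X]aE.
  apply: cvg_trans (cZ _ _ 4^-1 (cvgD (LE 2) (LE (-2)))).
  apply: near_eq_cvg; apply: nearW => n.
  by rewrite !fctE /lognormal_sinh /= !eE /L; field.
- have aE : 16^-1 * (a 4 + a (-4)) - 4^-1 * (a 2 + a (-2)) = 0 by rewrite /a; field.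
  rewrite -[X in _ --> X]aE.
  apply: cvg_trans (cvgB (cZ _ _ 16^-1 (cvgD (LE 4) (LE (-4)))) (cZ _ _ 4^-1 (cvgD (LE 2) (LE (-2))))).
  apply: near_eq_cvg; apply: nearW => n.
  by rewrite !fctE /lognormal_sinh /= !eE /L; field.
Qed.

Section moments.
Context (d : measure_display) (T : measurableType d) (P : probability T R).
Variables (h : T -> R) (v : R).
Hypotheses (v0 : 0 < v) (mh : measurable_fun setT h).
Hypothesis h_law : forall A, measurable A -> P (h @^-1` A) = normal_prob 0 (Num.sqrt v) A.
Notation leb := (@lebesgue_measure R).

Let sv0 : Num.sqrt v != 0. Proof. by rewrite sqrtr_eq0 -ltNge. Qed.

(* Completing the square turns the tilted density into a normal density. *)
Lemma expectation_expR_normal (k : R) :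
  P.-integrable setT (EFin \o (fun w => expR (k * h w))) /\
  \int[P]_w expR (k * h w) = expR (k ^+ 2 * v / 2).
Proof.
have E x : expR (k * x) * normal_pdf 0 (Num.sqrt v) x =
    expR (k ^+ 2 * v / 2) * normal_pdf (k * v) (Num.sqrt v) x.
  rewrite !normal_pdfE// /normal_fun mulrCA [RHS]mulrCA.
  congr (_ * _); rewrite -!expRD sqr_sqrtr ?ltW//; congr expR.
  by field; rewrite gt_eqF.
have ipdf := @integrable_normal_pdf R (k * v) (Num.sqrt v).
have mpdf := @measurable_normal_pdf R 0 (Num.sqrt v).
have ifp : leb.-integrable setT (fun x => (expR (k * x) * normal_pdf 0 (Num.sqrt v) x)%:E).
  have := integrableZl measurableT (expR (k ^+ 2 * v / 2)) ipdf.
  apply: eq_integrable => // x _; rewrite -EFinM; congr EFin.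
  exact: esym.
have mexp : measurable_fun setT (fun x : R => expR (k * x)).
  by apply: measurableT_comp => //; exact: measurable_funM.
have [i ->] := expectation_density mh mpdf (@normal_pdf_ge0 R 0 (Num.sqrt v)) h_law mexp ifp.
split => //; rewrite /Rintegral; under eq_integral do rewrite E EFinM.
by rewrite integralZl//= integral_normal_pdf mule1.
Qed.

Lemma lognormal_moments (b : R) :
  sinh_moments P (fun w => expR (h w + b)) (lognormal_sinh b v).
Proof.
have e (k : R) : P.-integrable setT (EFin \o (fun w => expR (k * (h w + b)))) /\
    \int[P]_w expR (k * (h w + b)) = lognormal b v k.
  have [i E] := expectation_expR_normal k.
  have -> : (fun w => expR (k * (h w + b))) = (fun w => expR (k * b) * expR (k * h w)).
    by apply/funext => w; rewrite -expRD; congr expR; ring.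
  split; first exact: (integrableZl measurableT (expR (k * b)) i).
  by rewrite RintegralZl// E -expRD.
have sums (s : seq (R * R)) (f : T -> R) :
    (forall w, f w = \sum_(p <- s) p.1 * expR (p.2 * (h w + b))) ->
    P.-integrable setT (EFin \o f) /\
    \int[P]_w f w = \sum_(p <- s) p.1 * lognormal b v p.2.
  move=> /funext ->; elim: s => [|p s [iS eS]].
    have -> : (fun w => \sum_(p <- [::] : seq (R * R)) p.1 * expR (p.2 * (h w + b))) = fun=> 0.
      by apply/funext => w; rewrite big_nil.
    by rewrite big_nil; split; [exact: integrable0|rewrite Rintegral_cst// mul0r].
  have [ip ep] := e p.2.
  have ip' : P.-integrable setT (EFin \o (fun w => p.1 * expR (p.2 * (h w + b)))).
    exact: (integrableZl measurableT p.1 ip).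
  have -> : (fun w => \sum_(q <- p :: s) q.1 * expR (q.2 * (h w + b))) =
      fun w => p.1 * expR (p.2 * (h w + b)) + \sum_(q <- s) q.1 * expR (q.2 * (h w + b)).
    by apply/funext => w; rewrite big_cons.
  rewrite big_cons; split; first exact: (integrableD measurableT ip' iS).
  by rewrite RintegralD// eS RintegralZl// ep.
have expn (k : nat) x : expR (k%:R * x) = expR x ^+ k :> R by exact: expRM_natl.
have expnN (k : nat) x : expR (- k%:R * x) = (expR x)^-1 ^+ k :> R.
  by rewrite mulNr expRN expn exprVn.
split.
- by apply: measurableT_comp => //; exact: measurable_funD.
- by move=> w; exact: expR_gt0.
move=> k; rewrite !inE => /or3P[] /eqP ->; rewrite /lognormal_sinh /=.
- have [|i E] := @sums [:: (2^-1, 1); (- 2^-1, - 1)] (fun w => sinhv (expR (h w + b)) ^+ 1).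
    move=> w; rewrite !big_cons big_nil /= (expn 1%N) (expnN 1%N) /sinhv.
    by field; rewrite gt_eqF// expR_gt0.
  by split=> //; rewrite E !big_cons big_nil /=; field.
- have [|i E] := @sums [:: (4^-1, 2); (- 2^-1, 0); (4^-1, - 2)] (fun w => sinhv (expR (h w + b)) ^+ 2).
    move=> w; rewrite !big_cons big_nil /= (expn 2%N) (expnN 2%N) mul0r expR0 /sinhv.
    by field; rewrite gt_eqF// expR_gt0.
  split=> //; rewrite E !big_cons big_nil /=.
  have -> : lognormal b v 0 = 1 by rewrite /lognormal expr0n !mul0r addr0 expR0.
  by field.
- have [|i E] := @sums [:: (16^-1, 4); (- 4^-1, 2); (6 / 16, 0); (- 4^-1, - 2); (16^-1, - 4)]
     (fun w => sinhv (expR (h w + b)) ^+ 4).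
    move=> w; rewrite !big_cons big_nil /= (expn 4%N) (expnN 4%N) (expn 2%N) (expnN 2%N) mul0r expR0 /sinhv.
    by field; rewrite gt_eqF// expR_gt0.
  split=> //; rewrite E !big_cons big_nil /=.
  have -> : lognormal b v 0 = 1 by rewrite /lognormal expr0n !mul0r addr0 expR0.
  by field.
Qed.

End moments.

End diffusive.

(** * Riemann sums along a path *)

(** Heine-Cantor relative to [K]: continuity is tested against points of [K] only, because the
    cutoff functions below are controlled on the closed square and not around it. *)
Lemma compact_modulus (R : realType) (V : pseudoMetricType R) (K : set V) (f : V -> R) :
  compact K ->
  (forall x, K x -> forall e, 0 < e -> exists2 dl, 0 < dl &
     forall y, K y -> ball x dl y -> `|f x - f y| < e) ->
  forall e, 0 < e -> exists2 dl, 0 < dl &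
    forall x y, K x -> K y -> ball x dl y -> `|f x - f y| <= e.
Proof.
move=> cK cf e e0.
have /near_covering_withinP/(_ _ (0 : R)^'+
    (fun dl x => forall y, K y -> ball x dl y -> `|f x - f y| <= e)) :=
  (compact_near_coveringP K).1 cK.
have h x : K x -> \forall x' \near x & i \near (0 : R)^'+, K x' ->
    forall y, K y -> ball x' i y -> `|f x' - f y| <= e.
  move=> Kx; have e2 : 0 < e / 2 by rewrite divr_gt0.
  have [dl dl0 hd] := cf x Kx _ e2.
  have dl2 : 0 < dl / 2 by rewrite divr_gt0.
  exists (ball x (dl / 2), [set i | 0 < i < dl / 2]) => /=.
    split; first exact: nbhsx_ballx.
    near=> i; apply/andP; split; near: i; first exact: nbhs_right_gt.
    exact: nbhs_right_lt.
  move=> [x' i] /= [bx' /andP[i0 idl]] Kx' y Ky bxy.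
  have h1 : `|f x - f x'| < e / 2.
    apply: hd => //; apply: le_ball bx'; rewrite ler_pdivrMr//; lra.
  have h2 : `|f x - f y| < e / 2.
    apply: hd => //; rewrite (splitr dl); apply: ball_triangle bx' _.
    by apply: le_ball bxy; exact: ltW.
  rewrite (_ : f x' - f y = (f x - f y) - (f x - f x')); last by ring.
  by apply: le_trans (ler_normB _ _) _; lra.
move=> /(_ _ h) [dl /= dl0 hdl].
exists (dl / 2); first by rewrite divr_gt0.
move=> x y Kx Ky; apply: hdl => //=; last by rewrite divr_gt0.
rewrite sub0r normrN gtr0_norm ?divr_gt0// ltr_pdivrMr//; lra.
Unshelve. all: by end_near. Qed.

Section riemann_sums.
Variable R : realType.
Notation leb := (@lebesgue_measure R).

Lemma Rintegral_itv_dist_le (f : R -> R) (a b v e : R) : a <= b ->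
  leb.-integrable `]a, b] (EFin \o f) ->
  (forall x, a < x <= b -> `|f x - v| <= e) ->
  `|\int[leb]_(x in `]a, b]) f x - v * (b - a)| <= e * (b - a).
Proof.
move=> ab fi fv.
have lebE : leb `]a, b] = (b - a)%:E.
  rewrite lebesgue_measure_itv/= lte_fin -EFinB.
  by move: ab; rewrite le_eqVlt => /predU1P[->|->]//; rewrite ltxx subrr.
have leE (k : R) : \int[leb]_(x in `]a, b]) k = k * (b - a).
  rewrite Rintegral_cst//; exact: (congr1 (fun z => k * fine z) lebE).
have cst_i (k : R) : leb.-integrable `]a, b] (EFin \o cst k).
  apply/integrableP; split; first by apply/measurable_EFinP.
  rewrite /= integral_cst//; apply: (@le_lt_trans _ _ (`|k|%:E * (b - a)%:E)%E).
    by rewrite -lebE.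
  by rewrite -EFinM ltry.
rewrite -leE -RintegralB//; last exact: (cst_i v).
have iB : leb.-integrable `]a, b] (EFin \o (fun x => f x - v)).
  exact: (integrableB _ fi (cst_i v)).
apply: le_trans (le_normr_Rintegral _ iB) _ => //.
rewrite -leE; apply: le_Rintegral => //.
- exact: (integrable_norm iB).
- exact: (cst_i e).
Qed.

(** Each cell is sampled at both of its endpoints, one per factor: this is the shape of the sums
    produced by [walk_Z_expR]. *)
Lemma cvg_riemann_product (c : R -> R) (t : R) : 0 < t ->
  {within `[0, t], continuous c} ->
  (fun n : nat => n%:R^-1 * \sum_(0 <= k < Num.truncn (n%:R * t))
     (c (k%:R / n%:R) * c (k.+1%:R / n%:R))) @ \oo -->
  \int[leb]_(s in `[0, t]) (c s * c s).
Proof.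
move=> t0 cc.
pose f s := c s * c s.
have fi : leb.-integrable `[0, t] (EFin \o f).
  apply: continuous_compact_integrable; first exact: segment_compact.
  by move=> x; apply: continuousM; exact: cc.
have [M M1 cM] : exists2 M, 1 <= M & forall x : R, 0 <= x <= t -> `|c x| <= M.
  have [] := @EVT_max R (fun x => `|c x|) 0 t (ltW t0).
    by move=> x; apply: continuous_comp; [exact: cc|exact: norm_continuous].
  move=> x0 _ hx; exists (`|c x0| + 1); first by rewrite lerDr.
  by move=> x x01; apply: le_trans (hx x _) _; rewrite ?lerDl ?in_itv.
have M0 : 0 < M by lra.
have fM (x : R) : 0 <= x <= t -> `|f x| <= M * M.
  by move=> xt; rewrite normrM ler_pM// cM.
have cun (e : R) : 0 < e -> exists2 dl : R, 0 < dl & forall x y : R, 0 <= x <= t -> 0 <= y <= t ->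
    `|x - y| < dl -> `|c x - c y| <= e.
  move=> e0; have [] := @compact_modulus R R (`[0, t]%classic) c _ _ e e0.
  - exact: segment_compact.
  - move=> x xt d0 d00; have /subspace_continuousP/(_ x xt)/cvgrPdist_lt/(_ _ d00) := cc.
    rewrite /prop_near1 /nbhs /= /within /= => -[dl /= dl0 hdl].
    by exists dl => // y yt bxy; apply: hdl.
  - move=> dl dl0 h; exists dl => // x y xt yt xy; apply: h => //=; by rewrite in_itv.
apply/cvgrPdist_le => e e0.
(* With this tolerance, moving both factors, each bounded by [M], changes the integrand by at most
   [e / 2 / t], so the full cells cost at most [e / 2]. The incomplete last cell has length at most
   [1 / n] and costs [M * M / n]. *)
have E0 : 0 < e / 2 / t / (2 * M) by rewrite !divr_gt0// mulr_gt0.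
have [dl dl0 hdl] := cun _ E0.
near=> n.
have n0 : 0 < n%:R :> R by rewrite ltr0n; near: n; exact: nbhs_infty_gt.
have nV0 : 0 < n%:R^-1 :> R by rewrite invr_gt0.
have ndl : n%:R^-1 < dl.
  rewrite -[ltRHS]invrK ltf_pV2 ?posrE ?invr_gt0//.
  by near: n; exact: nbhs_infty_gtr.
have nM : M * M / n%:R <= e / 2.
  rewrite ler_pdivrMr// -ler_pdivrMl ?divr_gt0//.
  by near: n; exact: nbhs_infty_ger.
set m := Num.truncn (n%:R * t).
have nt0 : 0 <= n%:R * t by rewrite mulr_ge0// ltW.
have /andP[mt tm] := truncn_itv nt0; rewrite -/m in mt tm.
have leb_int a b : 0 <= a -> b <= t -> leb.-integrable `]a, b] (EFin \o f).
  move=> a0 bt; apply: integrableS fi => //; apply: subset_itv; rewrite bnd_simp//.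
have pos (k : nat) : 0 <= k%:R / n%:R :> R by rewrite divr_ge0// ltW.
have kt (k : nat) : (k <= m)%N -> k%:R / n%:R <= t.
  move=> km; rewrite ler_pdivrMr// mulrC (le_trans _ mt)// ler_nat//.
have step (k : nat) : k.+1%:R / n%:R - k%:R / n%:R = n%:R^-1 :> R.
  by rewrite -mulrBl -natr1 addrAC subrr add0r mul1r.
have lestep (k : nat) : k%:R / n%:R <= k.+1%:R / n%:R :> R.
  by rewrite ler_pM2r// ler_nat.
have ind (k : nat) : (k <= m)%N ->
  `|\int[leb]_(s in `[0, k%:R / n%:R]) f s - n%:R^-1 * \sum_(0 <= i < k)
     (c (i%:R / n%:R) * c (i.+1%:R / n%:R))| <= k%:R * (e / 2 / t * n%:R^-1).
  elim: k => [|k IH] km.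
    by rewrite big_geq// mul0r set_itv1 Rintegral_set1 mulr0 subrr normr0 mul0r.
  have {}IH := IH (ltnW km).
  have ki : leb.-integrable `[0, k.+1%:R / n%:R] (EFin \o f).
    apply: integrableS fi => //; apply: subset_itvl; rewrite bnd_simp; exact: kt.
  have := @Rintegral_itvB R f (BLeft 0) (BRight (k.+1%:R / n%:R)) (k%:R / n%:R) ki.
  rewrite !bnd_simp => /(_ (pos k) (lestep k)) eI.
  rewrite big_nat_recr//= mulrDr.
  rewrite -[X in `|X - _|](subrK (\int[leb]_(x in `[0, k%:R / n%:R]) f x)) eI.
  rewrite (addrC (\int[leb]_(x in `]_, _]) f x)) opprD addrACA.
  have -> : k.+1%:R * (e / 2 / t * n%:R^-1) =
      k%:R * (e / 2 / t * n%:R^-1) + e / 2 / t * n%:R^-1 by rewrite -natr1 mulrDl mul1r.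
  apply: le_trans (ler_normD _ _) _; apply: lerD => //.
  rewrite (mulrC n%:R^-1 (c _ * _)).
  have := @Rintegral_itv_dist_le f _ _ (c (k%:R / n%:R) * c (k.+1%:R / n%:R))
    (e / 2 / t) (lestep k) (leb_int _ _ (pos k) (kt _ km)).
  rewrite (step k); apply => x /andP[x1 x2].
  have xt : 0 <= x <= t by rewrite (le_trans (pos k) (ltW x1)) (le_trans x2 (kt _ km)).
  have h1 : `|c x - c (k%:R / n%:R)| <= e / 2 / t / (2 * M).
    apply: hdl => //; first by rewrite pos kt// ltnW.
    by rewrite ger0_norm; have := step k; lra.
  have h2 : `|c x - c (k.+1%:R / n%:R)| <= e / 2 / t / (2 * M).
    apply: hdl => //; first by rewrite pos kt.
    by rewrite ler0_norm; have := step k; lra.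
  have -> : f x - c (k%:R / n%:R) * c (k.+1%:R / n%:R) =
     c x * (c x - c (k.+1%:R / n%:R)) + (c x - c (k%:R / n%:R)) * c (k.+1%:R / n%:R).
    by rewrite /f; ring.
  have -> : e / 2 / t = M * (e / 2 / t / (2 * M)) + (e / 2 / t / (2 * M)) * M.
    by field; rewrite !gt_eqF.
  apply: le_trans (ler_normD _ _) _; apply: lerD; rewrite normrM ler_pM//; apply: cM => //.
  by rewrite pos kt.
have := ind m (leqnn m).
have := @Rintegral_itvB R f (BLeft 0) (BRight t) (m%:R / n%:R) fi.
rewrite !bnd_simp => /(_ (pos m) (kt m (leqnn m))) eI hm.
rewrite -[X in `|X - _|](subrK (\int[leb]_(x in `[0, m%:R / n%:R]) f x)) eI -addrA.
rewrite [leRHS](splitr e); apply: le_trans (ler_normD _ _) _; apply: lerD.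
  have := @Rintegral_itv_dist_le f (m%:R / n%:R) t 0 (M * M) (kt m (leqnn m)) (leb_int _ _ (pos m) (lexx t)).
  rewrite mul0r subr0 => h; apply: le_trans (h _) _.
    move=> x /andP[x1 x2]; rewrite subr0 fM// x2 andbT.
    by rewrite (le_trans (pos m))// ltW.
  apply: le_trans nM; rewrite ler_wpM2l ?mulr_ge0 ?(ltW M0)//.
  have : t <= m.+1%:R / n%:R by rewrite ler_pdivlMr// mulrC ltW.
  by have := step m; clear; lra.
apply: le_trans hm _.
have -> : m%:R * (e / 2 / t * n%:R^-1) = e / 2 * (m%:R / n%:R / t).
  by field; rewrite !gt_eqF.
rewrite ler_piMr ?divr_ge0// ?(ltW e0)//.
by rewrite ler_pdivrMr// mul1r kt.
Unshelve. all: by end_near. Qed.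

End riemann_sums.

Section gaussian_walk.
Variable R : realType.
Notation leb := (@lebesgue_measure R).

Lemma walk_X_expR (u : nat -> R) m :
  walk_X (fun i => expR (u i.+1 - u i)) m = expR (u m - u 0%N).
Proof.
elim: m => [|m IH]; first by rewrite walk_X0 subrr expR0.
by rewrite walk_XS IH -expRD; congr expR; ring.
Qed.

(** Both products telescope: the inverse prefix is [expR (u 0 - u k)] and the suffix
    [expR (u m - u k.+1)]. Skipping factor [k] is what brings in two neighbouring points. *)
Lemma walk_Z_expR delta (u : nat -> R) m :
  walk_Z delta (fun i => expR (u i.+1 - u i)) m =
  expR (u 0%N + u m) * (delta * \sum_(0 <= k < m) (expR (- u k) * expR (- u k.+1))).
Proof.
elim: m => [|m IH]; first by rewrite walk_Z0 big_geq// !mulr0.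
rewrite walk_ZS IH walk_X_expR -expRN big_nat_recr//= !mulrDr; congr (_ + _).
  by rewrite mulrAC -expRD; congr (expR _ * _); ring.
by rewrite mulrCA -expRD -expRD; congr (_ * expR _); ring.
Qed.

Lemma cvg_truncn_div (t : R) : 0 < t ->
  (fun n => (Num.truncn (n%:R * t))%:R / n%:R) @ \oo --> t.
Proof.
move=> t0; apply: (@cvg_dist_invn _ _ _ 1); near=> n.
have n0 : 0 < n%:R :> R by rewrite ltr0n; near: n; exact: nbhs_infty_gt.
have nt0 : 0 <= n%:R * t by rewrite mulr_ge0// ltW.
have /andP[mt tm] := truncn_itv nt0.
rewrite ler0_norm; last by rewrite subr_le0 ler_pdivrMr// (mulrC t).
rewrite opprB lerBlDr -mulrDl ler_pdivlMr// (mulrC t) addrC ltW//.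
by rewrite natr1.
Unshelve. all: by end_near. Qed.

Variables (b : R -> R) (t : R).
Hypotheses (t0 : 0 < t) (cb : {within `[0, +oo[, continuous b}).

Let cvg_path_end : (fun n => b ((Num.truncn (n%:R * t))%:R / n%:R)) @ \oo --> b t.
Proof.
have /subspace_continuousP/(_ t) := cb.
rewrite /= in_itv/= (ltW t0) => /(_ isT) ct.
move=> A /ct hA; pose x n : R := (Num.truncn (n%:R * t))%:R / n%:R.
have h : \forall n \near \oo, `[0, +oo[%classic (x n) -> A (b (x n)) := cvg_truncn_div t0 hA.
suff : \forall n \near \oo, A (b (x n)) by [].
near=> n; have hn : `[0, +oo[%classic (x n) -> A (b (x n)) by near: n.
apply: hn; by rewrite /= in_itv/= andbT divr_ge0.
Unshelve. all: by end_near. Qed.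

Lemma cvg_walk_X_path :
  (fun n => walk_X (fun i => expR (b (i.+1%:R / n%:R) - b (i%:R / n%:R)))
     (Num.truncn (n%:R * t))) @ \oo --> expR (b t - b 0).
Proof.
have E n m : walk_X (fun i => expR (b (i.+1%:R / n%:R) - b (i%:R / n%:R))) m =
    expR (b (m%:R / n%:R) - b 0).
  by have := walk_X_expR (fun i => b (i%:R / n%:R)) m; rewrite mul0r.
under eq_fun do rewrite E.
apply: (cvg_comp _ expR); last exact: continuous_expR.
by apply: cvgB; [exact: cvg_path_end|exact: cvg_cst].
Qed.

Lemma cvg_path_riemann :
  (fun n => n%:R^-1 * \sum_(0 <= k < Num.truncn (n%:R * t))
     (expR (- b (k%:R / n%:R)) * expR (- b (k.+1%:R / n%:R)))) @ \oo -->
  \int[leb]_(s in `[0, t]) expR (- (2 * b s)).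
Proof.
have E : \int[leb]_(s in `[0, t]) expR (- (2 * b s)) =
    \int[leb]_(s in `[0, t]) (expR (- b s) * expR (- b s)).
  by apply: eq_Rintegral => s _; rewrite -expRD; congr expR; ring.
rewrite E; apply: cvg_riemann_product => //.
have cb' : {within `[0, t], continuous b}.
  apply: continuous_subspaceW cb; apply: subset_itvl; by rewrite bnd_simp.
move=> x; have cNx : {for x, continuous (fun s : subspace `[0, t] => - b s)}.
  by apply: continuousN; exact: cb'.
by apply: continuous_comp; [exact: cNx|exact: continuous_expR].
Qed.

(** The value [b 0] is kept: Brownian paths start at 0 only almost surely, whereas this convergence
    is used at every sample point to get measurability of the limit. *)
Lemma cvg_walk_Z_path :
  (fun n => walk_Z n%:R^-1 (fun i => expR (b (i.+1%:R / n%:R) - b (i%:R / n%:R)))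
     (Num.truncn (n%:R * t))) @ \oo -->
  expR (b 0 + b t) * \int[leb]_(s in `[0, t]) expR (- (2 * b s)).
Proof.
have E n m : walk_Z n%:R^-1 (fun i => expR (b (i.+1%:R / n%:R) - b (i%:R / n%:R))) m =
    expR (b 0 + b (m%:R / n%:R)) * (n%:R^-1 * \sum_(0 <= k < m)
     (expR (- b (k%:R / n%:R)) * expR (- b (k.+1%:R / n%:R)))).
  by have := walk_Z_expR n%:R^-1 (fun i => b (i%:R / n%:R)) m; rewrite mul0r.
under eq_fun do rewrite E.
apply: cvgM; last exact: cvg_path_riemann.
apply: (cvg_comp _ expR); last exact: continuous_expR.
by apply: cvgD; [exact: cvg_cst|exact: cvg_path_end].
Qed.

End gaussian_walk.

(** * From polynomial to continuous test functions *)

Section weak_convergence.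
Variable R : realType.

Lemma poly2_exp (f : R -> R -> R) k : poly2 f -> poly2 (fun p v => f p v ^+ k).
Proof.
move=> pf; elim: k => [|k IH].
  have -> : (fun p v => f p v ^+ 0) = (fun _ _ => 1) by [].
  exact: poly2_cst.
have -> : (fun p v => f p v ^+ k.+1) = (fun p v => f p v * f p v ^+ k).
  by apply/funext => p; apply/funext => v; rewrite exprS.
exact: poly2_mul.
Qed.

(* [edge] vanishes exactly where test functions of the matrix may be singular, and
   [1 - (1 - edge p v) ^+ k] is a polynomial cutoff increasing to [1] elsewhere. *)
Definition edge (p v : R) : R := p * (1 - p) * v.

Lemma poly2_edge_exp k : poly2 (fun p v : R => (1 - edge p v) ^+ k).
Proof.
apply: poly2_exp.
have -> : (fun p v : R => 1 - edge p v) = (fun p v => 1 + -1 * (p * (1 + -1 * p) * v)).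
  by apply/funext => p; apply/funext => v; rewrite /edge; ring.
apply: poly2_add; first exact: poly2_cst.
apply: poly2_mul; first exact: poly2_cst.
apply: poly2_mul; last exact: poly2_snd.
apply: poly2_mul; first exact: poly2_fst.
apply: poly2_add; first exact: poly2_cst.
by apply: poly2_mul; [exact: poly2_cst|exact: poly2_fst].
Qed.

Lemma edge_itv p v : 0 <= p <= 1 -> 0 <= v <= 1 -> 0 <= edge p v <= 1.
Proof.
move=> /andP[p0 p1] /andP[v0 v1]; rewrite /edge !mulr_ge0//=; last by rewrite subr_ge0.
by rewrite mulr_ile1// ?mulr_ge0 ?subr_ge0// mulr_ile1// ?subr_ge0//; lra.
Qed.

(** Bernoulli's inequality. The upper bound makes the cutoff vanish at least linearly in [edge]. *)
Lemma bernoulli_edge (h : R) k : 0 <= h <= 1 -> 0 <= 1 - (1 - h) ^+ k <= k%:R * h.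
Proof.
move=> /andP[h0 h1]; elim: k => [|k /andP[IH0 IH1]].
  by rewrite expr0 subrr mul0r lexx.
have e0 : 0 <= (1 - h) ^+ k by rewrite exprn_ge0// subr_ge0.
have e1 : (1 - h) ^+ k <= 1 by rewrite -subr_ge0.
have he : h * (1 - h) ^+ k <= h by rewrite ler_piMr.
have he0 : 0 <= h * (1 - h) ^+ k by rewrite mulr_ge0.
rewrite exprS mulrBl mul1r -natr1 mulrDl mul1r; apply/andP; split; lra.
Qed.

(** [G] may be discontinuous where [edge] vanishes, but it is bounded there and the cutoff tends to
    0, so the product is continuous on the whole closed square. *)
Lemma cutoff_modulus (G : R -> R -> R) (M : R) (k : nat) :
  (forall p v, 0 <= G p v <= M) ->
  (forall p v, 0 < p < 1 -> 0 < v -> {for (p, v), continuous (fun y : R * R => G y.1 y.2)}) ->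
  forall e, 0 < e -> exists2 dl, 0 < dl & forall a b a' b' : R,
    0 <= a <= 1 -> 0 <= b <= 1 -> 0 <= a' <= 1 -> 0 <= b' <= 1 ->
    `|a - a'| < dl -> `|b - b'| < dl ->
    `|G a b * (1 - (1 - edge a b) ^+ k) - G a' b' * (1 - (1 - edge a' b') ^+ k)| <= e.
Proof.
move=> GM Gc.
pose K := `[0 : R, 1]%classic `*` `[0 : R, 1]%classic.
pose g (y : R * R) := G y.1 y.2 * (1 - (1 - edge y.1 y.2) ^+ k).
have cK : compact K by apply: compact_setX; exact: segment_compact.
have M0 : 0 <= M by have /andP[] := GM 0 0; exact: le_trans.
have ce (y : R * R) : {for y, continuous (fun y : R * R => edge y.1 y.2)}.
  apply: cvgM; last exact: cvg_snd.
  apply: cvgM; first exact: cvg_fst.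
  by apply: cvgB; [exact: cvg_cst|exact: cvg_fst].
have KP (y : R * R) : K y -> 0 <= y.1 <= 1 /\ 0 <= y.2 <= 1.
  by move=> [] /=; rewrite !in_itv.
have loc (y : R * R) : K y -> forall e, 0 < e -> exists2 dl, 0 < dl &
    forall z, K z -> ball y dl z -> `|g y - g z| < e.
  move=> Ky e e0; have [y1 y2] := KP _ Ky; have /andP[h0 h1] := edge_itv y1 y2.
  suff : exists2 dl : R, 0 < dl & forall z, K z -> ball y dl z -> `|g y - g z| < e by [].
  move: h0; rewrite le_eqVlt => /predU1P[h0|h0].
    have e1 : 0 < e / (M * k%:R + 1) by rewrite divr_gt0// ltr_wpDl// mulr_ge0.
    have /cvgrPdist_lt/(_ _ e1)/nbhs_ballP[dl /= dl0 hdl] := ce y.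
    exists dl => // z Kz bz; have := hdl z bz; rewrite /= -h0 sub0r normrN => hz.
    have [z1 z2] := KP _ Kz; have hz01 := edge_itv z1 z2.
    have /andP[b0 b1] := bernoulli_edge k hz01; have /andP[g0 g1] := GM z.1 z.2.
    rewrite /g -h0 subr0 expr1n subrr mulr0 sub0r normrN.
    rewrite ger0_norm; last exact: mulr_ge0.
    apply: (@le_lt_trans _ _ (M * (k%:R * edge z.1 z.2))); first by rewrite ler_pM.
    move: hz; case/andP: hz01 => hz0 _; rewrite ger0_norm// ltr_pdivlMr ?ltr_wpDl ?mulr_ge0//.
    by move=> hz; apply: le_lt_trans hz; rewrite mulrDr mulr1 mulrA (mulrC (edge _ _)) lerDl.
  have gc : {for y, continuous g}.
    apply: cvgM.
      move: y1 y2 h0 {Ky h1}; case: y => p v /= /andP[p0 p1] /andP[v0 v1] h0.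
      apply: Gc.
        rewrite !lt_neqAle p0 p1 !andbT eq_sym; apply/andP; split; apply/negP => /eqP pE;
        by move: h0; rewrite /edge pE ?subrr ?(mul0r, mulr0) ?mul0r ltxx.
      rewrite lt_neqAle v0 andbT eq_sym; apply/negP => /eqP vE.
      by move: h0; rewrite /edge vE mulr0 ltxx.
    apply: cvgB; first exact: cvg_cst.
    apply: (cvg_comp (fun z : R * R => 1 - edge z.1 z.2) (fun x => x ^+ k)).
      by apply: cvgB; [exact: cvg_cst|exact: ce].
    exact: exprn_continuous.
  have /cvgrPdist_lt/(_ _ e0)/nbhs_ballP[dl /= dl0 hdl] := gc.
  by exists dl => // z _ bz; exact: hdl.
move=> e e0; have [dl dl0 h] := compact_modulus cK loc e0.
exists dl => // a b a' b' ha hb ha' hb' aa bb.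
by apply: (h (a, b) (a', b')); split; rewrite //= in_itv.
Qed.

Lemma Rintegral_dist_le (d : measure_display) (T : measurableType d)
    (P : probability T R) (f g h : T -> R) (M : R) :
  measurable_fun setT f -> measurable_fun setT g -> measurable_fun setT h ->
  (forall w, `|f w| <= M) -> (forall w, `|g w| <= M) -> (forall w, `|h w| <= M) ->
  (forall w, `|f w - g w| <= h w) ->
  `|\int[P]_w f w - \int[P]_w g w| <= \int[P]_w h w.
Proof.
move=> mf mg mh fM gM hM fgh.
have i1 := bounded_integrable P mf fM; have i2 := bounded_integrable P mg gM.
have i3 := bounded_integrable P mh hM.
rewrite -RintegralB//.
have i12 : P.-integrable setT (EFin \o (fun w => f w - g w)).
  exact: (integrableB measurableT i1 i2).
apply: le_trans (le_normr_Rintegral measurableT i12) _.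
by apply: le_Rintegral => //; exact: (integrable_norm i12).
Qed.

Lemma Rintegral_dominated (d : measure_display) (T : measurableType d)
    (P : probability T R) (f_ : nat -> T -> R) (f : T -> R) (M : R) :
  (forall n, measurable_fun setT (f_ n)) -> measurable_fun setT f ->
  (forall n w, `|f_ n w| <= M) ->
  {ae P, forall w, f_ ^~ w @ \oo --> f w} ->
  (fun n => \int[P]_w f_ n w) @ \oo --> \int[P]_w f w.
Proof.
move=> mf_ mf fM ff.
have [] := @dominated_convergence _ _ _ P setT measurableT (fun n => EFin \o f_ n)
  (EFin \o f) (EFin \o cst M).
- by move=> n; exact/measurable_EFinP.
- exact/measurable_EFinP.
- apply: filterS ff => w h _; apply: cvg_EFin; [exact: nearW|exact: h].
- exact: finite_measure_integrable_cst.
- by apply: aeW => w n _ /=; rewrite lee_fin.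
move=> i _ h; apply: fine_cvg; rewrite /Rintegral fineK; last exact: integrable_fin_num.
exact: h.
Qed.

(** Split [G] into [G * (1 - r k)], uniformly approximated by its Bernstein polynomial, and
    [G * r k], bounded by [M * r k]. As [r k] is itself a nonnegative polynomial, its small
    expectation under [Q] carries over to [P n]. Nonnegativity of [G] makes the Bernstein polynomial
    admissible. *)
Lemma cvg_expectation_of_poly2 (d : nat -> measure_display)
    (T : forall n, measurableType (d n)) (d' : measure_display) (T' : measurableType d')
    (P : forall n, probability (T n) R) (Q : probability T' R)
    (p v : forall n, T n -> R) (p' v' : T' -> R) (G : R -> R -> R) (M : R) :
  (forall n, measurable_fun setT (p n)) -> (forall n, measurable_fun setT (v n)) ->
  measurable_fun setT p' -> measurable_fun setT v' ->
  (forall n w, 0 < p n w < 1) -> (forall n w, 0 < v n w <= 1) ->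
  (forall w, 0 < p' w < 1) -> (forall w, 0 < v' w <= 1) ->
  (forall phi, poly2 phi -> (forall a b, 0 < a <= 1 -> 0 < b <= 1 -> 0 <= phi a b) ->
    (fun n => \int[P n]_w phi (p n w) (v n w)) @ \oo --> \int[Q]_w phi (p' w) (v' w)) ->
  (forall n, measurable_fun setT (fun w => G (p n w) (v n w))) ->
  measurable_fun setT (fun w => G (p' w) (v' w)) ->
  (forall a b, 0 <= G a b <= M) ->
  (forall a b, 0 < a < 1 -> 0 < b ->
    {for (a, b), continuous (fun y : R * R => G y.1 y.2)}) ->
  (fun n => \int[P n]_w G (p n w) (v n w)) @ \oo --> \int[Q]_w G (p' w) (v' w).
Proof.
move=> mp mv mp' mv' p01 v01 p'01 v'01 cvg_poly2 mG mG' GM cG.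
have M0 : 0 <= M by have /andP[] := GM 0 0; exact: le_trans.
pose r k a b : R := (1 - edge a b) ^+ k.
have itvp n w : 0 <= p n w <= 1 by have /andP[h1 h2] := p01 n w; rewrite !ltW.
have itvv n w : 0 <= v n w <= 1 by have /andP[h1 ->] := v01 n w; rewrite ltW.
have itvp' w : 0 <= p' w <= 1 by have /andP[h1 h2] := p'01 w; rewrite !ltW.
have itvv' w : 0 <= v' w <= 1 by have /andP[h1 ->] := v'01 w; rewrite ltW.
have r01 k a b : 0 <= a <= 1 -> 0 <= b <= 1 -> 0 <= r k a b <= 1.
  move=> ha hb; have /andP[h0 h1] := edge_itv ha hb.
  by rewrite exprn_ge0 ?subr_ge0//= exprn_ile1// ?subr_ge0// lerBlDr lerDl.
have mr k (d0 : measure_display) (T0 : measurableType d0) (a b : T0 -> R) :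
    measurable_fun setT a -> measurable_fun setT b ->
    measurable_fun setT (fun w => r k (a w) (b w)).
  by move=> ma mb; apply: measurable_poly2 => //; exact: poly2_edge_exp.
have Rk : (fun k => \int[Q]_w r k (p' w) (v' w)) @ \oo --> (0 : R).
  have -> : (0 : R) = \int[Q]_w 0 by rewrite Rintegral_cst// mul0r.
  apply: (@Rintegral_dominated _ _ _ _ _ 1).
  - by move=> k; exact: mr.
  - exact: measurable_cst.
  - by move=> k w; have /andP[h0 h1] := r01 k _ _ (itvp' w) (itvv' w); rewrite ger0_norm.
  apply: aeW => w; apply: cvg_expr.
  have /andP[h0 h1] := edge_itv (itvp' w) (itvv' w).
  rewrite ger0_norm ?subr_ge0// ltrBlDr ltrDl /edge.
  have /andP[a0 a1] := p'01 w; have /andP[b0 _] := v'01 w.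
  by rewrite !mulr_gt0// subr_gt0.
apply/cvgrPdist_le => e e0.
(* The cutoff expectation is at most [e1] under [Q] and [2 * e1] under [P n], and
   [(2 * M + 1) * e1 = e / 4]; with [e / 8] for each Bernstein approximation and [e / 4] for the
   polynomial expectations, the total stays below [e]. *)
pose e1 := e / 4 / (2 * M + 1); have e10 : 0 < e1 by rewrite !divr_gt0// ltr_wpDl// mulr_ge0.
have e20 : 0 < e / 16 by rewrite divr_gt0.
have [k Rk1] : exists k, \int[Q]_w r k (p' w) (v' w) <= e1.
  move/cvgrPdist_le: Rk => /(_ _ e10)[k _ /(_ k (leqnn k))] /=.
  by rewrite sub0r normrN => h; exists k; apply: le_trans h; exact: ler_norm.
pose g a b := G a b * (1 - r k a b).
have [dl dl0 hdl] := cutoff_modulus k GM cG e20.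
pose N := (Num.truncn (4 * M / dl ^+ 2 / (e / 16))).+1.
pose W := bernstein2 N g.
have Wg a b : 0 <= a <= 1 -> 0 <= b <= 1 -> `|W a b - g a b| <= e / 8.
  move=> ha hb; apply: le_trans (bernstein2_approx (ltn0Sn _) ha hb dl0 hdl _) _.
    move=> x y hx hy; have /andP[g0 g1] := GM x y; have /andP[r0 r1] := r01 k _ _ hx hy.
    rewrite ger0_norm; last by rewrite mulr_ge0// subr_ge0.
    by apply: le_trans g1; rewrite ler_piMr// lerBlDr lerDl.
  have hN : 4 * M / dl ^+ 2 / (e / 16) <= N%:R by rewrite ltW// truncnS_gt.
  have : 4 * M / dl ^+ 2 / N%:R <= e / 16.
    by rewrite ler_pdivrMr ?ltr0n// -ler_pdivrMl// mulrC.
  by move=> h; apply: le_trans (lerD (lexx (e / 16)) h) _; clear -e0; lra.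
have W0 a b : 0 < a <= 1 -> 0 < b <= 1 -> 0 <= W a b.
  move=> /andP[a0 a1] /andP[b0 b1]; apply: bernstein2_ge0; rewrite ?(ltW a0) ?(ltW b0)//.
  move=> x y hx hy; have /andP[g0 g1] := GM x y; have /andP[r0 r1] := r01 k _ _ hx hy.
  by rewrite mulr_ge0// subr_ge0.
have close (d0 : measure_display) (T0 : measurableType d0) (P0 : probability T0 R) (a b : T0 -> R) :
    measurable_fun setT a -> measurable_fun setT b ->
    measurable_fun setT (fun w => G (a w) (b w)) ->
    (forall w, 0 <= a w <= 1) -> (forall w, 0 <= b w <= 1) ->
    `|\int[P0]_w G (a w) (b w) - \int[P0]_w W (a w) (b w)| <=
    M * \int[P0]_w r k (a w) (b w) + e / 8.
  move=> ma mb mGab a01 b01.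
  have mW : measurable_fun setT (fun w => W (a w) (b w)).
    by apply: measurable_poly2 => //; exact: poly2_bernstein2.
  have -> : M * \int[P0]_w r k (a w) (b w) + e / 8 =
      \int[P0]_w (M * r k (a w) (b w) + e / 8).
    have ir : P0.-integrable setT (EFin \o (fun w => r k (a w) (b w))).
      apply: (@bounded_integrable _ _ _ P0 _ 1); first exact: mr.
      by move=> w; have /andP[h0 h1] := r01 k _ _ (a01 w) (b01 w); rewrite ger0_norm.
    rewrite RintegralD//; last exact: finite_measure_integrable_cst.
      by rewrite RintegralZl// Rintegral_cst// [X in fine X]probability_setT mulr1.
    exact: (integrableZl measurableT M ir).
  have gle w : `|g (a w) (b w)| <= M.
    have /andP[g0 g1] := GM (a w) (b w); have /andP[r0 r1] := r01 k _ _ (a01 w) (b01 w).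
    rewrite ger0_norm; last by rewrite mulr_ge0// subr_ge0.
    by apply: le_trans g1; rewrite ler_piMr// lerBlDr lerDl.
  apply: (@Rintegral_dist_le _ _ _ _ _ _ (M + e / 8)) => //.
  - by apply: measurable_funD => //; apply: measurable_funM => //; exact: mr.
  - move=> w; have /andP[g0 g1] := GM (a w) (b w).
    by rewrite ger0_norm// (le_trans g1)// lerDl !divr_ge0// ltW.
  - move=> w; rewrite -(subrK (g (a w) (b w)) (W _ _)) addrC.
    by apply: le_trans (ler_normD _ _) _; rewrite lerD// Wg.
  - move=> w; have /andP[r0 r1] := r01 k _ _ (a01 w) (b01 w).
    rewrite ger0_norm; first by rewrite lerD2r ler_piMr.
    by apply: addr_ge0; [exact: mulr_ge0|rewrite divr_ge0// ltW].
  - move=> w; have /andP[r0 r1] := r01 k _ _ (a01 w) (b01 w).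
    have /andP[g0 g1] := GM (a w) (b w).
    have -> : G (a w) (b w) - W (a w) (b w) =
      G (a w) (b w) * r k (a w) (b w) - (W (a w) (b w) - g (a w) (b w)).
      by rewrite /g; ring.
    apply: le_trans (ler_normB _ _) _; apply: lerD; last exact: Wg.
    by rewrite ger0_norm ?mulr_ge0// ler_wpM2r.
have cW : (fun n => \int[P n]_w W (p n w) (v n w)) @ \oo --> \int[Q]_w W (p' w) (v' w).
  by apply: cvg_poly2 => //; exact: poly2_bernstein2.
have cR : (fun n => \int[P n]_w r k (p n w) (v n w)) @ \oo --> \int[Q]_w r k (p' w) (v' w).
  apply: cvg_poly2; first exact: poly2_edge_exp.
  move=> a b /andP[a0 a1] /andP[b0 b1].
  have ha : 0 <= a <= 1 by rewrite ltW.
  have hb : 0 <= b <= 1 by rewrite ltW.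
  by have /andP[] := r01 k a b ha hb.
have e40 : 0 < e / 4 by rewrite divr_gt0.
move/cvgrPdist_le : cW => /(_ _ e40) cW; move/cvgrPdist_le : cR => /(_ _ e10) cR.
near=> n.
have hW : `|\int[Q]_w W (p' w) (v' w) - \int[P n]_w W (p n w) (v n w)| <= e / 4 by near: n.
have hR : `|\int[Q]_w r k (p' w) (v' w) - \int[P n]_w r k (p n w) (v n w)| <= e1 by near: n.
have h1 := close _ _ (P n) _ _ (mp n) (mv n) (mG n) (itvp n) (itvv n).
have h2 := close _ _ Q _ _ mp' mv' mG' itvp' itvv'.
have Rn : \int[P n]_w r k (p n w) (v n w) <= 2 * e1.
  move: hR; rewrite distrC => /(le_trans (ler_norm _)); lra.
have Me1 : (2 * M + 1) * e1 = e / 4.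
  by rewrite /e1 mulrC divfK// gt_eqF// ltr_wpDl// mulr_ge0.
have MR : M * \int[P n]_w r k (p n w) (v n w) <= M * (2 * e1) by rewrite ler_wpM2l.
have MR' : M * \int[Q]_w r k (p' w) (v' w) <= M * e1 by rewrite ler_wpM2l.
have Me : M * e1 <= e / 8 by lra.
move: h1 h2 hW; set A := \int[P n]_w G _ _; set B := \int[P n]_w W _ _.
set A' := \int[Q]_w G _ _; set B' := \int[Q]_w W _ _ => h1 h2 hW.
have -> : A' - A = (A' - B') + ((B' - B) - (A - B)) by ring.
apply: le_trans (ler_normD _ _) _.
have := ler_normB (B' - B) (A - B); lra.
Unshelve. all: by end_near. Qed.

End weak_convergence.

(** * Random matrices *)

Section matrix_valued.
Variable R : realType.

Lemma cvg_lower_mx (U : Type) (F : set_system U) (FF : Filter F) (x z y : U -> R) (x0 z0 y0 : R) :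
  x @ F --> x0 -> z @ F --> z0 -> y @ F --> y0 ->
  (fun u => lower_mx (x u) (z u) (y u)) @ F --> lower_mx x0 z0 y0.
Proof.
move=> cx cz cy A [B nB BA].
have B1 : nbhs x0 (B ord0 ord0) by have := nB ord0 ord0; rewrite mxE.
have B2 : nbhs z0 (B ord_max ord0) by have := nB ord_max ord0; rewrite mxE.
have B3 : nbhs y0 (B ord_max ord_max) by have := nB ord_max ord_max; rewrite mxE.
have B4 : B ord0 ord_max 0.
  by apply: nbhs_singleton; have := nB ord0 ord_max; rewrite mxE.
have hx := cx _ B1; have hz := cz _ B2; have hy := cy _ B3.
have h : F (x @^-1` B ord0 ord0 `&` (z @^-1` B ord_max ord0 `&` y @^-1` B ord_max ord_max)).
  by apply: filterI => //; exact: filterI.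
move: h; rewrite /nbhs /=; apply: filterS => u [h1 [h2 h3]].
apply: BA => i j; rewrite mxE.
have two (k : 'I_2) : k = ord0 \/ k = ord_max.
  by case: k => [[|[|k]] hk]; [left|right|]; try exact: val_inj.
by case: (two i) => ->; case: (two j) => ->.
Qed.

(** An open set is the union of the boxes with rational centre and radius [1 / (k + 1)] that it
    contains. There are countably many, enumerated by [unpickle], and each is a finite intersection
    of entrywise conditions. *)
Lemma random_element_mx (d : measure_display) (T : measurableType d) m n
    (X : T -> 'M[R]_(m, n)) :
  (forall i j, measurable_fun setT (fun w => X w i j)) -> random_element X.
Proof.
move=> mX U oU.
pose box (q : 'M[rat]_(m, n) * nat) : set 'M[R]_(m, n) :=
  [set N | forall i j, `|N i j - ratr (q.1 i j)| < q.2.+1%:R^-1].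
have mbox q : measurable (X @^-1` box q).
  have -> : X @^-1` box q = \bigcap_(ij in [set: 'I_m * 'I_n])
      [set w | `|X w ij.1 ij.2 - ratr (q.1 ij.1 ij.2)| < q.2.+1%:R^-1].
    apply/seteqP; split => w /= h; first by move=> ij _; exact: h.
    by move=> i j; exact: (h (i, j) I).
  apply: fin_bigcap_measurable => // -[i j] _ /=.
  have mf : measurable_fun setT (fun w => `|X w i j - ratr (q.1 i j)|).
    by apply: measurableT_comp => //; apply: measurable_funD => //.
  rewrite -[X in measurable X]setTI.
  have := mf measurableT `]-oo, q.2.+1%:R^-1[%classic (measurable_itv _).
  by congr measurable; apply/seteqP; split => w /=; rewrite in_itv.
have -> : X @^-1` U = \bigcup_(k : nat)
    (if unpickle k is Some q then
       (if `[< box q `<=` U >] then X @^-1` box q else set0) else set0).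
  apply/seteqP; split => w /=; last first.
    move=> [k _]; case: unpickle => // q; case: ifPn => // /asboolP qU wq.
    exact: qU.
  move=> Uw; have /nbhs_ballP[e /= e0 eU] : nbhs (X w) U by exact: open_nbhs_nbhs.
  have [k ke] : exists k : nat, 2 * k.+1%:R^-1 < e.
    exists (Num.truncn (2 / e)); rewrite ltr_pdivrMr ?ltr0n// mulrC -ltr_pdivrMr//.
    exact: truncnS_gt.
  have k0 : 0 < k.+1%:R^-1 :> R by rewrite invr_gt0.
  have hq i j : exists r : rat, `|X w i j - ratr r| < k.+1%:R^-1.
    have lt : X w i j - k.+1%:R^-1 < X w i j + k.+1%:R^-1.
      by rewrite ltrD2l (lt_trans _ k0)// oppr_lt0.
    have [r] := rat_in_itvoo lt.
    by rewrite in_itv/= => hr; exists r; rewrite ltr_distlC.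
  pose q : 'M[rat]_(m, n) := \matrix_(i, j) xchoose (hq i j).
  exists (pickle (q, k)) => //; rewrite pickleK.
  have wq : box (q, k) (X w) by move=> i j /=; rewrite mxE; have := xchooseP (hq i j).
  rewrite ifT//; apply/asboolP => N Nq; apply: eU; split => // i j.
  have := wq i j; have := Nq i j; rewrite /= => h1 h2.
  rewrite /ball /= (_ : X w i j - N i j =
    (X w i j - ratr (q i j)) - (N i j - ratr (q i j))); last by ring.
  apply: le_lt_trans (ler_normB _ _) _; apply: lt_trans ke.
  by rewrite (mulrDl 1 1) mul1r ltrD.
apply: bigcupT_measurable => k; case: unpickle => [q|]; last exact: measurable0.
by case: ifP => _; [exact: mbox|exact: measurable0].
Qed.

Lemma measurable_continuous_mx (d : measure_display) (T : measurableType d) m n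
    (X : T -> 'M[R]_(m, n)) (f : 'M[R]_(m, n) -> R) :
  random_element X -> continuous f -> measurable_fun setT (fun w => f (X w)).
Proof.
move=> mX cf; apply: (measurability _ (RGenOpens.measurableE R)) => //.
move=> _ [_ [a [b ->] <-]]; rewrite setTI.
apply: (mX (f @^-1` `]a, b[%classic)).
by move/continuousP : cf; apply; exact: interval_open.
Qed.

End matrix_valued.

(** * Convergence to the Brownian functional *)

Section poly2_functional.
Variable R : realType.

Lemma poly2_cvg (f : R -> R -> R) (x y : nat -> R) a b : poly2 f ->
  x @ \oo --> a -> y @ \oo --> b -> (fun n => f (x n) (y n)) @ \oo --> f a b.
Proof.
move=> pf cx cy; elim: pf => //.
- by move=> c; exact: cvg_cst.
- by move=> g h _ cg _ ch; exact: cvgD.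
- by move=> g h _ cg _ ch; exact: cvgM.
Qed.

Lemma poly2_bounded (f : R -> R -> R) : poly2 f ->
  exists C, forall a b, 0 < a <= 1 -> 0 < b <= 1 -> `|f a b| <= C.
Proof.
move=> /(poly2_jet (30 : R))[C HC]; exists C => a b /andP[a0 a1] /andP[b0 b1].
have jc (x : R) : 0 < x -> x <= 1 -> jet 30 (fun=> x).
  move=> x0 x1; apply: jet_le (jet_cst _).
  by rewrite gtr0_norm// (le_trans x1)// ler1n.
by have [/(_ 1 ltr01)] := HC _ _ (jc _ a0 a1) (jc _ b0 b1).
Qed.

Lemma walk_obs_bounded (phi : R -> R -> R) (C delta : R) (g : nat -> R) m :
  (forall a b, 0 < a <= 1 -> 0 < b <= 1 -> `|phi a b| <= C) ->
  0 <= delta -> (forall i, 0 < g i) -> `|walk_obs phi delta g m| <= C.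
Proof.
move=> hC d0 g0; apply: hC; apply: inv1D_itv; first by rewrite ltW// walk_X_gt0.
exact: walk_Z_ge0.
Qed.

End poly2_functional.

Lemma cvg_lindeberg_walk (R : realType) (d : nat -> measure_display)
    (T : forall n, measurableType (d n)) (d' : measure_display) (T' : measurableType d')
    (P : forall n, probability (T n) R) (Q : probability T' R)
    (gam : forall n, nat -> T n -> R) (zet : nat -> nat -> T' -> R)
    (s u : nat -> nat -> R) (lambda t : R) (phi : R -> R -> R) :
  0 < t ->
  (forall n, (0 < n)%N -> mutually_independent (P n) (gam n)) ->
  (forall n, (0 < n)%N -> mutually_independent Q (zet n)) ->
  (\forall n \near \oo, forall i, sinh_moments (P n) (gam n i) (s n)) ->
  (\forall n \near \oo, forall i, sinh_moments Q (zet n i) (u n)) ->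
  diffusive_moments lambda s -> diffusive_moments lambda u ->
  poly2 phi -> (forall a b, 0 < a <= 1 -> 0 < b <= 1 -> 0 <= phi a b) ->
  (fun n => \int[P n]_w walk_obs phi n%:R^-1 (fun i => gam n i w) (Num.truncn (n%:R * t)) -
    \int[Q]_v walk_obs phi n%:R^-1 (fun i => zet n i v) (Num.truncn (n%:R * t))) @ \oo -->
  (0 : R).
Proof.
move=> t0 ig iz mg mz ds du pphi phi0.
have [C HC] := poly2_jet (30 : R) pphi.
have C0 : 0 <= C.
  have j1 := jet_homog (lexx (0 : R)) (lexx (0 : R)) (lexx (0 : R)).
  exact: jet_ge0 (HC _ _ j1 j1).
apply/cvgrPdist_le => e e0.
have Ct1 : 0 < C * t + 1 by rewrite ltr_wpDl// mulr_ge0// ltW.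
(* For large [n] the gap times [n] is at most [2 * r + r], and there are at most [n * t]
   replacements, so the total error is at most [C * t * (3 * r) <= e]. *)
pose r := e / 3 / (C * t + 1); have r0 : 0 < r by rewrite !divr_gt0.
have /cvgrPdist_le/(_ _ r0) hgap := cvg_taylor_gap r0 ds du.
near=> n.
have n0 : (0 < n)%N by near: n; exact: nbhs_infty_gt.
have n0' : 0 < n%:R :> R by rewrite ltr0n.
have sg : forall i, sinh_moments (P n) (gam n i) (s n) by near: n.
have sz : forall i, sinh_moments Q (zet n i) (u n) by near: n.
have hg : `|r * 2 - n%:R * taylor_gap r (s n) (u n)| <= r by near: n.
have d0 : 0 <= n%:R^-1 :> R by rewrite invr_ge0 ltW.
have L := lindeberg_walk (ig n n0) (iz n n0) sg sz d0 r0 pphi phi0 HC.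
rewrite sub0r normrN; apply: le_trans (L _) _.
have gap0 : 0 <= C * taylor_gap r (s n) (u n).
  by have := L 1%N; rewrite mul1r; apply: le_trans.
have nt0 : 0 <= n%:R * t by rewrite mulr_ge0// ltW.
apply: (@le_trans _ _ (n%:R * t * (C * taylor_gap r (s n) (u n)))).
  by rewrite ler_wpM2r//; have /andP[] := truncn_itv nt0.
have -> : n%:R * t * (C * taylor_gap r (s n) (u n)) =
  (C * t) * (n%:R * taylor_gap r (s n) (u n)) by ring.
apply: (@le_trans _ _ (C * t * (3 * r))).
  rewrite ler_wpM2l ?mulr_ge0 ?(ltW t0)//.
  by move: hg; rewrite distrC => /(le_trans (ler_norm _)); lra.
have -> : C * t * (3 * r) = e * (C * t / (C * t + 1)) by rewrite /r; field; rewrite gt_eqF.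
by rewrite ler_piMr ?(ltW e0)// ler_pdivrMr// mul1r lerDl.
Unshelve. all: by end_near. Qed.

Section gig_increments.
Context (R : realType) (d : measure_display) (T : measurableType d).
Variables (P : probability T R) (lambda : R) (n : nat) (gamma : nat -> {RV P >-> R}).
Hypothesis gamma_law : forall i, has_gig_law lambda (Num.sqrt n%:R) (gamma i).

Let sqrtE : Num.sqrt n%:R ^+ 2 / 2 = n%:R / 2 :> R.
Proof. by rewrite sqr_sqrtr. Qed.

(** A zero mass would make the density identically 0, its normalising inverse being 0, and the
    expectation of the constant 1 would be 0 instead of 1. *)
Lemma gig_mass_gt0 : 2 * `|lambda| + 16 <= n%:R -> 0 < gig_mass (n%:R / 2) lambda.
Proof.
move=> hn; rewrite lt_neqAle gig_mass_ge0 andbT eq_sym; apply/negP => /eqP M0.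
have large : `|lambda| + 8 <= n%:R / 2 by lra.
have ik := integrable_gig_kernel_large large; rewrite -sqrtE in ik.
have [_] := gig_expectation (gamma_law 0) (@measurable_cst _ _ _ _ setT (1 : R)) ik.
rewrite sqrtE M0 invr0 mul0r Rintegral_cst// [X in fine X]probability_setT mul1r.
by move/eqP; rewrite oner_eq0.
Qed.

Lemma gig_sinh_moments i : 2 * `|lambda| + 16 <= n%:R ->
  sinh_moments P (fun w => pos_part1 (gamma i w)) (gig_sinh (n%:R / 2) lambda).
Proof.
move=> hn; have large : `|lambda| + 8 <= n%:R / 2 by lra.
split.
- by apply: measurableT_comp => //; exact: measurable_pos_part1.
- by move=> w; exact: pos_part1_gt0.
move=> k hk; have ik := gig_sinh_integrable large hk; rewrite -sqrtE in ik.
have mk : measurable_fun setT (fun x : R => sinhv x ^+ k).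
  apply: measurable_funX; apply: measurable_funM => //; apply: measurable_funB => //.
  exact: measurable_funVr.
have [i1 ->] := gig_expectation (gamma_law i) mk ik.
by rewrite /gig_sinh sqrtE.
Qed.

Lemma gig_pos_ae : {ae P, forall w, forall i, pos_part1 (gamma i w) = gamma i w}.
Proof.
apply: ae_foralln => i; exists (gamma i @^-1` `]-oo, 0]%classic); split.
- exact: measurable_funPTI.
- apply: etrans (gamma_law i (measurable_itv `]-oo, 0])) _.
  rewrite (eq_integral (cst 0%E)) ?integral0// => x; rewrite inE/= in_itv/= => x0.
  by rewrite gig_pdfE ltNge x0.
- move=> w /= h; rewrite in_itv/= leNgt; apply/negP => w0; apply: h.
  by rewrite /pos_part1 w0.
Qed.

End gig_increments.

Lemma mutually_independent_comp (R : realType) (d : measure_display) (T : measurableType d)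
    (P : probability T R) (X : nat -> T -> R) (f : R -> R) :
  measurable_fun setT f -> mutually_independent P X ->
  mutually_independent P (fun i w => f (X i w)).
Proof.
move=> mf iX J A uJ mA; apply: (iX J (fun i => f @^-1` A i) uJ) => i.
by rewrite -[X in measurable X]setTI; exact: mf.
Qed.

Section matrix_walk.
Variable R : realType.

Lemma random_element_lower_mx (d : measure_display) (T : measurableType d) (x z y : T -> R) :
  measurable_fun setT x -> measurable_fun setT z -> measurable_fun setT y ->
  random_element (fun w => lower_mx (x w) (z w) (y w)).
Proof.
move=> mx mz my; apply: random_element_mx => i j.
have -> : (fun w => lower_mx (x w) (z w) (y w) i j) =
    (fun w => if i == 0 then (if j == 0 then x w else 0) else (if j == 0 then z w else y w)).
  by apply/funext => w; rewrite mxE.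
by case: (i == 0); case: (j == 0) => //; exact: measurable_cst.
Qed.

Lemma continuous_mx_chart (f : 'M[R]_2 -> R) (a b : R) : continuous f -> 0 < a < 1 -> 0 < b ->
  {for (a, b), continuous (fun y : R * R =>
    f (lower_mx (y.1^-1 - 1) (y.2^-1 - 1) (y.1^-1 - 1)^-1))}.
Proof.
move=> cf /andP[a0 a1] b0.
have c1 : (fun y : R * R => y.1^-1 - 1) @ (a, b) --> a^-1 - 1.
  by apply: cvgB; [apply: cvgV; [rewrite gt_eqF|exact: cvg_fst]|exact: cvg_cst].
have c2 : (fun y : R * R => y.2^-1 - 1) @ (a, b) --> b^-1 - 1.
  by apply: cvgB; [apply: cvgV; [rewrite gt_eqF|exact: cvg_snd]|exact: cvg_cst].
have a2 : a^-1 - 1 != 0 by rewrite gt_eqF// subr_gt0 invf_gt1.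
have c3 : (fun y : R * R => (y.1^-1 - 1)^-1) @ (a, b) --> (a^-1 - 1)^-1 by exact: cvgV.
exact: (cvg_comp _ _ (cvg_lower_mx _ c1 c2 c3) (cf _)).
Qed.

Lemma inv1DK (x : R) : ((1 + x)^-1)^-1 - 1 = x.
Proof. by rewrite invrK addrC addKr. Qed.

Lemma inv1D_lt1 (x : R) : 0 < x -> 0 < (1 + x)^-1 < 1.
Proof.
move=> x0; have x1 : 0 < 1 + x by rewrite addr_gt0.
by apply/andP; split; [rewrite invr_gt0|rewrite invf_lt1// ltrDl].
Qed.

End matrix_walk.

Section brownian.
Context (R : realType) (d : measure_display) (T : measurableType d) (Q : probability T R).
Variables (B : R -> {RV Q >-> R}) (lambda t : R).
Hypotheses (B_brownian : standard_brownian_motion B) (t0 : 0 < t).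
Notation leb := (@lebesgue_measure R).

Definition brownian_factor (n i : nat) (w : T) : R :=
  expR (B (i.+1%:R / n%:R) w - B (i%:R / n%:R) w + lambda / n%:R).

Let b w := drifted lambda (fun s => B s w).

Lemma brownian_factorE n i w : brownian_factor n i w =
  expR (b w (i.+1%:R / n%:R) - b w (i%:R / n%:R)).
Proof. by rewrite /brownian_factor /b /drifted -natr1; congr expR; ring. Qed.

Lemma brownian_factor_moments n i : (0 < n)%N ->
  sinh_moments Q (brownian_factor n i) (lognormal_sinh (lambda / n%:R) n%:R^-1).
Proof.
move=> n0; have n0' : 0 < n%:R :> R by rewrite ltr0n.
apply: lognormal_moments; first by rewrite invr_gt0.
  by apply: measurable_funB; exact: measurable_funPT.
have u0 : 0 <= i%:R / n%:R :> R by rewrite divr_ge0// ltW.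
have uu : i%:R / n%:R < i.+1%:R / n%:R :> R by rewrite ltr_pM2r ?invr_gt0// ltr_nat.
move=> A mA; have := brownian_increment B_brownian u0 uu mA.
have -> : i.+1%:R / n%:R - i%:R / n%:R = n%:R^-1 :> R by rewrite -natr1; ring.
by [].
Qed.

Lemma brownian_factor_independent n : mutually_independent Q (brownian_factor n).
Proof.
apply: (@mutually_independent_comp _ _ _ _
  (fun i w => B (i.+1%:R / n%:R) w - B (i%:R / n%:R) w) (fun x => expR (x + lambda / n%:R))).
  by apply: measurableT_comp => //; exact: measurable_funD.
pose u (i : nat) : R := i%:R / n%:R.
have u0 : 0 <= u 0%N by rewrite /u mul0r.
have nu : nondecreasing_seq u by move=> i j ij; rewrite ler_wpM2r ?invr_ge0// ler_nat.
exact: (brownian_independent B_brownian u0 nu).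
Qed.

Let cb w : {within `[0, +oo[, continuous (b w)}.
Proof.
move=> s; apply: cvgD; first exact: (brownian_continuous B_brownian).
apply: continuous_subspaceT => {}s.
by apply: cvgM; [exact: cvg_cst|exact: cvg_id].
Qed.

Definition limit_x w : R := expR (b w t).
Definition limit_z w : R := expR (b w t) * \int[leb]_(s in `[0, t]) expR (- (2 * b w s)).

Let mb s : measurable_fun setT (fun w => b w s).
Proof. by apply: measurable_funD => //; exact: measurable_funPT. Qed.

Lemma measurable_limit_x : measurable_fun setT limit_x.
Proof. exact: measurableT_comp. Qed.

Lemma measurable_brownian_factor n i : measurable_fun setT (brownian_factor n i).
Proof.
apply: measurableT_comp => //; apply: measurable_funD => //.
by apply: measurable_funB; exact: measurable_funPT.
Qed.

Let m n := Num.truncn (n%:R * t).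

Lemma cvg_brownian_walk_X w :
  (fun n => walk_X (fun i => brownian_factor n i w) (m n)) @ \oo --> expR (b w t - b w 0).
Proof.
under eq_fun do under eq_fun do rewrite brownian_factorE.
exact: cvg_walk_X_path.
Qed.

Lemma cvg_brownian_walk_Z w :
  (fun n => walk_Z n%:R^-1 (fun i => brownian_factor n i w) (m n)) @ \oo -->
  expR (b w 0) * limit_z w.
Proof.
under eq_fun do under eq_fun do rewrite brownian_factorE.
by rewrite /limit_z mulrA -expRD; exact: cvg_walk_Z_path.
Qed.

(** The integral over time is measurable as a limit of measurable walks. The limit is required at
    every [w], hence the compensating factor [expR (b w 0)]. *)
Lemma measurable_limit_z : measurable_fun setT limit_z.
Proof.
have -> : limit_z = (fun w => expR (- b w 0) * (expR (b w 0) * limit_z w)).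
  by apply/funext => w; rewrite mulrA -expRD addNr expR0 mul1r.
apply: measurable_funM; first by apply: measurableT_comp => //; exact: measurableT_comp.
apply: (@measurable_fun_cvg _ _ _ _ (fun n w => walk_Z n%:R^-1 (fun i => brownian_factor n i w) (m n))).
  by move=> n; apply: measurable_walk_Z => i _; exact: measurable_brownian_factor.
by move=> w _; exact: cvg_brownian_walk_Z.
Qed.

Lemma limit_z_ge0 w : 0 <= limit_z w.
Proof. by rewrite mulr_ge0 ?expR_ge0//; apply: Rintegral_ge0 => s _; exact: expR_ge0. Qed.

Lemma cvg_brownian_walk_obs (phi : R -> R -> R) : poly2 phi ->
  (fun n => \int[Q]_w walk_obs phi n%:R^-1 (fun i => brownian_factor n i w) (m n)) @ \oo -->
  \int[Q]_w phi (1 + limit_x w)^-1 (1 + limit_z w)^-1.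
Proof.
move=> pphi; have [C HC] := poly2_bounded pphi.
apply: (@Rintegral_dominated _ _ _ _ _ _ C).
- by move=> n; apply: measurable_walk_obs => // i; exact: measurable_brownian_factor.
- apply: measurable_poly2 => //; apply: measurable_funVr; apply: measurable_funD => //.
    exact: measurable_limit_x.
  exact: measurable_limit_z.
- by move=> n w; apply: walk_obs_bounded => // i; exact: expR_gt0.
(* Only here is the starting point used: almost surely it removes the corrections in [b w 0]. *)
apply: filterS (brownian_start B_brownian) => w B0.
have b0 : b w 0 = 0 by rewrite /b /drifted B0 mulr0 addr0.
apply: poly2_cvg => //.
- apply: cvgV; first by rewrite gt_eqF// addr_gt0 ?expR_gt0.
  apply: cvgD; first exact: cvg_cst.
  by rewrite -[X in _ --> X](_ : expR (b w t - b w 0) = _);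
    [exact: cvg_brownian_walk_X|rewrite b0 subr0].
- apply: cvgV; first by rewrite gt_eqF// ltr_pwDl ?limit_z_ge0.
  apply: cvgD; first exact: cvg_cst.
  by rewrite -[X in _ --> X](_ : expR (b w 0) * limit_z w = _);
    [exact: cvg_brownian_walk_Z|rewrite b0 expR0 mul1r].
Qed.

End brownian.

Lemma expectation_Rintegral (R : realType) (d : measure_display) (T : measurableType d)
    (P : probability T R) (f : T -> R) (M : R) :
  measurable_fun setT f -> (forall w, `|f w| <= M) ->
  ('E_P[f] = (\int[P]_w f w)%:E)%E.
Proof.
move=> mf fM; rewrite unlock /Rintegral fineK//.
by apply: integrable_fin_num => //; exact: (@bounded_integrable _ _ _ P _ M).
Qed.

Lemma cvg_gig_walk_obs (R : realType) (lambda t : R) (d : nat -> measure_display)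
    (T : forall n : nat, measurableType (d n)) (P : forall n : nat, probability (T n) R)
    (gamma : forall n : nat, nat -> {RV (P n) >-> R})
    (d' : measure_display) (T' : measurableType d') (Q : probability T' R)
    (B : R -> {RV Q >-> R}) (phi : R -> R -> R) :
  0 < t ->
  (forall n, (0 < n)%N -> mutually_independent (P n) (fun i w => gamma n i w)) ->
  (forall n, (0 < n)%N -> forall i, has_gig_law lambda (Num.sqrt n%:R) (gamma n i)) ->
  standard_brownian_motion B ->
  poly2 phi -> (forall a b, 0 < a <= 1 -> 0 < b <= 1 -> 0 <= phi a b) ->
  (fun n => \int[P n]_w walk_obs phi n%:R^-1 (fun i => pos_part1 (gamma n i w))
      (Num.truncn (n%:R * t))) @ \oo -->
  \int[Q]_w phi (1 + limit_x B lambda t w)^-1 (1 + limit_z B lambda t w)^-1.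
Proof.
move=> t0 gamma_indep gamma_law bB pphi phi0.
have large_gt0 n : 2 * `|lambda| + 16 <= n%:R -> (0 < n)%N.
  by move=> h; rewrite -(ltr0n R); apply: lt_le_trans h; rewrite ltr_wpDl// mulr_ge0.
have dg : diffusive_moments lambda (fun n => gig_sinh (n%:R / 2) lambda).
  apply: gig_diffusive => n hn; have n0 := large_gt0 _ hn.
  exact: (gig_mass_gt0 (gamma_law n n0)).
have := @cvg_lindeberg_walk _ _ _ _ _ _ _ (fun n i w => pos_part1 (gamma n i w))
  (brownian_factor B lambda) _ _ _ _ phi t0 _ _ _ _ dg (lognormal_diffusive lambda) pphi phi0.
move=> /(_ P Q) L.
rewrite -[X in _ --> X]add0r.
pose bw n := \int[Q]_w walk_obs phi n%:R^-1 (fun i => brownian_factor B lambda n i w)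
  (Num.truncn (n%:R * t)).
rewrite (_ : (fun n => _) = (fun n => (\int[P n]_w walk_obs phi n%:R^-1
    (fun i => pos_part1 (gamma n i w)) (Num.truncn (n%:R * t)) - bw n) + bw n)); last first.
  by apply/funext => n; rewrite subrK.
apply: cvgD; last exact: cvg_brownian_walk_obs.
apply: L.
- move=> n n0; apply: mutually_independent_comp; first exact: measurable_pos_part1.
  exact: gamma_indep.
- by move=> n n0; exact: brownian_factor_independent.
- near=> n; move=> i.
  have hn : 2 * `|lambda| + 16 <= n%:R by near: n; exact: nbhs_infty_ger.
  exact: (gig_sinh_moments (gamma_law n (large_gt0 _ hn))).
- near=> n; move=> i; apply: brownian_factor_moments => //.
  by near: n; exact: nbhs_infty_gt.
Unshelve. all: by end_near. Qed.

Section convergence.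
Variables (R : realType) (lambda t : R) (t_gt0 : 0 < t)
  (d : nat -> measure_display) (T : forall n : nat, measurableType (d n))
  (P : forall n : nat, probability (T n) R)
  (gamma : forall n : nat, nat -> {RV (P n) >-> R})
  (gamma_indep : forall n : nat, (0 < n)%N ->
     mutually_independent (P n) (fun (i : nat) (w : T n) => gamma n i w))
  (gamma_law : forall n : nat, (0 < n)%N -> forall i : nat,
     has_gig_law lambda (Num.sqrt n%:R) (gamma n i))
  (d' : measure_display) (T' : measurableType d') (Q : probability T' R)
  (B : R -> {RV Q >-> R}) (B_brownian : standard_brownian_motion B).

Let gam n i (w : T n) := pos_part1 (gamma n i w).
Let m (n : nat) := Num.truncn (n%:R * t).
Let x := limit_x B lambda t.
Let z := limit_z B lambda t.

Let mgam n i : measurable_fun setT (@gam n i).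
Proof. by apply: measurableT_comp => //; exact: measurable_pos_part1. Qed.

Let gam_gt0 n (w : T n) i : 0 < gam i w. Proof. exact: pos_part1_gt0. Qed.

Let mx : measurable_fun setT x. Proof. exact: measurable_limit_x. Qed.
Let mz : measurable_fun setT z. Proof. exact: measurable_limit_z. Qed.

Lemma random_element_walk_b n (g : nat -> T n -> R) (delta : R) k :
  (forall i, measurable_fun setT (g i)) ->
  random_element (fun w => walk_b delta (fun i => g i w) k).
Proof.
move=> mg; have mX : measurable_fun setT (fun w => walk_X (fun i => g i w) k).
  by apply: measurable_walk_X => i _; exact: mg.
apply: random_element_lower_mx => //; last exact: measurable_funVr.
by apply: measurable_walk_Z => i _; exact: mg.
Qed.

Lemma limit_mxE w :
  limit_mx (drifted lambda (fun s => B s w)) t = lower_mx (x w) (z w) (x w)^-1.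
Proof. by rewrite /limit_mx expRN. Qed.

Lemma random_element_limit_mx :
  random_element (fun w => limit_mx (drifted lambda (fun s => B s w)) t).
Proof.
under eq_fun do rewrite limit_mxE.
by apply: random_element_lower_mx => //; exact: measurable_funVr.
Qed.

Lemma cvg_Rintegral_gig_walk (f : 'M[R]_2 -> R) (M : R) :
  continuous f -> (forall N, 0 <= f N <= M) ->
  (fun n => \int[P n]_w f (walk_b n%:R^-1 (fun i => gam i w) (m n))) @ \oo -->
  \int[Q]_w f (limit_mx (drifted lambda (fun s => B s w)) t).
Proof.
move=> cf f0M.
pose p n (w : T n) : R := (1 + walk_X (fun i => gam i w) (m n))^-1.
pose v n (w : T n) : R := (1 + walk_Z n%:R^-1 (fun i => gam i w) (m n))^-1.
(* The inverse chart of [x |-> 1 / (1 + x)] in both entries. Since [f] is bounded on all matrices,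
   the bounds on [G] hold for all [a] and [b], whatever the inverses return on the edges. *)
pose G a b : R := f (lower_mx (a^-1 - 1) (b^-1 - 1) (a^-1 - 1)^-1).
have GE n (w : T n) : f (walk_b n%:R^-1 (fun i => gam i w) (m n)) = G (p n w) (v n w).
  by rewrite /G !inv1DK.
have GE' w : f (limit_mx (drifted lambda (fun s => B s w)) t) =
    G (1 + x w)^-1 (1 + z w)^-1.
  by rewrite /G !inv1DK limit_mxE.
under eq_fun do under eq_Rintegral do rewrite GE.
under eq_Rintegral do rewrite GE'.
have inv_m d1 (T1 : measurableType d1) (h : T1 -> R) : measurable_fun setT h ->
    measurable_fun setT (fun w => (1 + h w)^-1).
  by move=> mh; apply: measurable_funVr; exact: measurable_funD.
have X0 n (w : T n) : 0 < walk_X (fun i => gam i w) (m n) by exact: walk_X_gt0.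
apply: (@cvg_expectation_of_poly2 _ _ _ _ _ _ _ _ _ _ _ _ M).
- by move=> n; apply: inv_m; apply: measurable_walk_X.
- by move=> n; apply: inv_m; apply: measurable_walk_Z.
- exact: inv_m.
- exact: inv_m.
- by move=> n w; exact: inv1D_lt1.
- by move=> n w; apply: inv1D_itv; apply: walk_Z_ge0 => //; rewrite invr_ge0.
- by move=> w; apply: inv1D_lt1; exact: expR_gt0.
- by move=> w; apply: inv1D_itv; exact: limit_z_ge0.
- by move=> phi pphi phi0; exact: cvg_gig_walk_obs.
- move=> n; under eq_fun do rewrite -GE.
  by apply: measurable_continuous_mx => //; exact: random_element_walk_b.
- under eq_fun do rewrite -GE'.
  by apply: measurable_continuous_mx => //; exact: random_element_limit_mx.
- by move=> a b; exact: f0M.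
- by move=> a b ha hb; exact: continuous_mx_chart.
Qed.

Lemma expectation_walk_pos_part1 (f : 'M[R]_2 -> R) n : (0 < n)%N -> continuous f ->
  ('E_(P n)[fun w => f (walk_b n%:R^-1 (fun i => gamma n i w) (m n))] =
   'E_(P n)[fun w => f (walk_b n%:R^-1 (fun i => gam i w) (m n))])%E.
Proof.
move=> n0 cf; rewrite unlock; apply: ae_eq_integral => //.
- apply/measurable_EFinP; apply: measurable_continuous_mx => //.
  exact: random_element_walk_b.
- apply/measurable_EFinP; apply: measurable_continuous_mx => //.
  exact: random_element_walk_b.
apply: filterS (gig_pos_ae (gamma_law n0)) => w gw _.
by congr (f (walk_b _ _ _))%:E; apply/funext => i; rewrite /gam gw.
Qed.

Lemma cvg_expectation_gig_walk (f : 'M[R]_2 -> R) (M : R) :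
  continuous f -> (forall N, `|f N| <= M) ->
  ('E_(P n)[fun w => f (walk_b n%:R^-1 (fun i => gamma n i w) (m n))] @[n --> \oo]
    --> 'E_Q[fun w => f (limit_mx (drifted lambda (fun s => B s w)) t)])%E.
Proof.
(* Adding [M] makes the test function nonnegative, as the polynomial approximation demands. *)
move=> cf fM; pose h N := f N + M.
have ch : continuous h by move=> N; exact: (cvgD (cf N) (cvg_cst M)).
have hM N : 0 <= h N <= M + M.
  by rewrite lerD2r -lerBlDr sub0r -ler_norml.
have mf n : measurable_fun setT
    (fun w : T n => f (walk_b n%:R^-1 (fun i => gam i w) (m n))).
  by apply: measurable_continuous_mx => //; exact: random_element_walk_b.
have mf' : measurable_fun setT (fun w => f (limit_mx (drifted lambda (fun s => B s w)) t)).
  by apply: measurable_continuous_mx => //; exact: random_element_limit_mx.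
have shift d1 (T1 : measurableType d1) (P1 : probability T1 R) (Y : T1 -> 'M[R]_2) :
    measurable_fun setT (f \o Y) ->
    \int[P1]_w f (Y w) = \int[P1]_w h (Y w) - M.
  move=> mY; rewrite /h RintegralD//.
  - by rewrite Rintegral_cst// [X in fine X]probability_setT mulr1 addrK.
  - exact: (@bounded_integrable _ _ _ P1 _ M).
  - by apply: (@bounded_integrable _ _ _ P1 _ `|M|).
rewrite (expectation_Rintegral _ mf' (fun w => fM _)).
apply: (@cvg_trans _ ((fun n =>
    (\int[P n]_w f (walk_b n%:R^-1 (fun i => gam i w) (m n)))%:E) @ \oo)).
  (* Nothing is known about the law of [gamma 0], so the passage to [pos_part1] holds for positive
     [n] only, which suffices for the limit. *)
  apply: near_eq_cvg; near=> n.
  have n0 : (0 < n)%N by near: n; exact: nbhs_infty_gt.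
  by rewrite expectation_walk_pos_part1// (expectation_Rintegral _ (mf n) (fun w => fM _)).
apply: cvg_EFin; first exact: nearW.
rewrite shift//; under eq_fun do rewrite /= shift//.
by apply: cvgB; [exact: cvg_Rintegral_gig_walk ch hM|exact: cvg_cst].
Unshelve. all: by end_near. Qed.

End convergence.

Theorem theorem7p3 (R : realType) (lambda t : R) (t_gt0 : 0 < t)
  (d : nat -> measure_display) (T : forall n : nat, measurableType (d n))
  (P : forall n : nat, probability (T n) R)
  (gamma : forall n : nat, nat -> {RV (P n) >-> R})
  (gamma_indep : forall n : nat, (0 < n)%N ->
     mutually_independent (P n) (fun (i : nat) (w : T n) => gamma n i w))
  (gamma_law : forall n : nat, (0 < n)%N -> forall i : nat,
     has_gig_law lambda (Num.sqrt n%:R) (gamma n i))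
  (d' : measure_display) (T' : measurableType d') (Q : probability T' R)
  (B : R -> {RV Q >-> R}) (B_brownian : standard_brownian_motion B) :
  cvg_in_law P Q
    (fun (n : nat) (w : T n) =>
       walk_b (n%:R^-1) (fun i => gamma n i w) (Num.truncn (n%:R * t)))
    (fun w : T' => limit_mx (drifted lambda (fun s => B s w)) t).
Proof.
split.
- by move=> n; apply: random_element_walk_b => i; exact: measurable_funPT.
- exact: random_element_limit_mx.
- by move=> f cf [M fM]; exact: cvg_expectation_gig_walk cf fM.
Qed.
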